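(* Assume $Q\ge0$, $(A-\frac\rho2I,\sqrt Q)$ is detectable, and $(A+G-\frac\rho2I,\sqrt Q(I-\Gamma))$ is detectable. Let $(\mathrm{R}_P)$ and $(\mathrm R_\Pi)$ denote the algebraic Riccati equations $$(\mathrm R_P)\ \ \rho P=A^TP+PA-PBR^{-1}B^TP+Q,\qquad (\mathrm R_\Pi)\ \ \rho\Pi=(A+G)^T\Pi+\Pi(A+G)-\Pi BR^{-1}B^T\Pi+\hat Q,$$ with $\hat Q=(I-\Gamma)^TQ(I-\Gamma)$. Then the following statements are equivalent: (i) The decentralized control laws $\hat u_i$ described in the context are well defined (i.e. there are symmetric $P,\Pi$ solving $(\mathrm R_P)$, $(\mathrm R_\Pi)$ and associated $s,\bar x\in C_{\rho/2}([0,\infty),\mathbb R^n)$), and with them, for any initial condition $(\hat x_1(0),\dots,\hat x_N(0))$ such that the $\hat x_i(0)$ are mutually independent with common mean $\bar x_0$, $\max_i\mathbb E\|\hat x_i(0)\|^2<C_0$ ($C_0$ independent of $N$), and $\{\hat x_i(0)\}$ independent of $\{W_i\}$, $$\sum_{i=1}^N\mathbb E\int_0^\infty e^{-\rho t}\big(\|\hat x_i(t)\|^2+\|\hat u_i(t)\|^2\big)dt<\infty.$$ (ii) $(\mathrm R_P)$ and $(\mathrm R_\Pi)$ admit unique solutions $P\ge0$, $\Pi\ge0$, respectively, and $\bar A+G-\frac\rho2I$ is Hurwitz, where $\bar A=A-BR^{-1}B^TP$. (iii) $(A-\frac\rho2I,B)$ is stabilizable, $(A+G-\frac\rho2I,B)$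 is stabilizable, and $\bar A+G-\frac\rho2I$ is Hurwitz, where $\bar A=A-BR^{-1}B^TP$ with $P$ the positive semidefinite solution of $(\mathrm R_P)$.
   Context: $N$ is the number of agents, $\rho>0$ a discount constant. $A,G,\Gamma,Q\in\mathbb R^{n\times n}$, $B\in\mathbb R^{n\times r}$, $R\in\mathbb R^{r\times r}$, $\eta\in\mathbb R^n$ are constant, $Q,R$ symmetric, $R>0$. $C_{\rho/2}([0,\infty),\mathbb R^n)$ is the set of continuous $g:[0,\infty)\to\mathbb R^n$ with $\int_0^\infty e^{-\rho t}\|g(t)\|^2dt<\infty$; $f,\sigma\in C_{\rho/2}([0,\infty),\mathbb R^n)$. $W_1,\dots,W_N$ are independent one-dimensional Brownian motions. A matrix is Hurwitz if all its eigenvalues have negative real part. Control laws: given symmetric solutions $P,\Pi$ of the two Riccati equations in the claim, $s,\bar x\in C_{\rho/2}([0,\infty),\mathbb R^n)$ are determined by $$\rho s=\dot s+[A+G-BR^{-1}B^T\Pi]^Ts+\Pi f-\bar\eta,\qquad \frac{d\bar x}{dt}=(A+G)\bar x-BR^{-1}B^T(\Pi\bar x+s)+f,\quad \bar x(0)=\bar x_0,$$ with $\bar\eta=Q\eta-\Gamma^TQ\eta$, and for $t\ge0$, $i=1,\dots,N$, $$\hat u_i(t)=-R^{-1}B^T[P\hat x_i(t)+(\Pi-P)\bar x(t)+s(t)],$$ where $\hat x_i$ are the closed-loop states: $d\hat x_i=[A\hat x_i+B\hat u_i+G\hat x^{(N)}+f]dt+\sigma dW_i$, $\hat x^{(N)}=\frac1N\sum_{j=1}^N\hat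 x_j$.
   Formalization: The number of agents is assumed to be N ≥ 2, because for N = 1 statement (i) does not imply (ii) or (iii): take n = 1, B = 0, R = 1, A = ρ/2+1, G = −2, Q = 1, η = f = σ = 0. *)

(* Defs.v *)
From HB Require Import structures.
From mathcomp Require Import all_boot all_order all_algebra.
From mathcomp Require Import complex.
From mathcomp Require Import all_classical all_reals all_analysis.
Set Implicit Arguments.
Unset Strict Implicit.
Unset Printing Implicit Defensive.
Import Order.TTheory GRing.Theory Num.Theory.
Import numFieldNormedType.Exports.
Local Open Scope classical_set_scope.
Local Open Scope ring_scope.

Section matrices.
Context {R : realType}.

Definition symmetric_mx n (M : 'M[R]_n) := M^T = M.

Definition psd n (M : 'M[R]_n) :=
  symmetric_mx M /\ forall v : 'cV[R]_n, 0 <= (v^T *m M *m v) 0 0.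

Definition posdef n (M : 'M[R]_n) :=
  symmetric_mx M /\ forall v : 'cV[R]_n, v != 0 -> 0 < (v^T *m M *m v) 0 0.

Definition is_psd_sqrt n (Q S : 'M[R]_n) := psd S /\ S *m S = Q.

(* Complex eigenvalues of the real matrix M. *)
Definition hurwitz n (M : 'M[R]_n) :=
  forall z : R[i], eigenvalue (map_mx (real_complex R) M) z -> complex.Re z < 0.

Definition stabilizable n r (A : 'M[R]_n) (B : 'M[R]_(n, r)) :=
  exists K : 'M[R]_(r, n), hurwitz (A + B *m K).

Definition detectable n m (A : 'M[R]_n) (C : 'M[R]_(m, n)) :=
  exists L : 'M[R]_(n, m), hurwitz (A + L *m C).

Definition riccati n r (rho : R) (A : 'M[R]_n) (B : 'M[R]_(n, r))
    (Rw : 'M[R]_r) (Q P : 'M[R]_n) :=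
  rho *: P = A^T *m P + P *m A - P *m B *m invmx Rw *m B^T *m P + Q.

Definition unique_psd_solution n (E : 'M[R]_n -> Prop) (P : 'M[R]_n) :=
  [/\ psd P, E P & forall P', psd P' -> E P' -> P' = P].

(* Squared Euclidean norm; the library's `|v| is the max norm. *)
Definition sqnorm n (v : 'cV[R]_n) : R := \sum_(j < n) v j 0 ^+ 2.

(* The space C_{rho/2}([0, oo), R^n). *)
Definition C_half n (rho : R) (g : R -> 'cV[R]_n) :=
  {within `[0, +oo[, continuous g} /\
  (\int[lebesgue_measure]_(t in `[0%R, +oo[)
     (expR (- rho * t) * sqnorm (g t))%:E < +oo)%E.

End matrices.

Section probability_notions.
Context {R : realType} {d : measure_display} {T : measurableType d}.
Implicit Types (P : probability T R).

(* Sigma-algebra generated by the real functions X i, for i in D. *)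
Definition sigma_of (I : Type) (D : set I) (X : I -> T -> R) : set (set T) :=
  <<s \bigcup_(i in D) preimage_set_system setT (X i) measurable >>.

Definition indep2 P (F G : set (set T)) :=
  forall E1 E2, F E1 -> G E2 -> P (E1 `&` E2) = (P E1 * P E2)%E.

Definition indep_family P (I : finType) (F : I -> set (set T)) :=
  forall (J : {set I}) (E : I -> set T), (forall i, F i (E i)) ->
    P (\bigcap_(i in [set` J]) E i) = (\prod_(i in J) P (E i))%E.

(* Standard one-dimensional Brownian motion; only times t >= 0 matter.  The
   second parameter of normal_prob is a standard deviation. *)
Definition brownian P (W : R -> T -> R) :=
  [/\ forall t, 0 <= t -> measurable_fun setT (W t),
      {ae P, forall w, W 0 w = 0},
      forall s t, 0 <= s -> s < t -> forall E, measurable E ->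
        P ((fun w => W t w - W s w) @^-1` E)
          = normal_prob 0 (Num.sqrt (t - s)) E,
      forall s t, 0 <= s -> s < t ->
        indep2 P (sigma_of [set u | 0 <= u <= s] W)
                 (sigma_of [set: unit] (fun _ w => W t w - W s w)) &
      forall w, {within `[0, +oo[, continuous (fun t => W t w)}].

Definition indep_brownians P (N : nat) (W : 'I_N -> R -> T -> R) :=
  (forall i, brownian P (W i)) /\
  indep_family P (fun i => sigma_of [set t | 0 <= t] (W i)).

Definition wiener_sum n (sigma : R -> 'cV[R]_n) (W : R -> T -> R)
    (t : R) (m : nat) (w : T) : 'cV[R]_n :=
  \sum_(k < m) (W (t * k.+1%:R / m%:R) w - W (t * k%:R / m%:R) w)
                 *: sigma (t * k%:R / m%:R).

(* I = \int_0^t sigma(u) dW(u): for a continuous deterministic integrand the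
   Ito integral is the L^2 limit of the left-point Riemann sums. *)
Definition is_wiener_integral P n (sigma : R -> 'cV[R]_n) (W : R -> T -> R)
    (t : R) (I : T -> 'cV[R]_n) :=
  (forall j, measurable_fun setT (fun w => I w j 0)) /\
  (fun m => \int[P]_w (sqnorm (wiener_sum sigma W t m w - I w))%:E)%E
    @ \oo --> 0%E.

End probability_notions.

(* (T', P') is an extension of the probability space (T, P): random variables
   X on T are transported to T' as X \o p, with unchanged joint laws. *)
Definition prob_extension {R : realType} {d d' : measure_display}
    {T : measurableType d} {T' : measurableType d'}
    (P : probability T R) (P' : probability T' R) (p : T' -> T) :=
  measurable_fun setT p /\
  forall E, measurable E -> P' (p @^-1` E) = P E.

Section control.
Context {R : realType} {n r : nat}.
Variables (rho : R) (A G Gam Q : 'M[R]_n) (B : 'M[R]_(n, r)) (Rw : 'M[R]_r).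
Variables (eta : 'cV[R]_n) (f sigma : R -> 'cV[R]_n).

Definition Qhat : 'M[R]_n := (1%:M - Gam)^T *m Q *m (1%:M - Gam).

Definition etabar : 'cV[R]_n := Q *m eta - Gam^T *m Q *m eta.

(* In the next two definitions the equation is imposed on t > 0; membership in
   C_half gives continuity at 0. *)
Definition offset_eq (Pi : 'M[R]_n) (s : R -> 'cV[R]_n) :=
  forall t, 0 < t -> derivable s t 1 /\
    rho *: s t = derive1 s t + (A + G - B *m invmx Rw *m B^T *m Pi)^T *m s t
                 + Pi *m f t - etabar.

Definition mean_field_eq (Pi : 'M[R]_n) (s : R -> 'cV[R]_n)
    (x0 : 'cV[R]_n) (xbar : R -> 'cV[R]_n) :=
  xbar 0 = x0 /\
  forall t, 0 < t -> derivable xbar t 1 /\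
    derive1 xbar t = (A + G) *m xbar t
                 - B *m invmx Rw *m B^T *m (Pi *m xbar t + s t) + f t.

Definition control_law (P Pi : 'M[R]_n) (s xbar : R -> 'cV[R]_n)
    (t : R) (x : 'cV[R]_n) : 'cV[R]_r :=
  - (invmx Rw *m B^T *m (P *m x + (Pi - P) *m xbar t + s t)).

Section closed_loop.
Context {d : measure_display} {T : measurableType d} (Pr : probability T R).
Context {N : nat} (W : 'I_N -> R -> T -> R).

Definition average (x : 'I_N -> R -> T -> 'cV[R]_n) (t : R) (w : T) :
  'cV[R]_n := N%:R^-1 *: \sum_(i < N) x i t w.

(* x solves
     dx_i = [A x_i + B u_i + G x^(N) + f] dt + sigma dW_i,  i = 1, ..., N,
   with u_i(t) = u t (x_i(t)), in integrated form.  The noise is additive with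
   deterministic intensity, so solutions are determined path by path by the
   initial value and the Wiener integrals; adaptedness need not be imposed. *)
Definition closed_loop (u : R -> 'cV[R]_n -> 'cV[R]_r)
    (x : 'I_N -> R -> T -> 'cV[R]_n) :=
  forall i,
  [/\ forall t, 0 <= t -> forall j, measurable_fun setT (fun w => x i t w j 0),
      forall w, {within `[0, +oo[, continuous (fun t => x i t w)} &
      forall t, 0 <= t -> exists I : T -> 'cV[R]_n,
        is_wiener_integral Pr sigma (W i) t I /\
        {ae Pr, forall w, forall j, x i t w j 0 = x i 0 w j 0
          + \int[lebesgue_measure]_(v in `[0, t])
              ((A *m x i v w + B *m u v (x i v w) + G *m average x v w + f v)
                 j 0)
          + I w j 0}].

Definition admissible_initial (x0 : 'cV[R]_n) (xi : 'I_N -> T -> 'cV[R]_n) :=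
  [/\ forall i j, measurable_fun setT (fun w => xi i w j 0),
      indep_family Pr (fun i => sigma_of [set: 'I_n] (fun j w => xi i w j 0)),
      forall i j, ('E_Pr[fun w => xi i w j 0%R])%E = (x0 j 0)%:E,
      exists C0 : R, forall i, ('E_Pr[fun w => sqnorm (xi i w)] < C0%:E)%E &
      indep2 Pr
        (sigma_of [set: 'I_N * 'I_n] (fun k w => xi k.1 w k.2 0))
        (sigma_of [set k : 'I_N * R | 0 <= k.2] (fun k => W k.1 k.2))].

(* Sum over i of E int_0^oo e^{-rho t} (|x_i|^2 + |u_i|^2) dt. *)
Definition total_energy (u : R -> 'cV[R]_n -> 'cV[R]_r)
    (x : 'I_N -> R -> T -> 'cV[R]_n) : \bar R :=
  (\sum_(i < N) \int[Pr]_w \int[lebesgue_measure]_(t in `[0%R, +oo[)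
     (expR (- rho * t) * (sqnorm (x i t w) + sqnorm (u t (x i t w))))%:E)%E.

End closed_loop.
End control.

(* Main.v *)
Require Import Defs.
From HB Require Import structures.
From mathcomp Require Import all_boot all_order all_algebra.
From mathcomp Require Import complex.
From mathcomp Require Import all_classical all_reals all_analysis.
From mathcomp Require Import measurable_realfun.
From mathcomp Require Import ring lra.
Set Implicit Arguments.
Unset Strict Implicit.
Unset Printing Implicit Defensive.
Import Order.TTheory GRing.Theory Num.Theory.
Import numFieldNormedType.Exports.
Local Open Scope classical_set_scope.
Local Open Scope ring_scope.

(** Subtracting the Wiener integrals, the deviation of the population mean from
    the mean field and the deviations of the agents from their mean solve linear
    equations with matrices Abar + G and Abar, so a quadratic Lyapunov function
    bounds their discounted energy by that of the initial values and of the
    noise.  Conversely, the closed loop is affine in the initial states: letting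
    one agent start at the mean plus or minus a vector a with equal probability,
    finiteness of the energy makes exp(t Abar) a and exp(t (Abar + G)) a square
    integrable for the weight exp(- rho t), which forces both shifted matrices
    to be Hurwitz.  Kleinman's iteration solves the Riccati equations under
    stabilizability, and detectability makes positive semidefinite solutions
    stabilizing, hence unique. *)

(** * Quadratic forms *)

Section bilinear_forms.
Context {R : realType}.

(** The notion of solution shapes the proof. [closed_loop] asks for paths that are continuous for
    every outcome, whereas a Wiener integral at a fixed time is only an L^2 limit. Solutions to
    which (i) can be applied must be exhibited, so a version of the Wiener integral with all paths
    continuous is built from a maximal inequality. Given solutions are compared with it at dyadic
    times, and continuity extends the equation to all times outside a single null set. A random
    initial state must be independent of the Brownian motions, and the given space may carry nothing
    else; a fair coin is therefore adjoined, which is possible because (i) ranges over extensions of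
    the space. Comparing two distinct agents isolates exp(t Abar); this uses at least two agents. In
    (i) the matrix P is only symmetric: it turns out positive semidefinite because Abar - rho/2 is
    shown to be Hurwitz. The matrix Pi of (ii) comes from Kleinman's iteration, since the feedback -
    R^-1 B^T P makes A + G - rho/2 Hurwitz. *)

Definition bform n m (M : 'M[R]_(n, m)) (u : 'cV[R]_n) (v : 'cV[R]_m) : R :=
  (u^T *m M *m v) 0 0.

Lemma bformE n m (M : 'M[R]_(n, m)) u v :
  bform M u v = \sum_(i < n) \sum_(j < m) u i 0 * M i j * v j 0.
Proof.
rewrite /bform mxE exchange_big; apply: eq_bigr => j _ /=.
by rewrite mxE mulr_suml; apply: eq_bigr => i _; rewrite mxE.
Qed.

Section arith.
Variables n m : nat.
Implicit Types (M N : 'M[R]_(n, m)) (u : 'cV[R]_n) (v : 'cV[R]_m).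

Lemma bformDl M u1 u2 v : bform M (u1 + u2) v = bform M u1 v + bform M u2 v.
Proof. by rewrite /bform linearD !mulmxDl mxE. Qed.

Lemma bformDr M u v1 v2 : bform M u (v1 + v2) = bform M u v1 + bform M u v2.
Proof. by rewrite /bform mulmxDr mxE. Qed.

Lemma bformNl M u v : bform M (- u) v = - bform M u v.
Proof. by rewrite /bform linearN !mulNmx mxE. Qed.

Lemma bformNr M u v : bform M u (- v) = - bform M u v.
Proof. by rewrite /bform mulmxN mxE. Qed.

Lemma bformZl M c u v : bform M (c *: u) v = c * bform M u v.
Proof. by rewrite /bform linearZ -!scalemxAl mxE. Qed.

Lemma bformZr M c u v : bform M u (c *: v) = c * bform M u v.
Proof. by rewrite /bform -scalemxAr mxE. Qed.

Lemma bformDm M N u v : bform (M + N) u v = bform M u v + bform N u v.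
Proof. by rewrite /bform mulmxDr mulmxDl mxE. Qed.

Lemma bformNm M u v : bform (- M) u v = - bform M u v.
Proof. by rewrite /bform mulmxN mulNmx mxE. Qed.

Lemma bformZm c M u v : bform (c *: M) u v = c * bform M u v.
Proof. by rewrite /bform -scalemxAr -scalemxAl mxE. Qed.

Lemma bform0l M v : bform M 0 v = 0.
Proof. by rewrite /bform trmx0 !mul0mx mxE. Qed.

Lemma bformT M u v : bform M u v = bform M^T v u.
Proof.
by rewrite !bformE exchange_big; apply: eq_bigr => i _; apply: eq_bigr => j _;
  rewrite !mxE; ring.
Qed.

Lemma bformMr p M (X : 'M[R]_(m, p)) u (v : 'cV[R]_p) :
  bform M u (X *m v) = bform (M *m X) u v.
Proof. by rewrite /bform !mulmxA. Qed.

Lemma bformMl p M (X : 'M[R]_(n, p)) (u : 'cV[R]_p) v :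
  bform M (X *m u) v = bform (X^T *m M) u v.
Proof. by rewrite /bform trmx_mul !mulmxA. Qed.

Lemma bform_le M u v :
  `|bform M u v| <= (\sum_i \sum_j `|M i j|) * (sqnorm u + sqnorm v).
Proof.
rewrite bformE mulr_suml (le_trans (ler_norm_sum _ _ _))//.
apply: ler_sum => i _; rewrite mulr_suml (le_trans (ler_norm_sum _ _ _))//.
apply: ler_sum => j _; rewrite !normrM -mulrA mulrCA ler_wpM2l//.
have h1 : u i 0 ^+ 2 <= sqnorm u.
  by rewrite /sqnorm (bigD1 i)//= lerDl sumr_ge0// => k _; exact: sqr_ge0.
have h2 : v j 0 ^+ 2 <= sqnorm v.
  by rewrite /sqnorm (bigD1 j)//= lerDl sumr_ge0// => k _; exact: sqr_ge0.
rewrite (le_trans _ (lerD h1 h2))// -(real_normK (num_real (u i 0))).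
rewrite -(real_normK (num_real (v j 0))).
have := sqr_ge0 (`|u i 0| - `|v j 0|); nra.
Qed.

End arith.

Lemma sqnormE n (v : 'cV[R]_n) : sqnorm v = bform 1%:M v v.
Proof.
rewrite /bform mulmx1 mxE; apply: eq_bigr => i _.
by rewrite mxE expr2.
Qed.

Lemma sqnorm_ge0 n (v : 'cV[R]_n) : 0 <= sqnorm v.
Proof. by apply: sumr_ge0 => i _; exact: sqr_ge0. Qed.

Lemma sqnorm_eq0 n (v : 'cV[R]_n) : (sqnorm v == 0) = (v == 0).
Proof.
apply/eqP/eqP => [|->]; last first.
  by rewrite /sqnorm big1// => i _; rewrite mxE expr0n.
move=> h; apply/matrixP => i j; rewrite (ord1 j) mxE.
move: h; rewrite /sqnorm => /eqP; rewrite psumr_eq0; last by move=> *; exact: sqr_ge0.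
by move=> /allP /(_ i); rewrite mem_index_enum sqrf_eq0 => /(_ isT) /eqP.
Qed.

Lemma sqnorm_gt0 n (v : 'cV[R]_n) : (0 < sqnorm v) = (v != 0).
Proof. by rewrite lt_neqAle sqnorm_ge0 andbT eq_sym sqnorm_eq0. Qed.

Lemma sqnorm0 n : sqnorm (0 : 'cV[R]_n) = 0.
Proof. by apply/eqP; rewrite sqnorm_eq0. Qed.

Lemma sqnormN n (v : 'cV[R]_n) : sqnorm (- v) = sqnorm v.
Proof. by apply: eq_bigr => i _; rewrite mxE sqrrN. Qed.

Lemma sqnormZ n c (v : 'cV[R]_n) : sqnorm (c *: v) = c ^+ 2 * sqnorm v.
Proof. by rewrite mulr_sumr; apply: eq_bigr => i _; rewrite mxE exprMn. Qed.

Lemma sqnormD_le n (u v : 'cV[R]_n) :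
  sqnorm (u + v) <= 2 * (sqnorm u + sqnorm v).
Proof.
rewrite /sqnorm -big_split mulr_sumr; apply: ler_sum => i _ /=; rewrite mxE.
have := sqr_ge0 (u i 0 - v i 0); nra.
Qed.

Lemma sqnormB_le n (u v : 'cV[R]_n) :
  sqnorm (u - v) <= 2 * (sqnorm u + sqnorm v).
Proof. by rewrite -(sqnormN v) sqnormD_le. Qed.

(** Each use of the two-term inequality doubles the constant, hence the power of two; only
    finiteness of energies is at stake, so sharpness does not matter. *)
Lemma sqnorm_sum_le n (I : Type) (s : seq I) (v : I -> 'cV[R]_n) :
  sqnorm (\sum_(i <- s) v i) <= 2 ^+ size s * \sum_(i <- s) sqnorm (v i).
Proof.
elim: s => [|i s IH]; first by rewrite !big_nil sqnorm0 mulr0.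
rewrite !big_cons /= exprS (le_trans (sqnormD_le _ _))// -mulrA ler_pM2l//.
rewrite mulrDr lerD// -[leLHS]mul1r ler_wpM2r ?sqnorm_ge0// exprn_ege1//.
by rewrite ler1n.
Qed.

Lemma sqnorm_mulmx_le n m (M : 'M[R]_(n, m)) :
  exists2 K, 0 < K & forall v, sqnorm (M *m v) <= K * sqnorm v.
Proof.
exists ((\sum_i \sum_j `|(M^T *m M) i j|) * 2 + 1).
  by rewrite ltr_wpDl// mulr_ge0// sumr_ge0// => i _; exact: sumr_ge0.
move=> v; rewrite sqnormE bformMl bformMr mulmx1.
have := bform_le (M^T *m M) v v; have := sqnorm_ge0 v.
set K := \sum_i _ => h1 h2; have := ler_norm (bform (M^T *m M) v v); nra.
Qed.

End bilinear_forms.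

Section definite_matrices.
Context {R : realType}.

Lemma bformC n (M : 'M[R]_n) u v : symmetric_mx M -> bform M u v = bform M v u.
Proof. by move=> sM; rewrite bformT sM. Qed.

Lemma psd_ge0 n (M : 'M[R]_n) v : psd M -> 0 <= bform M v v.
Proof. by case=> _; exact. Qed.

Lemma posdef_psd n (M : 'M[R]_n) : posdef M -> psd M.
Proof.
case=> sM M0; split=> // v; have [->|/M0/ltW//] := eqVneq v 0.
by rewrite mulmx0 mxE.
Qed.

Lemma psd_cauchy_schwarz n (M : 'M[R]_n) u v : psd M ->
  bform M u v ^+ 2 <= bform M u u * bform M v v.
Proof.
move=> pM; have sM := pM.1.
have h (s t : R) : 0 <= s ^+ 2 * bform M u u + 2 * s * t * bform M u v
    + t ^+ 2 * bform M v v.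
  have := psd_ge0 (s *: u + t *: v) pM.
  rewrite !(bformDl, bformDr, bformZl, bformZr) (bformC v u sM); lra.
set a := bform M u u in h *; set b := bform M u v in h *.
set c := bform M v v in h *.
have a0 : 0 <= a by exact: psd_ge0.
have c0 : 0 <= c by exact: psd_ge0.
have [a_eq0|a_neq0] := eqVneq a 0.
  (* With a = 0 this choice turns the form into -(c + 2) b^2, so b = 0. *)
  have h1 := h (- (c + 1)) b.
  rewrite a_eq0 in h1 *.
  suff -> : b = 0 by rewrite expr0n/= mul0r.
  apply/eqP; rewrite -sqrf_eq0 eq_le sqr_ge0 andbT.
  have := sqr_ge0 b; nra.
have agt : 0 < a by rewrite lt_neqAle eq_sym a_neq0.
have := h b (- a).
rewrite (_ : _ + _ = a * (a * c - b ^+ 2)); last by ring.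
by rewrite pmulr_rge0// subr_ge0.
Qed.

(** Cauchy-Schwarz against each basis vector: a zero of the form annihilates every entry of M v. *)
Lemma psd_ker n (M : 'M[R]_n) v : psd M -> bform M v v = 0 -> M *m v = 0.
Proof.
move=> pM Mv; apply/matrixP => i j; rewrite (ord1 j) [RHS]mxE.
have := psd_cauchy_schwarz (delta_mx i 0) v pM.
rewrite Mv mulr0 => h; have {h} : bform M (delta_mx i 0) v = 0.
  by apply/eqP; rewrite -sqrf_eq0 eq_le h sqr_ge0.
by rewrite /bform trmx_delta -rowE -row_mul mxE.
Qed.

Lemma posdef_unit n (M : 'M[R]_n) : posdef M -> M \in unitmx.
Proof.
case=> sM pM; rewrite -row_free_unit -kermx_eq0.
apply/eqP/row_matrixP => i; rewrite row0; apply/eqP; apply: contraT => h.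
have h' : (row i (kermx M))^T != 0.
  by apply: contra h => /eqP/(congr1 trmx); rewrite trmxK trmx0 => ->.
have := pM _ h'; rewrite trmxK -row_mul mulmx_ker row0 mul0mx mxE.
by rewrite ltxx.
Qed.

(** Cauchy-Schwarz for v and M^-1 v gives |v|^4 <= (v^T M v)(v^T M^-1 v), and the second factor is
    at most K |v|^2; this replaces the compactness of the unit sphere and yields the constant
    1/K. *)
Lemma posdef_coercive n (M : 'M[R]_n) : posdef M ->
  exists2 c, 0 < c & forall v, c * sqnorm v <= bform M v v.
Proof.
move=> pM; have uM := posdef_unit pM.
set K := (\sum_i \sum_j `|(invmx M) i j|) * 2 + 1.
have K0 : 0 < K.
  by rewrite ltr_wpDl// mulr_ge0// sumr_ge0// => i _; exact: sumr_ge0.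
exists K^-1; first by rewrite invr_gt0.
move=> v; set N := sqnorm v; rewrite ler_pdivrMl//.
have N0 : 0 <= N := sqnorm_ge0 v.
have Mv0 : 0 <= bform M v v by exact: (psd_ge0 v (posdef_psd pM)).
have := psd_cauchy_schwarz v (invmx M *m v) (posdef_psd pM).
rewrite bformMr mulmxV// -sqnormE bformMr mulmxV// [X in _ * X]bformT trmx1.
rewrite bformMr mul1mx -/N => h.
have := bform_le (invmx M) v v; rewrite -/N => h1.
have {h1} h1 : bform (invmx M) v v <= K * N.
  have := ler_norm (bform (invmx M) v v); rewrite /K; lra.
have h2 : N ^+ 2 <= bform M v v * (K * N).
  by rewrite (le_trans h)// ler_wpM2l.
have [N_eq0|N_neq0] := eqVneq N 0; first by rewrite N_eq0 mulr_ge0// ltW.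
have Np : 0 < N by rewrite lt_neqAle eq_sym N_neq0.
move: h2; rewrite (_ : _ * (K * N) = K * bform M v v * N); last by ring.
by rewrite expr2 ler_pM2r.
Qed.

Lemma bform_bounded n (M : 'M[R]_n) :
  exists2 K, 0 < K & forall u v, `|bform M u v| <= K * (sqnorm u + sqnorm v).
Proof.
exists (\sum_i \sum_j `|M i j| + 1).
  by rewrite ltr_wpDl// sumr_ge0// => i _; exact: sumr_ge0.
move=> u v; apply: (le_trans (bform_le _ _ _)).
by rewrite ler_wpM2r ?addr_ge0 ?sqnorm_ge0// lerDl.
Qed.

Lemma eigenvalue_trmx n (M : 'M[R]_n) z :
  eigenvalue (map_mx (real_complex R) M^T) z =
  eigenvalue (map_mx (real_complex R) M) z.
Proof.
rewrite !eigenvalue_root_char -map_trmx /char_poly /char_poly_mx.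
by rewrite -[in RHS]det_tr linearB/= tr_scalar_mx -map_trmx.
Qed.

Lemma hurwitz_trmx n (M : 'M[R]_n) : hurwitz M -> hurwitz M^T.
Proof. by move=> h z; rewrite eigenvalue_trmx; exact: h. Qed.

(* [a + i b] is then an eigenvector for the eigenvalue [alpha + i beta]. *)
Lemma hurwitzP n (M : 'M[R]_n) : hurwitz M <->
  forall alpha beta (a b : 'cV[R]_n), M *m a = alpha *: a - beta *: b ->
    M *m b = beta *: a + alpha *: b -> (a != 0) || (b != 0) -> alpha < 0.
Proof.
split=> [hM alpha beta a b Ma Mb ab|h z].
  suff /hM : eigenvalue (map_mx (real_complex R) M) (Complex alpha beta) by [].
  rewrite -eigenvalue_trmx; apply/eigenvalueP.
  pose v : 'cV[R[i]]_n := \col_i Complex (a i 0) (b i 0).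
  exists v^T.
    apply/matrixP => i j; rewrite (ord1 i) -map_trmx -trmx_mul mxE mxE.
    rewrite [RHS]mxE mxE mxE.
    have := congr1 (fun X : 'cV_n => X j 0) Ma; rewrite !mxE => e1.
    have := congr1 (fun X : 'cV_n => X j 0) Mb; rewrite !mxE => e2.
    transitivity (Complex (\sum_k M j k * a k 0) (\sum_k M j k * b k 0)).
      transitivity (\sum_k Complex (M j k * a k 0) (M j k * b k 0)).
        by apply: eq_bigr => k _; rewrite !mxE; simpc.
      elim/big_ind3 : _ => // x1 x2 x3 y1 y2 y3 -> -> /=.
      by simpc.
    rewrite e1 e2; simpc; congr Complex; ring.
  apply/eqP => v0; move: ab; rewrite -negb_and => /negP; apply.
  apply/andP; split; apply/eqP/matrixP => i j; rewrite (ord1 j) [RHS]mxE.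
    by have := congr1 (fun X : 'rV[R[i]]_n => complex.Re (X 0 i)) v0; rewrite !mxE.
  by have := congr1 (fun X : 'rV[R[i]]_n => complex.Im (X 0 i)) v0; rewrite !mxE.
rewrite -eigenvalue_trmx => /eigenvalueP[v Mv v0].
apply: (h _ (complex.Im z) (\col_i complex.Re (v 0 i))
  (\col_i complex.Im (v 0 i))).
- apply/matrixP => i j; have := congr1 (fun X : 'rV[R[i]]_n => complex.Re (X 0 i)) Mv.
  rewrite !mxE; case: z {Mv} => x y; case: (v 0 i) => p q /=.
  move=> <-; rewrite raddf_sum; apply: eq_bigr => k _.
  by rewrite !mxE; case: (v 0 k) => c e /=; ring.
- apply/matrixP => i j; have := congr1 (fun X : 'rV[R[i]]_n => complex.Im (X 0 i)) Mv.
  rewrite !mxE; case: z {Mv} => x y; case: (v 0 i) => p q /=.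
  rewrite (_ : x * q + y * p = y * p + x * q); last by ring.
  move=> <-; rewrite raddf_sum; apply: eq_bigr => k _.
  by rewrite !mxE; case: (v 0 k) => c e /=; ring.
- rewrite -negb_and; apply: contra v0 => /andP[/eqP ha /eqP hb].
  apply/eqP/matrixP => i j; rewrite (ord1 i) [RHS]mxE.
  have := congr1 (fun X : 'cV[R]_n => X j 0) ha.
  have := congr1 (fun X : 'cV[R]_n => X j 0) hb.
  by rewrite !mxE; case: (v 0 j) => p q /= -> ->.
Qed.

End definite_matrices.

(** * Lyapunov equations *)

Section lyapunov.
Context {R : realType}.

(* The weights [delta ^ (2 i)] make the off-diagonal part of a lower triangular
   complex matrix [Tr + i Ti] negligible. *)
Lemma trig_dissipative_weights n (Tr Ti : 'M[R]_n) :
  (forall i, Tr i i < 0) ->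
  (forall i j : 'I_n, (i < j)%N -> Tr i j = 0 /\ Ti i j = 0) ->
  exists2 d : 'I_n -> R, (forall i, 0 < d i) &
    forall x y : 'cV[R]_n, (x != 0) || (y != 0) ->
      \sum_i d i * (x i 0 * (Tr *m x - Ti *m y) i 0
                  + y i 0 * (Tr *m y + Ti *m x) i 0) < 0.
Proof.
move=> Tdiag Ttrig.
pose c : R := \big[Num.min/1]_i (- Tr i i).
have c0 : 0 < c.
  by apply/bigmin_gtP; split => // i _; rewrite oppr_gt0.
have cP i : Tr i i <= - c by rewrite lerNr; exact: bigmin_le_cond.
pose K := \sum_i \sum_j (`|Tr i j| + `|Ti i j|).
have K0 : 0 <= K.
  by apply: sumr_ge0 => i _; apply: sumr_ge0 => j _; rewrite addr_ge0.
have KP i j : `|Tr i j| + `|Ti i j| <= K.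
  rewrite /K (bigD1 i)//= (bigD1 j)//= -addrA lerDl addr_ge0//.
    by apply: sumr_ge0 => k _; rewrite addr_ge0.
  by apply: sumr_ge0 => k _; apply: sumr_ge0 => l _; rewrite addr_ge0.
pose nn : R := n%:R.
have nn0 : 0 <= nn by exact: ler0n.
(* The ratio c / D makes [de] at most 1 and 2 n K [de] smaller than c, so that the off-diagonal
   terms cannot outweigh the diagonal ones. *)
pose D := c + 2 * nn * K + 1.
have nK0 : 0 <= nn * K by exact: mulr_ge0.
have D0 : 0 < D by rewrite /D; nra.
pose de := c / D.
have de0 : 0 < de by rewrite divr_gt0.
have de1 : de <= 1 by rewrite ler_pdivrMr// mul1r /D; nra.
have deK : 2 * nn * K * de < c.
  by rewrite mulrCA mulrA ltr_pdivrMr// -mulrA ltr_pM2l// /D; nra.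
exists (fun i => (de ^+ i) ^+ 2) => [i|x y xy0]; first by rewrite !exprn_gt0.
pose N i := x i 0 ^+ 2 + y i 0 ^+ 2.
pose d (i : 'I_n) := (de ^+ i) ^+ 2.
have N0 i : 0 <= N i by rewrite addr_ge0// sqr_ge0.
have d0 i : 0 < d i by rewrite /d !exprn_gt0.
pose S := \sum_i d i * N i.
have S0 : 0 < S.
  rewrite lt_neqAle eq_sym; apply/andP; split; last first.
    by apply: sumr_ge0 => i _; rewrite mulr_ge0// ltW.
  apply: contraTneq xy0 => /eqP; rewrite psumr_eq0; last first.
    by move=> i _; rewrite mulr_ge0// ltW.
  move=> /allP h; rewrite negb_or !negbK; apply/andP; split;
    apply/eqP/matrixP => i j; rewrite (ord1 j) mxE; have := h i;
    rewrite mem_index_enum mulf_eq0 (gt_eqF (d0 i))/= => /(_ isT);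
    by rewrite paddr_eq0 ?sqr_ge0// !sqrf_eq0 => /andP[/eqP ? /eqP ?].
pose t i j := d i * (x i 0 * (Tr i j * x j 0 - Ti i j * y j 0)
                   + y i 0 * (Tr i j * y j 0 + Ti i j * x j 0)).
have -> : \sum_i d i * (x i 0 * (Tr *m x - Ti *m y) i 0
                  + y i 0 * (Tr *m y + Ti *m x) i 0) = \sum_i \sum_j t i j.
  apply: eq_bigr => i _; rewrite !mxE -sumrN -!big_split/= !mulr_sumr.
  rewrite -big_split/= mulr_sumr.
  by apply: eq_bigr => j _; rewrite /t; ring.
have tP i j : t i j <= (if i == j then - c * (d i * N i) else 0)
      + K * de * (d i * N i + d j * N j).
  have r0 : 0 <= K * de * (d i * N i + d j * N j).
    apply: mulr_ge0; first by apply: mulr_ge0 => //; exact: ltW.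
    by apply: addr_ge0; apply: mulr_ge0 => //; exact: ltW.
  have [->|ij] := eqVneq i j.
    rewrite (_ : t j j = d j * (N j * Tr j j)); last by rewrite /t /N; ring.
    rewrite (@le_trans _ _ (- c * (d j * N j)))//; last first.
      rewrite lerDl; apply: mulr_ge0; first by apply: mulr_ge0 => //; exact: ltW.
      by apply: addr_ge0; apply: mulr_ge0 => //; exact: ltW.
    have := mulr_ge0 (ltW (d0 j)) (N0 j).
    by move=> ?; rewrite mulrA [leRHS]mulrC; exact: ler_wpM2l.
  rewrite add0r; have [lt_ij|] := ltnP i j.
    by have [e1 e2] := Ttrig _ _ lt_ij; rewrite /t e1 e2 !mul0r subr0 addr0 !mulr0
      addr0 mulr0.
  rewrite leq_eqVlt => /predU1P[/val_inj e|lt_ji]; first by rewrite e eqxx in ij.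
  pose p := de ^+ i; pose q := de ^+ j.
  have p0 : 0 < p by rewrite exprn_gt0.
  have q0 : 0 < q by rewrite exprn_gt0.
  (* Here j < i, so the row weight has at least one more factor [de] than the column weight: each
     off-diagonal term gains a factor [de]. *)
  have pq : p <= de * q.
    rewrite /p /q -exprS; apply: ler_wiXn2l => //; exact: ltW.
  rewrite /t -/d /d -/p -/q.
  have k1 := KP i j.
  pose u := `|x i 0| + `|y i 0|; pose v := `|x j 0| + `|y j 0|.
  have u0 : 0 <= u by rewrite addr_ge0.
  have v0 : 0 <= v by rewrite addr_ge0.
  have s1 : x i 0 * (Tr i j * x j 0 - Ti i j * y j 0)
                   + y i 0 * (Tr i j * y j 0 + Ti i j * x j 0) <= K * (u * v).
    have e (a b : R) : a * b <= `|a| * `|b| by rewrite -normrM ler_norm.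
    have h1 := e (x i 0) (Tr i j * x j 0); have h2 := e (x i 0) (- (Ti i j * y j 0)).
    have h3 := e (y i 0) (Tr i j * y j 0); have h4 := e (y i 0) (Ti i j * x j 0).
    rewrite normrN in h2; rewrite !normrM in h1 h2 h3 h4.
    rewrite (@le_trans _ _ ((`|Tr i j| + `|Ti i j|) * (u * v)))//; last first.
      by rewrite ler_wpM2r// mulr_ge0.
    rewrite /u /v.
    have a1 := normr_ge0 (Tr i j); have a2 := normr_ge0 (Ti i j).
    set X1 := `|x i 0| in h1 h2 h3 h4 *; set X2 := `|x j 0| in h1 h2 h3 h4 *.
    set Y1 := `|y i 0| in h1 h2 h3 h4 *; set Y2 := `|y j 0| in h1 h2 h3 h4 *.
    set B1 := `|Tr i j| in a1 h1 h2 h3 h4 *; set B2 := `|Ti i j| in a2 h1 h2 h3 h4 *.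
    have X10 : 0 <= X1 by exact: normr_ge0. have X20 : 0 <= X2 by exact: normr_ge0.
    have Y10 : 0 <= Y1 by exact: normr_ge0. have Y20 : 0 <= Y2 by exact: normr_ge0.
    have w1 : 0 <= B1 * (X1 * Y2) by rewrite !mulr_ge0.
    have w2 : 0 <= B1 * (Y1 * X2) by rewrite !mulr_ge0.
    have w3 : 0 <= B2 * (X1 * X2) by rewrite !mulr_ge0.
    have w4 : 0 <= B2 * (Y1 * Y2) by rewrite !mulr_ge0.
    nra.
  have s2 : p ^+ 2 * (u * v) <= de * ((p * u) * (q * v)).
    rewrite (_ : _ * (u * v) = p * (p * u * v)); last by ring.
    rewrite (_ : de * _ = de * q * (p * u * v)); last by ring.
    by rewrite ler_wpM2r// !mulr_ge0// ltW.
  have s3 : (p * u) * (q * v) <= p ^+ 2 * N i + q ^+ 2 * N j.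
    have n1 : u ^+ 2 <= 2 * N i.
      rewrite /N /u -(real_normK (num_real (x i 0))) -(real_normK (num_real (y i 0))).
      have := sqr_ge0 (`|x i 0| - `|y i 0|); nra.
    have n2 : v ^+ 2 <= 2 * N j.
      rewrite /N /v -(real_normK (num_real (x j 0))) -(real_normK (num_real (y j 0))).
      have := sqr_ge0 (`|x j 0| - `|y j 0|); nra.
    have m1 : p ^+ 2 * u ^+ 2 <= p ^+ 2 * (2 * N i) by rewrite ler_wpM2l// sqr_ge0.
    have m2 : q ^+ 2 * v ^+ 2 <= q ^+ 2 * (2 * N j) by rewrite ler_wpM2l// sqr_ge0.
    have := sqr_ge0 (p * u - q * v); nra.
  rewrite (@le_trans _ _ (p ^+ 2 * (K * (u * v))))//.
    by rewrite ler_wpM2l// sqr_ge0.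
  rewrite mulrCA -mulrA ler_wpM2l// (le_trans s2)// ler_wpM2l//.
  exact: ltW.
apply: (@le_lt_trans _ _ (- c * S + 2 * nn * K * de * S)).
  have -> : - c * S + 2 * nn * K * de * S = \sum_i \sum_j
     ((if i == j then - c * (d i * N i) else 0)
      + K * de * (d i * N i + d j * N j)).
    transitivity (\sum_i (- c * (d i * N i) + K * de * (nn * (d i * N i) + S))).
      rewrite big_split/= -mulr_sumr; congr (_ + _).
      rewrite -mulr_sumr big_split/= -mulr_sumr sumr_const card_ord -mulr_natl.
      by rewrite -/S -/nn; ring.
    apply: eq_bigr => i _; rewrite big_split/=; congr (_ + _).
      by rewrite -big_mkcond/= (eq_bigl (pred1 i)) ?big_pred1_eq// => j /=; rewrite eq_sym.
    rewrite -mulr_sumr big_split/= sumr_const card_ord -mulr_natl.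
    by [].
  by apply: ler_sum => i _; apply: ler_sum => j _.
have : 2 * nn * K * de * S < c * S by rewrite ltr_pM2r.
lra.
Qed.

End lyapunov.

Section lyapunov.
Context {R : realType}.

Local Notation Cx := (real_complex R).

Lemma complex_mulmx_ReIm m n p (X : 'M[R[i]]_(m, n)) (Y : 'M[R[i]]_(n, p)) :
  (map_mx (@complex.Re R) (X *m Y) = map_mx (@complex.Re R) X *m map_mx (@complex.Re R) Y
     - map_mx (@complex.Im R) X *m map_mx (@complex.Im R) Y) *
  (map_mx (@complex.Im R) (X *m Y) = map_mx (@complex.Re R) X *m map_mx (@complex.Im R) Y
     + map_mx (@complex.Im R) X *m map_mx (@complex.Re R) Y).
Proof.
split; apply/matrixP => i j; rewrite !mxE raddf_sum ?(sumrB, =^~ sumrN) -big_split;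
  apply: eq_bigr => k _ /=; rewrite !mxE; case: (X i k) => a b;
  case: (Y k j) => c e /=; ring.
Qed.

(** Over the complex numbers a unitary P with P M = T P makes T lower triangular with eigenvalues of
    M on its diagonal. H is the Hermitian form sum_i d_i |(P v)_i|^2 restricted to real vectors,
    with the weights of [trig_dissipative_weights]; real and imaginary parts are separated
    throughout to stay with real matrices. *)
Lemma hurwitz_lyapunov_form n (M : 'M[R]_n) : hurwitz M ->
  exists2 H : 'M[R]_n, posdef H &
    forall v : 'cV[R]_n, v != 0 -> bform H v (M *m v) < 0.
Proof.
(* Schur triangularization asks for a positive size. *)
case: n M => [|n] M hM.
  have z (v : 'cV[R]_0) : v = 0 by apply/matrixP => -[].
  exists 1%:M => [|v]; last by rewrite (z v) eqxx.
  by split=> [|v]; [exact: trmx1 | rewrite (z v) eqxx].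
have [P Pu trig0] := Schur (map_mx Cx M) (ltn0Sn n).
pose T := conjmx P (map_mx Cx M); have trigT : is_trig_mx T := trig0.
have uP := unitarymx_unit Pu.
have PM : P *m map_mx Cx M = T *m P.
  by rewrite /T conjumx// mulmxKV.
clearbody T.


pose Pr := map_mx (@complex.Re R) P; pose Pi := map_mx (@complex.Im R) P.
pose Tr := map_mx (@complex.Re R) T; pose Ti := map_mx (@complex.Im R) T.
have Mr : map_mx (@complex.Re R) (map_mx Cx M) = M.
  by apply/matrixP => i j; rewrite !mxE.
have Mi : map_mx (@complex.Im R) (map_mx Cx M) = 0.
  by apply/matrixP => i j; rewrite !mxE.
have PrM : Pr *m M = Tr *m Pr - Ti *m Pi.
  have := congr1 (map_mx (@complex.Re R)) PM.
  by rewrite !complex_mulmx_ReIm Mr Mi mulmx0 subr0.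
have PiM : Pi *m M = Tr *m Pi + Ti *m Pr.
  have := congr1 (map_mx (@complex.Im R)) PM.
  by rewrite !complex_mulmx_ReIm Mr Mi mulmx0 add0r.
have Td i : Tr i i < 0.
  rewrite mxE; apply: hM.
  have : eigenvalue T (T i i).
    rewrite eigenvalue_root_char (char_poly_trig trigT) rootE horner_prod.
    by apply/prodf_eq0; exists i; rewrite // !hornerE subrr.

  move=> /eigenvalueP[w wT w0]; apply/eigenvalueP; exists (w *m P).
    by rewrite -mulmxA PM mulmxA wT -scalemxAl.
  by apply: contra w0 => /eqP/(congr1 (mulmx^~ (invmx P)));
    rewrite mulmxK// mul0mx => ->.

have Tt (i j : 'I_n.+1) : (i < j)%N -> Tr i j = 0 /\ Ti i j = 0.
  move=> ij; rewrite !mxE.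
  by have /is_trig_mxP/(_ _ _ ij) -> := trigT.
have [d d0 dP] := trig_dissipative_weights Td Tt.
pose Dg := diag_mx (\row_i d i).
pose H := Pr^T *m Dg *m Pr + Pi^T *m Dg *m Pi.
have HE v w : bform H v w = \sum_i d i * ((Pr *m v) i 0 * (Pr *m w) i 0
     + (Pi *m v) i 0 * (Pi *m w) i 0).
  have e k (X : 'M[R]_(n.+1, k)) v' w' : bform (X^T *m Dg *m X) v' w' =
      \sum_i d i * ((X *m v') i 0 * (X *m w') i 0).
    rewrite -bformMr -bformMl bformE; apply: eq_bigr => i _.
    rewrite (bigD1 i)//= big1 ?addr0 => [|j ji]; last first.
      by rewrite [Dg i j]mxE eq_sym (negbTE ji) mulr0n mulr0 mul0r.

    by rewrite [Dg i i]mxE eqxx mulr1n [(\row_i d i) 0 i]mxE; ring.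
  by rewrite bformDm !e -big_split; apply: eq_bigr => i _ /=; rewrite mulrDr.
have nz (v : 'cV[R]_n.+1) : v != 0 -> (Pr *m v != 0) || (Pi *m v != 0).
  move=> v0; rewrite -negb_and; apply: contra v0 => /andP[/eqP e1 /eqP e2].
  have : P *m map_mx Cx v = 0.
    have vr : map_mx (@complex.Re R) (map_mx Cx v) = v.
      by apply/matrixP => i j; rewrite !mxE.
    have vi : map_mx (@complex.Im R) (map_mx Cx v) = 0.
      by apply/matrixP => i j; rewrite !mxE.
    have [h1 h2] := complex_mulmx_ReIm P (map_mx Cx v).
    rewrite vr vi !mulmx0 -/Pr -/Pi e1 subr0 in h1.
    rewrite vr vi !mulmx0 -/Pr -/Pi e2 add0r in h2.
    apply/matrixP => i j; move/matrixP/(_ i j): h1; move/matrixP/(_ i j): h2.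
    by rewrite !mxE; case: (\sum_ _ _) => ? ? /= -> ->.
  move/(congr1 (mulmx (invmx P))); rewrite mulKmx// mulmx0 => h.
  apply/eqP/matrixP => i j; move/matrixP/(_ i j): h; rewrite !mxE.
  by move=> /(congr1 (@complex.Re R)).
exists H => [|v v0].
  split=> [|v v0].
    by rewrite /symmetric_mx /H linearD/= !trmx_mul !trmxK !tr_diag_mx !mulmxA.
  rewrite -/(bform H v v) HE lt_neqAle eq_sym; apply/andP; split; last first.
    by apply: sumr_ge0 => i _; rewrite -!expr2 mulr_ge0 ?addr_ge0 ?sqr_ge0// ltW.
  apply: contraTneq (nz v v0) => /eqP; rewrite psumr_eq0; last first.
    by move=> i _; rewrite -!expr2 mulr_ge0 ?addr_ge0 ?sqr_ge0// ltW.
  move=> /allP h; rewrite negb_or !negbK; apply/andP; split;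
    apply/eqP/matrixP => i j; rewrite (ord1 j) [RHS]mxE; have := h i;
    rewrite mem_index_enum mulf_eq0 (gt_eqF (d0 i))/= -!expr2 => /(_ isT);
    by rewrite paddr_eq0 ?sqr_ge0// !sqrf_eq0 => /andP[/eqP ? /eqP ?].
rewrite HE !mulmxA PrM PiM.
have := dP _ _ (nz v v0).
by rewrite !mulmxA !mulmxBl !mulmxDl.
Qed.

Lemma bform_lyapunov n (X M : 'M[R]_n) v : symmetric_mx X ->
  bform (M^T *m X + X *m M) v v = 2 * bform X v (M *m v).
Proof.
move=> sX; rewrite bformDm -(bformMl X M) -(bformMr X M) (bformC (M *m v))//; ring.
Qed.

(** [posdef_coercive] applied to -(M^T H + H M) makes the strict inequality uniform. *)
Lemma hurwitz_lyapunov n (M : 'M[R]_n) : hurwitz M ->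
  exists2 H : 'M[R]_n, posdef H &
    exists2 c, 0 < c & forall v, bform H v (M *m v) <= - c * sqnorm v.
Proof.
move=> /hurwitz_lyapunov_form[H pH HM]; exists H => //.
have sH := pH.1.
have pN : posdef (- (M^T *m H + H *m M)).
  split=> [|v v0].
    by rewrite /symmetric_mx linearN linearD/= !trmx_mul trmxK sH addrC.
  rewrite -/(bform _ v v) bformNm bform_lyapunov// oppr_gt0.
  by rewrite pmulr_rlt0// HM.
have [c c0 cP] := posdef_coercive pN.
exists (c / 2) => [|v]; first by rewrite divr_gt0.
have := cP v; rewrite bformNm bform_lyapunov//; lra.
Qed.

(** Let ts be the infimum of the t >= 0 for which X + t H is positive semidefinite, H being a strict
    Lyapunov form. If ts > 0, a null vector v of Z = X + ts H would satisfy Z v = 0, hence v^T Z M v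
    = 0, although this quantity is negative; so Z is positive definite and ts could be decreased. *)
Lemma lyapunov_psd n (M X : 'M[R]_n) : hurwitz M -> symmetric_mx X ->
  (forall v, bform X v (M *m v) <= 0) -> psd X.
Proof.
move=> hM sX XM; have [H pH HM] := hurwitz_lyapunov_form hM.
have sH := pH.1.
have sZ t : symmetric_mx (X + t *: H).
  by rewrite /symmetric_mx linearD linearZ/= sX sH.
pose S : set R := [set t | 0 <= t /\ psd (X + t *: H)].
have [c c0 cP] := posdef_coercive pH.
have [K K0 KP] := bform_bounded X.
have [K' K'0 K'P] := bform_bounded H.
have S0 : S !=set0.
  exists (2 * K / c); split; first by rewrite divr_ge0 ?mulr_ge0// ltW.
  split=> [|v]; first exact: sZ.
  rewrite -/(bform _ v v) bformDm bformZm.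
  have h := KP v v.
  have : 2 * K / c * (c * sqnorm v) <= 2 * K / c * bform H v v.
    by rewrite ler_wpM2l// divr_ge0 ?mulr_ge0// ltW.
  rewrite mulrA divfK ?gt_eqF//.
  have := ler_norm (- bform X v v); rewrite normrN; lra.
have lS : has_lbound S by exists 0 => t [].
pose ts := inf S.
have ts0 : 0 <= ts by apply: lb_le_inf => // t [].
have pZ : psd (X + ts *: H).
  split=> [|v]; first exact: sZ.
  rewrite -/(bform _ v v) bformDm bformZm.
  have [->|v0] := eqVneq v 0; first by rewrite !bform0l mulr0 addr0.
  have Hv : 0 < bform H v v := pH.2 v v0.
  rewrite -lerBlDl sub0r -ler_pdivrMr//; apply: lb_le_inf => // t [_ [_ /(_ v)]].
  by rewrite -/(bform _ v v) bformDm bformZm ler_pdivrMr//; lra.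
have [ts_eq0|ts_neq0] := eqVneq ts 0.
  by rewrite ts_eq0 scale0r addr0 in pZ.
have tsp : 0 < ts by rewrite lt_neqAle eq_sym ts_neq0.
have dZ : posdef (X + ts *: H).
  split=> [|v v0]; first exact: sZ.
  rewrite -/(bform _ v v) lt_neqAle psd_ge0// andbT eq_sym.
  apply/eqP => /(psd_ker pZ) Zv.
  have : bform (X + ts *: H) v (M *m v) = 0.
    by rewrite bformC// /bform -mulmxA Zv mulmx0 mxE.
  rewrite bformDm bformZm.
  have := XM v; have : ts * bform H v (M *m v) < 0 by rewrite pmulr_rlt0// HM.
  lra.
have [c' c'0 c'P] := posdef_coercive dZ.
(* The decrease e keeps ts - e nonnegative and costs at most 2 K' e |v|^2, which the coercivity
   constant c' of Z pays for. *)
pose e := Num.min ts (c' / (2 * K')).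
have e0 : 0 < e by rewrite lt_min tsp divr_gt0// mulr_gt0.
have e1 : e <= ts by rewrite ge_min lexx.
have e2 : 2 * K' * e <= c'.
  by rewrite mulrC -ler_pdivlMr ?mulr_gt0// ge_min lexx orbT.
suff : S (ts - e).
  by move=> /(ge_inf lS); rewrite -/ts; lra.
split; first by rewrite subr_ge0.
split=> [|v]; first exact: sZ.
rewrite -/(bform _ v v) scalerBl addrA bformDm bformNm bformZm.
have := c'P v; have := K'P v v; have := ler_norm (bform H v v) => a1 a2 a3.
have : e * bform H v v <= e * (K' * (sqnorm v + sqnorm v)).
  by rewrite ler_wpM2l ?(ltW e0)//; exact: le_trans a2.
have : 2 * K' * e * sqnorm v <= c' * sqnorm v by rewrite ler_wpM2r// sqnorm_ge0.
lra.
Qed.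

Lemma psd_anti n (X : 'M[R]_n) : psd X -> psd (- X) -> X = 0.
Proof.
move=> pX pN; apply/matrixP => i j; rewrite [RHS]mxE.
have : X *m delta_mx j (0 : 'I_1) = 0.
  apply: psd_ker => //; apply/eqP; rewrite eq_le psd_ge0// andbT.
  by rewrite -oppr_ge0 -bformNm psd_ge0.
by rewrite -colE => /matrixP/(_ i 0); rewrite !mxE.
Qed.

Lemma lyapunov_eq0 n (M X : 'M[R]_n) : hurwitz M -> symmetric_mx X ->
  M^T *m X + X *m M = 0 -> X = 0.
Proof.
move=> hM sX e.
have z v : bform X v (M *m v) = 0.
  apply/eqP; have := bform_lyapunov M v sX.
  by rewrite e {1}/bform mulmx0 mul0mx mxE => /esym/eqP; rewrite mulf_eq0 pnatr_eq0.
apply: psd_anti; apply: (lyapunov_psd hM) => //.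
- by move=> v; rewrite z.
- by rewrite /symmetric_mx linearN/= sX.
- by move=> v; rewrite bformNm z oppr0.
Qed.

Lemma hurwitz_block_diag n (M : 'M[R]_n) : hurwitz M ->
  hurwitz (block_mx M 0 0 M).
Proof.
move=> hM; apply/hurwitzP => al be a b.
rewrite -(vsubmxK a) -(vsubmxK b) !mul_block_col !scale_col_mx !add_col_mx.
rewrite opp_col_mx add_col_mx !mul0mx !addr0 !add0r.
move=> /eq_col_mx[a1 a2] /eq_col_mx[b1 b2] h.
have [e|u] := boolP ((usubmx a != 0) || (usubmx b != 0)).
  by have /hurwitzP/(_ _ _ _ _ a1 b1 e) := hM.
move: u; rewrite negb_or !negbK => /andP[/eqP u1 /eqP u2].
have /hurwitzP/(_ _ _ _ _ a2 b2) := hM; apply.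
move: h; rewrite u1 u2 -!negb_and; apply: contra => /andP[/eqP-> /eqP->].
by rewrite col_mx0 eqxx.
Qed.

(** X need not be symmetric here, so [lyapunov_eq0] is applied to the symmetric matrix with
    off-diagonal blocks X and X^T, which solves the Lyapunov equation of diag(M, M). *)
Lemma lyapunov_inj n (M X : 'M[R]_n) : hurwitz M ->
  M^T *m X + X *m M = 0 -> X = 0.
Proof.
move=> hM e; have hB := hurwitz_block_diag hM.
have : block_mx 0 X X^T 0 = 0 :> 'M[R]_(n + n).
  apply: (lyapunov_eq0 hB).
    by rewrite /symmetric_mx tr_block_mx !trmx0 trmxK.
  rewrite tr_block_mx !trmx0 !mulmx_block !mul0mx !mulmx0 !addr0 !add0r.
  rewrite add_block_mx !addr0 e.
  have -> : M^T *m X^T + X^T *m M = 0.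
    by have := congr1 trmx e; rewrite linearD/= !trmx_mul trmxK trmx0 addrC.

  by rewrite block_mx0.
by rewrite -(block_mx0 R n n n n) => /eq_block_mx[].
Qed.

(** An injective linear endomorphism of the space of matrices is bijective; the solution is
    symmetric because X - X^T solves the homogeneous equation. *)
Lemma lyapunov_solution n (M Q : 'M[R]_n) : hurwitz M -> symmetric_mx Q ->
  exists2 X, symmetric_mx X & M^T *m X + X *m M + Q = 0.
Proof.
move=> hM sQ.
pose L := lin_mulmx M^T + lin_mulmxr M : 'M[R]_(n * n, n * n).
have LE Y : mxvec Y *m L = mxvec (M^T *m Y + Y *m M).
  by rewrite mulmxDr !mul_vec_lin linearD.
have uL : L \in unitmx.
  rewrite -row_free_unit -kermx_eq0; apply/eqP/row_matrixP => i.
  rewrite row0; have : row i (kermx L) *m L = 0 by rewrite -row_mul mulmx_ker row0.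
  rewrite -[row i _]vec_mxK LE => h.
  suff -> : vec_mx (row i (kermx L)) = 0 by rewrite linear0.
  apply: (lyapunov_inj hM); apply: (can_inj mxvecK); by rewrite h linear0.
pose X := vec_mx (mxvec (- Q) *m invmx L).
have XE : M^T *m X + X *m M = - Q.
  by apply: (can_inj mxvecK); rewrite -LE vec_mxK mulmxKV.
exists X; last by rewrite XE addNr.
apply/eqP; rewrite -subr_eq0; apply/eqP; apply: (lyapunov_inj hM).
rewrite mulmxBr mulmxBl addrACA -opprD XE.
have := congr1 trmx XE; rewrite linearD linearN/= !trmx_mul trmxK sQ => e.
by rewrite [X in X - _]addrC e subrr.

Qed.

End lyapunov.

(** * Riccati equations *)

Section entrywise_limits.
Context {R : realType}.

(** Entrywise convergence lets every limit rule reduce to one for real sequences. *)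
Definition mxcvg m n (X : nat -> 'M[R]_(m, n)) (L : 'M[R]_(m, n)) :=
  forall i j, (fun k => X k i j) @ \oo --> L i j.

Lemma mxcvg_cst m n (L : 'M[R]_(m, n)) : mxcvg (fun=> L) L.
Proof. by move=> i j; exact: cvg_cst. Qed.

Lemma mxcvgD m n (X Y : nat -> 'M[R]_(m, n)) L K :
  mxcvg X L -> mxcvg Y K -> mxcvg (fun k => X k + Y k) (L + K).
Proof.
move=> XL YK i j; rewrite mxE; under eq_fun do rewrite mxE.
exact: cvgD (XL i j) (YK i j).
Qed.

Lemma mxcvgN m n (X : nat -> 'M[R]_(m, n)) L :
  mxcvg X L -> mxcvg (fun k => - X k) (- L).
Proof.
by move=> XL i j; rewrite mxE; under eq_fun do rewrite mxE; exact: cvgN (XL i j).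
Qed.

Lemma mxcvgT m n (X : nat -> 'M[R]_(m, n)) L :
  mxcvg X L -> mxcvg (fun k => (X k)^T) L^T.
Proof. by move=> XL i j; rewrite mxE; under eq_fun do rewrite mxE; exact: XL. Qed.

Lemma mxcvgM m n p (X : nat -> 'M[R]_(m, n)) (Y : nat -> 'M[R]_(n, p)) L K :
  mxcvg X L -> mxcvg Y K -> mxcvg (fun k => X k *m Y k) (L *m K).
Proof.
move=> XL YK i j; rewrite mxE; under eq_fun do rewrite mxE.
by apply: (cvg_big add_continuous) => l _; exact: cvgM (XL i l) (YK l j).
Qed.

Lemma mxcvg_unique m n (X : nat -> 'M[R]_(m, n)) L K :
  mxcvg X L -> mxcvg X K -> L = K.
Proof.
by move=> XL XK; apply/matrixP => i j; apply: cvg_unique (XL i j) (XK i j).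
Qed.

Lemma mxcvgS m n (X : nat -> 'M[R]_(m, n)) L :
  mxcvg X L -> mxcvg (fun k => X k.+1) L.
Proof.
move=> XL i j; have := XL i j.
by rewrite -(cvg_shiftS (fun k => X k i j)).
Qed.

(** Each quadratic form v^T X_k v is nonincreasing and nonnegative, hence converges, and by
    polarization every entry is a combination of three such forms. *)
Lemma psd_nonincreasing_mxcvg n (X : nat -> 'M[R]_n) :
  (forall k, psd (X k)) -> (forall k, psd (X k - X k.+1)) ->
  exists2 L, psd L & mxcvg X L.
Proof.
move=> pX dX.
have qcvg v : cvgn (fun k => bform (X k) v v).
  apply: nonincreasing_is_cvgn; last first.
    by exists 0 => _ [k _ <-]; exact: psd_ge0.
  apply/nonincreasing_seqP => k; rewrite -subr_ge0 -bformNm -bformDm.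
  exact: psd_ge0.
pose e i : 'cV[R]_n := delta_mx i 0.
have eE k i j : bform (X k) (e i) (e j) = X k i j.
  by rewrite /bform trmx_delta -rowE -colE !mxE.
have XE k i j : X k i j = 2^-1 * (bform (X k) (e i + e j) (e i + e j)
      - bform (X k) (e i) (e i) - bform (X k) (e j) (e j)).
  rewrite !(bformDl, bformDr) (bformC (e j) (e i) (pX k).1) !eE; lra.
pose L := \matrix_(i, j) limn (fun k => X k i j).
have XL : mxcvg X L.
  move=> k l; rewrite mxE.
  suff : cvgn (fun m => X m k l) by [].
  under eq_fun do rewrite XE.
  by apply: is_cvgMl_tmp; apply: is_cvgB => //; apply: is_cvgB.

exists L => //; split=> [|v].
  apply: (mxcvg_unique _ XL); have := mxcvgT XL.
  by under eq_fun do rewrite (pX _).1.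
have /(_ 0 0) h := mxcvgM (mxcvgM (@mxcvg_cst 1 n v^T) XL) (@mxcvg_cst n 1 v).

rewrite -(cvg_lim _ h)//; apply: limr_ge => //; first by apply: cvgP h.
by apply: nearW => k; exact: psd_ge0.
Qed.

End entrywise_limits.

Section riccati_equation.
Context {R : realType} {n r : nat}.
Variables (A : 'M[R]_n) (B : 'M[R]_(n, r)) (Rw : 'M[R]_r).
Hypothesis pRw : posdef Rw.
Let S := B *m invmx Rw *m B^T.

Definition are (Q P : 'M[R]_n) := A^T *m P + P *m A - P *m S *m P + Q = 0.

(** The shift of A0 by rho / 2 subtracts rho P from A0^T P + P A0, so discounting disappears and the
    theory concerns the undiscounted equation. *)
Lemma are_riccati rho A0 Q P : A = A0 - (rho / 2)%:M ->
  riccati rho A0 B Rw Q P <-> are Q P.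
Proof.
move=> eA; rewrite /riccati /are eA.
set X := A0^T *m P; set Y := P *m A0.
have -> : (A0 - (rho / 2)%:M)^T *m P + P *m (A0 - (rho / 2)%:M)
    = X + Y - rho *: P.
  rewrite linearB/= tr_scalar_mx mulmxBl mulmxBr mul_scalar_mx mul_mx_scalar.
  rewrite addrACA -opprD -scalerDl; congr (_ - _ *: _); lra.
rewrite /S !mulmxA; set Z := P *m _ *m _ *m _ *m P.
clearbody X Y Z; split=> h; apply/matrixP => i j;
  by move/matrixP/(_ i j): h; rewrite !mxE; lra.
Qed.

Lemma gain_sym : symmetric_mx S.
Proof. by rewrite /symmetric_mx /S !trmx_mul trmxK trmx_inv pRw.1 mulmxA. Qed.

Lemma invmx_Rw_bform (v : 'cV[R]_r) :
  bform (invmx Rw) v v = bform Rw (invmx Rw *m v) (invmx Rw *m v).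
Proof.
rewrite bformMl bformMr trmx_inv pRw.1 mulVmx ?posdef_unit// mul1mx.
by [].
Qed.

Lemma gain_bform (v : 'cV[R]_n) :
  bform S v v = bform Rw (invmx Rw *m B^T *m v) (invmx Rw *m B^T *m v).
Proof.
by rewrite -(mulmxA (invmx Rw)) -invmx_Rw_bform bformMl bformMr trmxK.
Qed.

Lemma gain_psd : psd S.
Proof.
split=> [|v]; first exact: gain_sym.
by rewrite -/(bform S v v) gain_bform psd_ge0//; exact: posdef_psd.
Qed.


(** Under the feedback - R^-1 B^T P, the stored cost v^T P v decreases at the rate of the running
    costs of state and control. *)
Lemma are_dissipation Q P v : symmetric_mx P -> are Q P ->
  2 * bform P v ((A - S *m P) *m v) = - (bform Q v v + bform S (P *m v) (P *m v)).
Proof.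
move=> sP eP; rewrite -bform_lyapunov// bformMl bformMr sP -bformDm -bformNm.
congr bform; move: eP; rewrite /are linearB/= trmx_mul sP gain_sym.
rewrite mulmxBl mulmxBr !mulmxA.
set X := A^T *m P; set Y := P *m A; set Z := P *m S *m P.
clearbody X Y Z => e; apply/matrixP => i j.
by move/matrixP/(_ i j): e; rewrite !mxE; lra.
Qed.

(** Let a + i b be an eigenvector of the closed loop with real part al >= 0. Adding the dissipation
    identities for a and b cancels the imaginary part of the eigenvalue and equates 2 al times a
    nonnegative number with minus a sum of nonnegative terms. So C and S P vanish on a and b, and
    the same eigenvector belongs to A + L C, against detectability. *)
Lemma detectable_are_hurwitz m Q P (C : 'M[R]_(m, n)) : psd P -> are Q P ->
  Q = C^T *m C -> detectable A C -> hurwitz (A - S *m P).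
Proof.
move=> pP eP QC [L /hurwitzP hL]; apply/hurwitzP => al be a b Ma Mb ab.
rewrite ltNge; apply/negP => al0.
have QE v : bform Q v v = sqnorm (C *m v).
  by rewrite sqnormE bformMl bformMr mulmx1 QC.
have h1 := are_dissipation a pP.1 eP; have h2 := are_dissipation b pP.1 eP.
move: h1 h2; rewrite Ma Mb bformDr bformDr bformNr !bformZr (bformC b a pP.1).
rewrite !QE => h1 h2.
have a0 := psd_ge0 a pP; have b0 := psd_ge0 b pP.
have c0 := sqnorm_ge0 (C *m a); have d0 := sqnorm_ge0 (C *m b).
have e0 := psd_ge0 (P *m a) gain_psd; have f0 := psd_ge0 (P *m b) gain_psd.
have p1 := mulr_ge0 al0 a0; have p2 := mulr_ge0 al0 b0.
have /eqP ca : sqnorm (C *m a) = 0 by apply/eqP; rewrite eq_le c0 andbT; lra.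
have /eqP cb : sqnorm (C *m b) = 0 by apply/eqP; rewrite eq_le d0 andbT; lra.
have sa : bform S (P *m a) (P *m a) = 0 by apply/eqP; rewrite eq_le e0 andbT; lra.
have sb : bform S (P *m b) (P *m b) = 0 by apply/eqP; rewrite eq_le f0 andbT; lra.
move: ca cb; rewrite !sqnorm_eq0 => /eqP ca /eqP cb.
have /(psd_ker gain_psd) ka := sa; have /(psd_ker gain_psd) kb := sb.
have : al < 0; last by rewrite ltNge al0.
apply: (hL al be a b) => //.
- by rewrite -Ma mulmxDl mulmxBl -(mulmxA S) -(mulmxA L) ca ka mulmx0 subr0 addr0.
- by rewrite -Mb mulmxDl mulmxBl -(mulmxA S) -(mulmxA L) cb kb mulmx0 subr0 addr0.
Qed.

(** A stabilizing solution Y dominates every symmetric solution X: along A - S Y the form of Y - X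
    has rate -(Y - X) S (Y - X), so [lyapunov_psd] applies. Two stabilizing solutions dominate each
    other. *)
Lemma are_stabilizing_unique Q P1 P2 : symmetric_mx P1 -> symmetric_mx P2 ->
  are Q P1 -> are Q P2 -> hurwitz (A - S *m P1) -> hurwitz (A - S *m P2) ->
  P1 = P2.
Proof.
have le X Y : symmetric_mx X -> symmetric_mx Y -> are Q X -> are Q Y ->
    hurwitz (A - S *m Y) -> psd (Y - X).
  move=> sX sY eX eY hY.
  have sD : symmetric_mx (Y - X) by rewrite /symmetric_mx linearB/= sX sY.
  apply: (lyapunov_psd hY) => // v.
  suff : 2 * bform (Y - X) v ((A - S *m Y) *m v)
       = - bform S ((Y - X) *m v) ((Y - X) *m v).
    have := psd_ge0 ((Y - X) *m v) gain_psd; lra.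
  have e1 := are_dissipation v sY eY; have e2 := are_dissipation v sX eX.
  have e3 : bform X v ((A - S *m Y) *m v) = bform X v ((A - S *m X) *m v)
      - bform S (X *m v) (Y *m v) + bform S (X *m v) (X *m v).
    have w (Z : 'M[R]_n) : bform X v (S *m Z *m v) = bform S (X *m v) (Z *m v).
      by rewrite -mulmxA bformMr [RHS]bformMl sX.
    by rewrite !mulmxBl !(bformDr, bformNr) !w; lra.
  rewrite bformDm bformNm mulrDr e1 mulrN e3 !mulrDr e2.
  rewrite !mulmxBl !(bformDl, bformDr, bformNl, bformNr).
  rewrite (bformC (Y *m v) (X *m v) gain_sym); lra.
move=> s1 s2 e1 e2 h1 h2; apply/eqP; rewrite -subr_eq0; apply/eqP.
by apply: psd_anti; rewrite ?opprB; exact: le.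
Qed.

End riccati_equation.

(** * Kleinman's iteration *)

Section kleinman.
Context {R : realType} {n r : nat}.
Variables (A : 'M[R]_n) (B : 'M[R]_(n, r)) (Rw : 'M[R]_r).
Hypothesis pRw : posdef Rw.
Let S := B *m invmx Rw *m B^T.

(** X is the cost matrix of the constant feedback u = K x; solving for X is the policy evaluation
    step of the iteration. *)
Definition gain_lyapunov (Q : 'M[R]_n) (K : 'M[R]_(r, n)) X :=
  (A + B *m K)^T *m X + X *m (A + B *m K) + (Q + K^T *m Rw *m K) = 0.

Lemma gain_lyapunov_bform Q K X v : symmetric_mx X -> gain_lyapunov Q K X ->
  2 * bform X v ((A + B *m K) *m v) = - (bform Q v v + bform Rw (K *m v) (K *m v)).
Proof.
move=> sX /eqP; rewrite addr_eq0 => /eqP e.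
by rewrite -bform_lyapunov// e bformNm bformDm bformMl bformMr.
Qed.

(** Completion of the square: relative to the improved feedback - R^-1 B^T X, the old gain K costs
    an extra term in g. Stability and monotonicity of the iteration both come from the sign of this
    term. *)
Lemma kleinman_identity Q K X v : symmetric_mx X -> gain_lyapunov Q K X ->
  let g := (K + invmx Rw *m B^T *m X) *m v in
  2 * bform X v ((A - S *m X) *m v) =
    - (bform Q v v + bform S (X *m v) (X *m v) + bform Rw g g).
Proof.
move=> sX eX /=; have uR := posdef_unit pRw.
have h := gain_lyapunov_bform v sX eX.
rewrite [(K + _) *m v]mulmxDl; set k := K *m v; set g := invmx Rw *m B^T *m X *m v.
have XB w : bform X v (B *m w) = bform Rw g w.
  rewrite /g -!mulmxA bformMl trmx_inv pRw.1 mulVmx// [RHS]bformMl mulmx1 trmxK.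
  by rewrite bformMl sX bformMr.
have -> : bform S (X *m v) (X *m v) = bform Rw g g.
  by rewrite /S gain_bform// /g !mulmxA.
have -> : (A - S *m X) *m v = (A + B *m K) *m v - B *m (k + g).
  rewrite mulmxBl mulmxDl mulmxDr /k /g !mulmxA opprD addrA.
  by rewrite addrK.
rewrite bformDr bformNr XB mulrBr h -/k !(bformDl, bformDr).
by rewrite (bformC k g pRw.1); lra.
Qed.

(** If the improved closed loop had an eigenvalue with nonnegative real part, the identity would
    force g = 0 on the eigenvector; there the old and the new feedback agree, which contradicts the
    Hurwitz hypothesis on A + B K. *)
Lemma kleinman_step Q K : psd Q -> hurwitz (A + B *m K) ->
  exists X, [/\ psd X, hurwitz (A - S *m X) & gain_lyapunov Q K X].
Proof.
move=> pQ hK.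
have sQ : symmetric_mx (Q + K^T *m Rw *m K).
  by rewrite /symmetric_mx linearD/= !trmx_mul trmxK pQ.1 pRw.1 mulmxA.
have [X sX eX] := lyapunov_solution hK sQ.
have pX : psd X.
  apply: (lyapunov_psd hK) => // v.
  have := gain_lyapunov_bform v sX eX; have := psd_ge0 v pQ.
  have := psd_ge0 (K *m v) (posdef_psd pRw) => h2 h1 h.
  by rewrite -(@pmulr_rle0 _ 2)// h oppr_le0 addr_ge0.
exists X; split; [exact: pX| |exact: eX]; apply/hurwitzP => al be a b Ma Mb ab.
rewrite ltNge; apply/negP => al0.
have h1 := kleinman_identity a sX eX; have h2 := kleinman_identity b sX eX.
move: h1 h2; rewrite /= Ma Mb bformDr bformDr bformNr !bformZr (bformC b a sX).
set ga := (_ *m a) in Ma *; set gb := (_ *m b) in Mb *.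
set ga' := (K + _) *m a; set gb' := (K + _) *m b => h1 h2.
have a0 := mulr_ge0 al0 (psd_ge0 a pX); have b0 := mulr_ge0 al0 (psd_ge0 b pX).
have c0 := psd_ge0 a pQ; have d0 := psd_ge0 b pQ.
have e0 := psd_ge0 (X *m a) (gain_psd B pRw); have f0 := psd_ge0 (X *m b) (gain_psd B pRw).
have g0 := psd_ge0 ga' (posdef_psd pRw); have i0 := psd_ge0 gb' (posdef_psd pRw).
rewrite -/S in e0 f0.
have uR := posdef_unit pRw.
have z (w : 'cV[R]_r) : bform Rw w w <= 0 -> w = 0.
  move=> w0; apply/eqP; apply: contraLR w0 => w0; rewrite -ltNge.
  exact: (pRw.2 _ w0).
have /z za : bform Rw ga' ga' <= 0 by lra.
have /z zb : bform Rw gb' gb' <= 0 by lra.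
have E w : (K + invmx Rw *m B^T *m X) *m w = 0 ->
    (A + B *m K) *m w = (A - S *m X) *m w.
  move=> h; apply/eqP; rewrite -subr_eq0 -mulmxBl; apply/eqP.
  have -> : A + B *m K - (A - S *m X) = B *m (K + invmx Rw *m B^T *m X).
    by rewrite mulmxDr !mulmxA opprB addrC addrA subrK addrC.
  by rewrite -(mulmxA B) h mulmx0.
have : al < 0; last by rewrite ltNge al0.
have /hurwitzP/(_ al be a b) := hK; apply.
- by rewrite E.
- by rewrite E.
- exact: ab.
Qed.

(** Along A - S X the rates of both cost matrices are known, and they differ exactly by the square
    of [kleinman_identity]. *)
Lemma kleinman_monotone Q K X X' : hurwitz (A - S *m X) ->
  symmetric_mx X -> symmetric_mx X' -> gain_lyapunov Q K X ->
  gain_lyapunov Q (- (invmx Rw *m B^T *m X)) X' -> psd (X - X').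
Proof.
move=> hX sX sX' eX eX'.
have e : A + B *m - (invmx Rw *m B^T *m X) = A - S *m X.
  by rewrite mulmxN /S !mulmxA.
have sD : symmetric_mx (X - X') by rewrite /symmetric_mx linearB/= sX sX'.
apply: (lyapunov_psd hX) => // v.
have h1 := kleinman_identity v sX eX; have := gain_lyapunov_bform v sX' eX'.
rewrite e => h2; rewrite bformDm bformNm.
have := psd_ge0 ((K + invmx Rw *m B^T *m X) *m v) (posdef_psd pRw).
move: h1; rewrite /=; set g := bform Rw (_ *m v) _.
have -> : bform S (X *m v) (X *m v) = bform Rw (- (invmx Rw *m B^T *m X) *m v)
   (- (invmx Rw *m B^T *m X) *m v).
  by rewrite mulNmx bformNl bformNr opprK /S gain_bform// !mulmxA.

lra.
Qed.

Lemma stabilizable_are Q : psd Q -> stabilizable A B ->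
  exists P, psd P /\ are A B Rw Q P.
Proof.
move=> pQ [K0 hK0].
pose I X := [/\ psd X, hurwitz (A - S *m X) & exists K, gain_lyapunov Q K X].
have [X0 [p0 h0 e0]] := kleinman_step pQ hK0.
(* The iterates are carried together with the invariant [I], which guarantees that the next one
   exists; this makes the iteration a total function. *)
have step (X : {X | I X}) : {Y : {X | I X} |
    gain_lyapunov Q (- (invmx Rw *m B^T *m sval X)) (sval Y)}.
  case: X => X [pX hX eX] /=; apply: cid.
  have [|Y [pY hY eY]] := @kleinman_step Q (- (invmx Rw *m B^T *m X)) pQ.
    by rewrite mulmxN !mulmxA.
  by exists (exist I Y (And3 pY hY (ex_intro (fun K => gain_lyapunov Q K Y) _ eY))).
pose Z := fix Z k := if k is k'.+1 then sval (step (Z k')) else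
   exist I X0 (And3 p0 h0 (ex_intro (fun K => gain_lyapunov Q K X0) _ e0)).
pose X k := sval (Z k).
have pX k : psd (X k) by rewrite /X; case: (Z k) => ? [].
have eX k : gain_lyapunov Q (- (invmx Rw *m B^T *m X k)) (X k.+1).
  by rewrite /X /=; case: (step (Z k)).
have dX k : psd (X k - X k.+1).
  have [_ hX [K eK]] : I (X k) by rewrite /X; case: (Z k).
  exact: (kleinman_monotone hX (pX k).1 (pX k.+1).1 eK (eX k)).
have [L pL XL] := psd_nonincreasing_mxcvg pX dX.
exists L; split=> //.
have XL' := mxcvgS XL.
pose G := invmx Rw *m B^T.
have GL : mxcvg (fun k => - (G *m X k)) (- (G *m L)).
  exact: mxcvgN (mxcvgM (@mxcvg_cst R r n G) XL).
have AL := mxcvgD (@mxcvg_cst R n n A) (mxcvgM (@mxcvg_cst R n r B) GL).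
have h := mxcvgD (mxcvgD (mxcvgM (mxcvgT AL) XL') (mxcvgM XL' AL))
  (mxcvgD (@mxcvg_cst R n n Q) (mxcvgM (mxcvgM (mxcvgT GL) (@mxcvg_cst R r r Rw)) GL)).
have h0' : gain_lyapunov Q (- (G *m L)) L.
  apply: (mxcvg_unique h); have := @mxcvg_cst R n n 0.
  congr mxcvg; apply/funext => k; exact/esym/eX.
move: h0'; rewrite /gain_lyapunov /are.
have uR := posdef_unit pRw.
(* For the limit gain K = - R^-1 B^T L one has K^T R K = L S L, and the limit of the Lyapunov
   equations becomes the Riccati equation. *)
have GR : (- (G *m L))^T *m Rw *m - (G *m L) = L *m S *m L.
  rewrite mulmxN [(- _)^T]linearN/= !mulNmx opprK !trmx_mul trmxK trmx_inv pRw.1 pL.1.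
  by rewrite /G !mulmxA mulmxKV.
rewrite GR linearD/= !(mulmxN, linearN)/= mulmxDl mulNmx mulmxDr mulmxN.
rewrite !trmx_mul trmxK trmx_inv pRw.1 pL.1 -/S !mulmxA.
set U := A^T *m L; set V := L *m A; set W := L *m _ *m _ *m _ *m L.
clearbody U V W => h'; apply/matrixP => i j.
by move/matrixP/(_ i j): h'; rewrite !mxE; lra.
Qed.

End kleinman.

(** * Discounted Riccati equations under detectability *)

Section shifted_riccati.
Context {R : realType} {n r m : nat}.
Variables (rho : R) (A : 'M[R]_n) (B : 'M[R]_(n, r)) (Rw : 'M[R]_r).
Variables (Q : 'M[R]_n) (C : 'M[R]_(m, n)).
Hypothesis pRw : posdef Rw.
Hypothesis QC : Q = C^T *m C.
Hypothesis hdet : detectable (A - (rho / 2)%:M) C.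
Let S := B *m invmx Rw *m B^T.

Lemma gram_psd : psd Q.
Proof.
rewrite QC; split=> [|v]; first by rewrite /symmetric_mx trmx_mul trmxK.
by have := sqnorm_ge0 (C *m v); rewrite sqnormE bformMl bformMr mulmx1.
Qed.

Lemma riccati_hurwitz P : psd P -> riccati rho A B Rw Q P ->
  hurwitz (A - S *m P - (rho / 2)%:M).
Proof.
move=> pP /(are_riccati _ _ _ _ erefl) eP; rewrite addrAC.
exact: (detectable_are_hurwitz pRw pP eP QC hdet).
Qed.

Lemma riccati_psd_unique P P' : psd P -> psd P' ->
  riccati rho A B Rw Q P -> riccati rho A B Rw Q P' -> P = P'.
Proof.
move=> pP pP' eP eP'.
have h := riccati_hurwitz pP eP; have h' := riccati_hurwitz pP' eP'.
rewrite addrAC in h; rewrite addrAC in h'.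
move/(are_riccati _ _ _ _ erefl) in eP; move/(are_riccati _ _ _ _ erefl) in eP'.
exact: (are_stabilizing_unique pRw pP.1 pP'.1 eP eP' h h').

Qed.

Lemma stabilizable_riccati : stabilizable (A - (rho / 2)%:M) B ->
  exists P, psd P /\ riccati rho A B Rw Q P.
Proof.
move=> /(stabilizable_are pRw gram_psd)[P [pP eP]]; exists P; split=> //.
by apply/(are_riccati _ _ _ _ erefl).
Qed.

Lemma riccati_stabilizable P : psd P -> riccati rho A B Rw Q P ->
  stabilizable (A - (rho / 2)%:M) B.
Proof.
move=> pP eP; exists (- (invmx Rw *m B^T *m P)).
by rewrite mulmxN !mulmxA addrAC; exact: riccati_hurwitz.
Qed.

(** Serves for the matrix P of (i), which is only symmetric and whose Hurwitz property is obtained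
    first; the dissipation identity then gives the sign. *)
Lemma riccati_hurwitz_psd P : symmetric_mx P -> riccati rho A B Rw Q P ->
  hurwitz (A - S *m P - (rho / 2)%:M) -> psd P.
Proof.
move=> sP eP hP; apply: (lyapunov_psd hP) => // v.
move/(are_riccati _ _ _ _ erefl) in eP; rewrite addrAC.
have := are_dissipation pRw v sP eP; have := psd_ge0 v gram_psd.
have := psd_ge0 (P *m v) (gain_psd B pRw); rewrite -/S; lra.
Qed.

End shifted_riccati.

(** * Linear differential equations *)

Section calculus.
Context {R : realType}.
Local Notation mu := (@lebesgue_measure R).

(** The functions of the statement are continuous on the half-line only. Composing with max(t, 0)
    gives functions continuous on R with the same values for t >= 0, to which two-sided calculus
    applies; this device recurs throughout. *)
Lemma continuous_clip (U : topologicalType) (g : R -> U) :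
  {within `[0, +oo[, continuous g} -> continuous (fun t : R => g (Num.max t 0)).
Proof.
move=> cg; have ccl : continuous (fun t : R => Num.max t 0).
  have -> : (fun t : R => Num.max t 0) = (fun t : R => (t + `|t|) * 2^-1).
    apply/funext => t; case: (leP 0 t) => t0.
      by rewrite ger0_norm//; lra.
    by rewrite ltr0_norm//; lra.
  move=> t; apply: cvgMr_tmp; apply: cvgD; first exact: cvg_id.
  exact: norm_continuous.

have -> : (fun t : R => g (Num.max t 0)) = g \o (fun t : R => Num.max t 0) by [].
have A0 (s : R) : (`[0, +oo[%classic : set R) (Num.max s 0).
  by rewrite /= in_itv/= andbT le_max lexx orbT.
move=> t; have h := (@subspace_continuousP _ _ _ g).1 cg (Num.max t 0) (A0 t).
apply: (@cvg_comp _ _ _ (fun s : R => Num.max s 0) g _ _ _ _ h) => P hP.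
have h2 : nbhs t ((fun s : R => Num.max s 0) @^-1`
    [set x | (`[0, +oo[%classic : set R) x -> P x]) by exact: ccl.
by apply: (@filterS _ (nbhs t) _ _ _ _ h2) => s; apply; exact: A0.
Qed.

Lemma continuous_integrable (f : R -> R) a b : continuous f ->
  mu.-integrable `[a, b] (EFin \o f).
Proof.
move=> cf; apply: continuous_compact_integrable; first exact: segment_compact.
exact: continuous_subspaceT.
Qed.

(** The signed integral from 0 to y, also for y < 0, so that the primitive of a continuous function
    is differentiable at every real point, 0 included. *)
Definition prim (f : R -> R) (y : R) : R :=
  \int[mu]_(v in `[0, y]) f v - \int[mu]_(v in `[y, 0]) f v.

Lemma primE f y : 0 <= y -> prim f y = \int[mu]_(v in `[0, y]) f v.
Proof.
rewrite le_eqVlt => /predU1P[<-|y0]; rewrite /prim.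
  by rewrite set_itv1 Rintegral_set1 subr0.
by rewrite [X in _ - X](_ : _ = 0) ?subr0// set_itv_ge ?Rintegral_set0// -leNgt bnd_simp.
Qed.

Lemma prim0 f : prim f 0 = 0.
Proof. by rewrite primE// set_itv1 Rintegral_set1. Qed.

Lemma Rintegral_cat (f : R -> R) a b c : continuous f -> a <= b -> b <= c ->
  \int[mu]_(v in `[a, c]) f v = \int[mu]_(v in `[a, b]) f v + \int[mu]_(v in `[b, c]) f v.
Proof.
move=> cf ab bc.
rewrite -(@Rintegral_itv_obnd_cbnd _ b (BRight c)); last first.
  apply: (integrableS _ _ _ (continuous_integrable b c cf)) => //.
  by apply: subset_itvr; rewrite bnd_simp.
rewrite -(@Rintegral_itvB _ f (BLeft a) (BRight c) b) ?bnd_simp//.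
  by rewrite addrC subrK.
exact: continuous_integrable.
Qed.

Lemma is_derive_prim (f : R -> R) (y : R) : continuous f -> is_derive y 1 (prim f) (f y).
Proof.
move=> cf.
(* M is at most 0 and to the left of y, so that near y the primitive is an integral from the fixed
   point M, up to a constant. *)
pose M := - (`|y| + 1).
have M0 : M <= 0 by rewrite oppr_le0 addr_ge0.
have My : M < y.
  by rewrite /M ltrNl (le_lt_trans (ler_norm _))// normrN ltrDl.
have E z : M < z -> prim f z = \int[mu]_(v in `[M, z]) f v - \int[mu]_(v in `[M, 0]) f v.
  move=> Mz; have [z0|/ltW z0] := leP 0 z.
    by rewrite primE// [X in X - _](@Rintegral_cat f M 0 z)// addrC addKr.
  rewrite [X in _ - X](@Rintegral_cat f M z 0)//; last exact: ltW.
  rewrite opprD addrA subrr /prim.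
  move: z0; rewrite le_eqVlt => /predU1P[->|z0].
    by rewrite set_itv1 Rintegral_set1.
  congr (_ - _); rewrite set_itv_ge ?Rintegral_set0// -leNgt bnd_simp.
  exact: z0.
have [d1 d2] := @continuous_FTC1_closed _ f M y (y + 1) (ltr_pwDr ltr01 (lexx y))
  (continuous_integrable _ _ cf) My (cf y).
have d3 : is_derive y 1 (fun z => \int[mu]_(v in `[M, z]) f v) (f y).
  by apply: DeriveDef; [exact: d1|rewrite -derive1E; exact: d2].

have d4 : is_derive y 1 (fun z => \int[mu]_(v in `[M, z]) f v - \int[mu]_(v in `[M, 0]) f v) (f y).
  rewrite -[f y]subr0; apply: is_deriveB.
apply: (near_eq_is_derive _ d4).
near=> z; rewrite E//.
by near: z; exact: lt_nbhsr.
Unshelve. all: by end_near. Qed.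

Lemma is_derive_continuous (f df : R -> R) :
  (forall t : R, is_derive t 1 f (df t)) -> continuous f.
Proof.
move=> h t; apply: differentiable_continuous; apply/derivable1_diffP.
by case: (h t).
Qed.

Lemma continuous_prim (f : R -> R) : continuous f -> continuous (prim f).
Proof. by move=> cf; apply: is_derive_continuous => t; exact: is_derive_prim. Qed.

Lemma le_is_derive (F f : R -> R) (a b : R) :
  (forall t : R, is_derive t 1 F (f t)) -> (forall t, a < t < b -> f t <= 0) ->
  a <= b -> F b <= F a.
Proof.
move=> dF f0 ab.
have cF := is_derive_continuous dF.
apply: (@ler0_derive1_nincr _ F a b) => //.
- move=> x; rewrite in_itv/= => xab; rewrite derive1E.
  by case: (dF x) => _ ->; rewrite ?f0.
- exact: continuous_subspaceT.
Qed.

(** Only derivatives at positive times are required, as in the equations for s and xbar; continuity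
    takes care of 0, because F minus the primitive is both nonincreasing and nondecreasing. *)
Lemma eq_prim (F f : R -> R) : continuous F -> continuous f ->
  (forall t : R, 0 < t -> is_derive t 1 F (f t)) ->
  forall t, 0 <= t -> F t = F 0 + prim f t.
Proof.
move=> cF cf dF t t0; pose H x := F x - prim f x.
have cH : continuous H.
  by move=> x; apply: cvgB; [exact: cF | exact: continuous_prim].
have dH (x : R) : 0 < x -> is_derive x 1 H 0.
  move=> x0; rewrite -(subrr (f x)); apply: is_deriveB; first exact: dF.
  exact: is_derive_prim.
have HE : H t = H 0.
  apply/eqP; rewrite eq_le; apply/andP; split.
    apply: (@ler0_derive1_nincr _ H 0 t) => //.
    - move=> x; rewrite in_itv/= => /andP[x0 _].
      by case: (dH x x0).
    - move=> x; rewrite in_itv/= => /andP[x0 _]; rewrite derive1E.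
      by case: (dH x x0) => _ ->; rewrite ?f0.
    - exact: continuous_subspaceT.
  apply: (@ger0_derive1_ndecr _ H 0 t) => //.
  - move=> x; rewrite in_itv/= => /andP[x0 _].
    by case: (dH x x0).
  - move=> x; rewrite in_itv/= => /andP[x0 _]; rewrite derive1E.
    by case: (dH x x0) => _ ->; rewrite ?f0.
  - exact: continuous_subspaceT.
by move: HE; rewrite /H prim0 subr0 => <-; rewrite subrK.
Qed.

Lemma eq_in_prim (f g : R -> R) t : 0 <= t -> (forall v, 0 <= v <= t -> f v = g v) ->
  prim f t = prim g t.
Proof.
move=> t0 h; rewrite !primE//; apply: eq_Rintegral => v; rewrite inE/= in_itv/=.
exact: h.
Qed.

Lemma is_derive_mul (f g : R -> R) (t a b : R) : is_derive t 1 f a -> is_derive t 1 g b ->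
  is_derive t 1 (fun x => f x * g x) (a * g t + f t * b).
Proof.
move=> df dg; apply: (is_derive_eq (is_deriveM df dg)).
by rewrite /GRing.scale/= addrC mulrC.
Qed.

Lemma is_derive_bigsum (I : Type) (s : seq I) (f : I -> R -> R) (t : R) (df : I -> R) :
  (forall i, is_derive t 1 (f i) (df i)) ->
  is_derive t 1 (fun x => \sum_(i <- s) f i x) (\sum_(i <- s) df i).
Proof.
move=> h; elim: s => [|i s IH].
  rewrite big_nil (_ : (fun x => _) = cst 0); first exact: is_derive_cst.
  by apply/funext => x; rewrite big_nil.
rewrite big_cons (_ : (fun x => _) = (fun x => f i x + \sum_(j <- s) f j x)).
  exact: is_deriveD.
by apply/funext => x; rewrite big_cons.
Qed.

(** Entrywise derivatives reduce vector calculus to the real case; [is_vderive_derivable] and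
    [derivable_is_vderive] translate to and from [derivable]. *)
Definition is_vderive m n (u : R -> 'M[R]_(m, n)) (t : R) (du : 'M[R]_(m, n)) :=
  forall i j, is_derive t 1 (fun x => u x i j) (du i j).

Lemma is_vderiveD m n (u v : R -> 'M[R]_(m, n)) t du dv :
  is_vderive u t du -> is_vderive v t dv ->
  is_vderive (fun x => u x + v x) t (du + dv).
Proof.
move=> hu hv i j; rewrite mxE.
rewrite (_ : (fun x => _) = (fun x => u x i j + v x i j)).
  exact: is_deriveD (hu i j) (hv i j).
by apply/funext => x; rewrite mxE.
Qed.

Lemma is_vderive_cst m n (c : 'M[R]_(m, n)) t : is_vderive (fun=> c) t 0.
Proof. by move=> i j; rewrite mxE; exact: is_derive_cst. Qed.

Lemma is_vderiveM m n p (u : R -> 'M[R]_(m, n)) (v : R -> 'M[R]_(n, p)) t du dv :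
  is_vderive u t du -> is_vderive v t dv ->
  is_vderive (fun x => u x *m v x) t (du *m v t + u t *m dv).
Proof.
move=> hu hv i j; rewrite !mxE -big_split/=.
rewrite (_ : (fun x => _) = (fun x => \sum_k u x i k * v x k j)).
  by apply: is_derive_bigsum => k; exact: is_derive_mul (hu i k) (hv k j).
by apply/funext => x; rewrite mxE.
Qed.

Lemma is_vderive_bform n m (M : 'M[R]_(n, m)) (u : R -> 'cV[R]_n) (v : R -> 'cV[R]_m) (t : R) du dv :
  is_vderive u t du -> is_vderive v t dv ->
  is_derive t 1 (fun x => bform M (u x) (v x)) (bform M du (v t) + bform M (u t) dv).
Proof.
move=> hu hv.
have hu' : is_vderive (fun x => (u x)^T) t du^T.
  move=> i j; rewrite mxE (_ : (fun x => _) = (fun x => u x j i)); first exact: hu.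
  by apply/funext => x; rewrite mxE.
have h := is_vderiveM (is_vderiveM hu' (@is_vderive_cst _ _ M t)) hv.
by apply: (is_derive_eq (h 0 0)); rewrite mulmx0 addr0 mxE.
Qed.

Definition vcontinuous m n (u : R -> 'M[R]_(m, n)) :=
  forall i j, continuous (fun t => u t i j).

Lemma is_vderive_continuous m n (u du : R -> 'M[R]_(m, n)) :
  (forall t, is_vderive u t (du t)) -> vcontinuous u.
Proof. by move=> h i j; apply: is_derive_continuous => t; exact: h. Qed.

Lemma vcontinuous_cst m n (c : 'M[R]_(m, n)) : vcontinuous (fun=> c).
Proof. by move=> i j t; exact: cvg_cst. Qed.

Lemma vcontinuousD m n (u v : R -> 'M[R]_(m, n)) :
  vcontinuous u -> vcontinuous v -> vcontinuous (fun t => u t + v t).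
Proof.
move=> hu hv i j t; rewrite /continuous_at mxE; under eq_fun do rewrite mxE.
exact: cvgD (hu i j t) (hv i j t).
Qed.

Lemma vcontinuousN m n (u : R -> 'M[R]_(m, n)) :
  vcontinuous u -> vcontinuous (fun t => - u t).
Proof.
move=> hu i j t; rewrite /continuous_at mxE; under eq_fun do rewrite mxE.
exact: cvgN (hu i j t).
Qed.

Lemma vcontinuousB m n (u v : R -> 'M[R]_(m, n)) :
  vcontinuous u -> vcontinuous v -> vcontinuous (fun t => u t - v t).
Proof. by move=> hu hv; apply: vcontinuousD => //; exact: vcontinuousN. Qed.

Lemma vcontinuousM m n p (u : R -> 'M[R]_(m, n)) (v : R -> 'M[R]_(n, p)) :
  vcontinuous u -> vcontinuous v -> vcontinuous (fun t => u t *m v t).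
Proof.
move=> hu hv i j t; rewrite /continuous_at mxE; under eq_fun do rewrite mxE.
by apply: (cvg_big add_continuous) => k _; exact: cvgM (hu i k t) (hv k j t).
Qed.

Lemma vcontinuous_sum m n (I : Type) (s : seq I) (u : I -> R -> 'M[R]_(m, n)) :
  (forall i, vcontinuous (u i)) -> vcontinuous (fun t => \sum_(i <- s) u i t).
Proof.
move=> h; elim: s => [|k s IH].
  by under eq_fun do rewrite big_nil; exact: vcontinuous_cst.
by under eq_fun do rewrite big_cons; exact: vcontinuousD.
Qed.

Lemma vcontinuousZ m n (c : R) (u : R -> 'M[R]_(m, n)) :
  vcontinuous u -> vcontinuous (fun t => c *: u t).
Proof.
move=> hu; have := vcontinuousM (@vcontinuous_cst _ _ c%:M) hu.
by under eq_fun do rewrite mul_scalar_mx.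
Qed.

Lemma vcontinuous_sqnorm n (u : R -> 'cV[R]_n) :
  vcontinuous u -> continuous (fun t => sqnorm (u t)).
Proof.
move=> hu t; rewrite /sqnorm; apply: (cvg_big add_continuous) => k _.
by rewrite expr2; under eq_fun do rewrite expr2; exact: cvgM (hu k 0 t) (hu k 0 t).
Qed.

Definition vprim n (g : R -> 'cV[R]_n) (t : R) : 'cV[R]_n :=
  \col_i prim (fun v => g v i 0) t.

Lemma is_vderive_vprim n (g : R -> 'cV[R]_n) t : vcontinuous g ->
  is_vderive (vprim g) t (g t).
Proof.
move=> cg i j; rewrite (ord1 j).
rewrite (_ : (fun x => _) = prim (fun v => g v i 0)).
  exact: is_derive_prim.
by apply/funext => x; rewrite mxE.
Qed.

Lemma vprim0 n (g : R -> 'cV[R]_n) : vprim g 0 = 0.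
Proof. by apply/matrixP => i j; rewrite !mxE prim0. Qed.

Lemma vcontinuous_vprim n (g : R -> 'cV[R]_n) : vcontinuous g ->
  vcontinuous (vprim g).
Proof. by move=> cg; apply: is_vderive_continuous => t; exact: is_vderive_vprim. Qed.

Lemma vcontinuous_clip m n (g : R -> 'M[R]_(m, n)) :
  {within `[0, +oo[, continuous g} -> vcontinuous (fun t : R => g (Num.max t 0)).
Proof.
move=> /continuous_clip h i j t.
have := @coord_continuous R m n i j (g (Num.max t 0)).
by apply: continuous_comp; exact: h.
Qed.

Lemma within_vcontinuous m n (A : set R) (g : R -> 'M[R]_(m, n)) :
  vcontinuous g -> {within A, continuous g}.
Proof.
move=> h; apply: continuous_subspaceT => t.
apply/cvg_mx_entourageP => E entE.
have hh i j : \forall s \near t, (g t i j, g s i j) \in E.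
  have /cvg_app_entourageP/(_ _ entE) := h i j t.
  by apply: filterS => s; rewrite inE.
near=> s => i j.
move: i j; near: s.
by apply: filter_forall => i; apply: filter_forall => j; exact: hh.
Unshelve. all: by end_near. Qed.

End calculus.

(** * Matrix exponential and variation of constants *)

Section matrix_exponential.
Context {R : realType}.

(** The geometric bound on a lets the series be dominated by C exp(c |x|). *)
Lemma fact_pseries_cvg (a : nat -> R) C c x : 0 <= c ->
  (forall k, `|a k| <= C * c ^+ k) ->
  cvgn (pseries (fun k => a k / k`!%:R) x).
Proof.
move=> c0 ha; apply: normed_cvg.
apply: (@series_le_cvg _ _ (fun k => C * exp_coeff (c * `|x|) k)) => //.
- by move=> k; exact: normr_ge0.
- move=> k; have C0 : 0 <= C.
    by have := ha 0%N; rewrite expr0 mulr1; exact: le_trans.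
  by rewrite mulr_ge0// exp_coeff_ge0// mulr_ge0.
- move=> k /=; rewrite !normrM normfV normr_nat normrX /exp_coeff /= exprMn.
  rewrite -mulrA (mulrC (_^-1)) -[c ^+ k * _ * _]mulrA [leRHS]mulrA ler_wpM2r//.
- have -> : (fun k => C * exp_coeff (c * `|x|) k) = C *: (exp_coeff (c * `|x|)).
    by apply/funext.
  by apply: is_cvg_seriesZ; exact: is_cvg_series_exp_coeff.
Qed.

Lemma fact_pseries_derive (a : nat -> R) C c (x : R) : 0 <= c ->
  (forall k, `|a k| <= C * c ^+ k) ->
  is_derive x 1 (fun y => limn (pseries (fun k => a k / k`!%:R) y))
     (limn (pseries (fun k => a k.+1 / k`!%:R) x)).
Proof.
move=> c0 ha.
(* Formal differentiation is an index shift, because (k + 1) / (k + 1)! = 1 / k!, and a shifted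
   sequence keeps a geometric bound; so the series and its first two formal derivatives converge, as
   term-by-term differentiation requires. *)
have dE (b : nat -> R) : pseries_diffs (fun k => b k / k`!%:R) =
    (fun k => b k.+1 / k`!%:R).
  apply/funext => k; rewrite /pseries_diffs factS natrM invfM.
  by rewrite mulrCA mulVKf// pnatr_eq0.

have hS (b : nat -> R) C' : (forall k, `|b k| <= C' * c ^+ k) ->
    forall k, `|b k.+1| <= (C' * c) * c ^+ k.
  by move=> hb k; have := hb k.+1; rewrite exprS mulrA.
have := @pseries_snd_diffs _ (fun k => a k / k`!%:R) (`|x| + 1) x.
rewrite !dE; apply.
- exact: fact_pseries_cvg c0 ha.
- exact: fact_pseries_cvg c0 (hS _ _ ha).
- exact: fact_pseries_cvg c0 (hS _ _ (hS _ _ ha)).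
- by rewrite [ltRHS]ger0_norm ?addr_ge0// ltrDl.
Qed.

Variable n : nat.
Implicit Types M : 'M[R]_n.

Definition mpow M k : 'M[R]_n := iter k (mulmx M) 1%:M.

Lemma mpow_bound M : exists2 c, 0 <= c & forall k i j, `|mpow M k i j| <= 1 * c ^+ k.
Proof.
exists (\sum_i \sum_j `|M i j|).
  by apply: sumr_ge0 => i _; exact: sumr_ge0.
set c := \sum_i _; have c0 : 0 <= c by apply: sumr_ge0 => i _; exact: sumr_ge0.
elim=> [|k IH] i j.
  rewrite expr0 mulr1 /= mxE; case: eqP => _; rewrite ?normr1// normr0.
  exact: ler01.
rewrite /= mxE mul1r exprS (le_trans (ler_norm_sum _ _ _))//.
rewrite (@le_trans _ _ (\sum_l `|M i l| * c ^+ k))//.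
  apply: ler_sum => l _; rewrite normrM ler_wpM2l//.
  by have := IH l j; rewrite mul1r.
rewrite -mulr_suml ler_wpM2r ?exprn_ge0// /c [leRHS](bigD1 i)//= lerDl.
by apply: sumr_ge0 => l _; exact: sumr_ge0.
Qed.

Lemma mpowSr M k : mpow M k.+1 = mpow M k *m M.
Proof.
by elim: k => [|k IH] /=; [rewrite mulmx1 mul1mx | rewrite -mulmxA -IH].
Qed.

(** The exponential exp(t M), defined entry by entry so that real power series can be
    differentiated. *)
Definition mexp M (t : R) : 'M[R]_n :=
  \matrix_(i, j) limn (pseries (fun k => mpow M k i j / k`!%:R) t).

Lemma mexp_pseries M t i j :
  pseries (fun k => mpow M k i j / k`!%:R) t @ \oo --> mexp M t i j.
Proof.
have [c c0 hc] := mpow_bound M; rewrite mxE.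
have h : cvgn (pseries (fun k => mpow M k i j / k`!%:R) t).
  exact: fact_pseries_cvg c0 (fun k => hc k i j).
exact: h.
Qed.

Lemma mexp0 M : mexp M 0 = 1%:M.
Proof.
apply/matrixP => i j; rewrite -(cvg_lim _ (@mexp_pseries M 0 i j))//.
apply: cvg_lim => //; rewrite -(cvg_shiftS (pseries _ _)).
rewrite (_ : (fun k => _) = fun=> (1%:M : 'M[R]_n) i j).
  exact: cvg_cst.
apply/funext => k; rewrite /pseries/= /series/= big_nat_recl//.
rewrite expr0 mulr1 /= fact0 divr1 big1 ?addr0// => l _.
by rewrite expr0n/= mulr0.
Qed.

Lemma mulmx_mexp_pseries M t i j :
  (pseries (fun k => mpow M k.+1 i j / k`!%:R) t @ \oo --> (M *m mexp M t) i j) *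
  (pseries (fun k => mpow M k.+1 i j / k`!%:R) t @ \oo --> (mexp M t *m M) i j).
Proof.
split; rewrite mxE.
  rewrite (_ : pseries _ t = fun k => \sum_l M i l *
       pseries (fun k => mpow M k l j / k`!%:R) t k).
    apply: (cvg_big add_continuous) => l _.
    by apply: cvgMl_tmp; exact: mexp_pseries.
  apply/funext => k; rewrite /pseries/= /series/=.
  under [RHS]eq_bigr do rewrite mulr_sumr.
  rewrite exchange_big; apply: eq_bigr => m _ /=.
  by rewrite mxE !mulr_suml; apply: eq_bigr => l _; ring.
rewrite (_ : pseries _ t = fun k => \sum_l 
       pseries (fun k => mpow M k i l / k`!%:R) t k * M l j).
  apply: (cvg_big add_continuous) => l _.
  by apply: cvgMr_tmp; exact: mexp_pseries.
apply/funext => k; rewrite /pseries/= /series/=.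
under [RHS]eq_bigr do rewrite mulr_suml.
rewrite exchange_big; apply: eq_bigr => m _ /=.
rewrite -[M *m _]/(mpow M m.+1) mpowSr.
by rewrite mxE !mulr_suml; apply: eq_bigr => l _; ring.
Qed.

Lemma mexp_comm M t : M *m mexp M t = mexp M t *m M.
Proof.
apply/matrixP => i j; rewrite -(cvg_lim _ (mulmx_mexp_pseries M t i j).1)//.
exact: cvg_lim (mulmx_mexp_pseries M t i j).2.

Qed.

Lemma is_vderive_mexp M t : is_vderive (mexp M) t (M *m mexp M t).
Proof.
move=> i j; have [c c0 hc] := mpow_bound M.
rewrite (_ : (fun x => _) = fun y => limn (pseries (fun k => mpow M k i j / k`!%:R) y)).
  rewrite -(cvg_lim _ (mulmx_mexp_pseries M t i j).1)//.
  exact: fact_pseries_derive c0 (fun k => hc k i j).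
by apply/funext => x; rewrite mxE.
Qed.

Lemma is_vderive_comp_opp m p (u : R -> 'M[R]_(m, p)) (t : R) du :
  is_vderive u (- t) du -> is_vderive (fun x => u (- x)) t (- du).
Proof.
move=> h i j; rewrite mxE.
have dN : is_derive t 1 (fun x : R => - x) (- 1 : R).
  by apply: is_deriveN.
by have := @is_derive1_comp _ _ _ _ _ _ (h i j) dN; rewrite mulrN1.
Qed.

(** The product has derivative zero, since M commutes with its exponential. *)
Lemma mexp_mulN M t : mexp M t *m mexp M (- t) = 1%:M.
Proof.
have h (s : R) : is_vderive (fun x => mexp M x *m mexp M (- x)) s 0.
  have := is_vderiveM (is_vderive_mexp M s) (is_vderive_comp_opp (is_vderive_mexp M (- s))).
  by rewrite mulmxN mulmxA mexp_comm subrr.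
apply/matrixP => i j.
transitivity ((mexp M 0 *m mexp M (- 0)) i j); last by rewrite oppr0 mexp0 mulmx1.
apply: (@is_derive_0_is_cst R (fun x => (mexp M x *m mexp M (- x)) i j)) => s.
by have := h s i j; rewrite mxE.
Qed.

Lemma vcontinuous_mexp M : vcontinuous (mexp M).
Proof. by apply: is_vderive_continuous => t; exact: is_vderive_mexp. Qed.

Lemma vcontinuous_mexpN M : vcontinuous (fun t => mexp M (- t)).
Proof.
apply: is_vderive_continuous => t.
exact: is_vderive_comp_opp (is_vderive_mexp M (- t)).
Qed.

(** Variation of constants for z' = M z + g with z(0) = c. *)
Definition lin_ode M (c : 'cV[R]_n) (g : R -> 'cV[R]_n) (t : R) : 'cV[R]_n :=
  mexp M t *m (c + vprim (fun v => mexp M (- v) *m g v) t).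

Lemma lin_ode0 M c g : lin_ode M c g 0 = c.
Proof. by rewrite /lin_ode mexp0 mul1mx vprim0 addr0. Qed.

Lemma is_vderive_lin_ode M c g t : vcontinuous g ->
  is_vderive (lin_ode M c g) t (M *m lin_ode M c g t + g t).
Proof.
move=> cg.
have cE : vcontinuous (fun v => mexp M (- v) *m g v).
  by apply: vcontinuousM => //; exact: vcontinuous_mexpN.
have := is_vderiveM (is_vderive_mexp M t)
  (is_vderiveD (@is_vderive_cst R n 1 c t) (is_vderive_vprim t cE)).
by rewrite add0r mulmxA mexp_mulN mul1mx /lin_ode mulmxA.
Qed.

Lemma vcontinuous_lin_ode M c g : vcontinuous g -> vcontinuous (lin_ode M c g).
Proof. by move=> cg; apply: is_vderive_continuous => t; exact: is_vderive_lin_ode. Qed.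

End matrix_exponential.

(** * Discounted energy estimates *)

Section discounted_L2.
Context {R : realType}.
Local Notation mu := (@lebesgue_measure R).

Lemma integral_prim (f : R -> R) t : continuous f -> 0 <= t ->
  (\int[mu]_(v in `[0%R, t]) (f v)%:E)%E = (prim f t)%:E.
Proof.
move=> cf t0; rewrite primE// /Rintegral fineK//.
by apply: integrable_fin_num => //; exact: continuous_integrable.
Qed.

Lemma le_prim (f g : R -> R) t : continuous f -> continuous g -> 0 <= t ->
  (forall v, 0 <= v <= t -> f v <= g v) -> prim f t <= prim g t.
Proof.
move=> cf cg t0 fg; rewrite !primE//; apply: le_Rintegral => //.
- exact: continuous_integrable.
- exact: continuous_integrable.
Qed.

Lemma primD (f g : R -> R) t : continuous f -> continuous g -> 0 <= t ->
  prim (fun v => f v + g v) t = prim f t + prim g t.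
Proof.
move=> cf cg t0; rewrite !primE// RintegralD//; exact: continuous_integrable.
Qed.

Lemma primZ k (f : R -> R) t : continuous f -> 0 <= t ->
  prim (fun v => k * f v) t = k * prim f t.
Proof.
move=> cf t0; rewrite !primE// RintegralZl//; exact: continuous_integrable.
Qed.

Lemma prim_ge0 (f : R -> R) t : (forall v, 0 <= f v) -> 0 <= t -> 0 <= prim f t.
Proof. by move=> f0 t0; rewrite primE//; apply: Rintegral_ge0. Qed.

Lemma prim_homo (f : R -> R) s t : continuous f -> (forall v, 0 <= f v) ->
  0 <= s <= t -> prim f s <= prim f t.
Proof.
move=> cf f0 /andP[s0 st]; rewrite !primE// ?(le_trans s0)//.
by rewrite (Rintegral_cat cf s0 st) lerDl Rintegral_ge0.
Qed.

Lemma continuous_scale k (f : R -> R) : continuous f -> continuous (fun v => k * f v).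
Proof. by move=> cf t; apply: cvgMl_tmp; exact: cf. Qed.

Lemma continuousM_fun (f g : R -> R) : continuous f -> continuous g ->
  continuous (fun v => f v * g v).
Proof. by move=> cf cg t; exact: cvgM (cf t) (cg t). Qed.

Lemma continuousD_fun (f g : R -> R) : continuous f -> continuous g ->
  continuous (fun v => f v + g v).
Proof. by move=> cf cg t; exact: cvgD (cf t) (cg t). Qed.

Lemma is_derive_expRZ k (t : R) :
  is_derive t 1 (fun x => expR (k * x)) (k * expR (k * t)).
Proof.
have dk : is_derive t 1 (fun x : R => k * x) k.
  have := is_deriveZ k (is_derive_id t (1 : R)).
  by rewrite /GRing.scale/= mulr1.
by have := @is_derive1_comp _ _ _ _ _ _ (is_derive_expR (k * t)) dk; rewrite mulrC.
Qed.

Lemma continuous_expRZ (k : R) : continuous (fun x => expR (k * x)).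
Proof. by apply: is_derive_continuous => t; exact: is_derive_expRZ. Qed.

Definition energy_density n (rho : R) (q : R -> 'cV[R]_n) (t : R) : R :=
  expR (- rho * t) * sqnorm (q t).

Lemma energy_density_ge0 n rho (q : R -> 'cV[R]_n) t : 0 <= energy_density rho q t.
Proof. by rewrite mulr_ge0 ?expR_ge0 ?sqnorm_ge0. Qed.

Lemma continuous_energy_density n rho (q : R -> 'cV[R]_n) : vcontinuous q ->
  continuous (energy_density rho q).
Proof.
move=> cq; apply: continuousM_fun; first exact: continuous_expRZ.
exact: vcontinuous_sqnorm.
Qed.
Arguments continuous_energy_density [n] rho [q] _.


Definition L2rho n (rho : R) (q : R -> 'cV[R]_n) :=
  (\int[mu]_(t in `[0%R, +oo[) (expR (- rho * t) * sqnorm (q t))%:E < +oo)%E.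

(** The integral over the half-line is the supremum of the integrals over [0, m]; energy estimates
    can therefore be made with real numbers on bounded intervals, with a bound independent of t. *)
Lemma L2rhoP n rho (q : R -> 'cV[R]_n) : vcontinuous q ->
  L2rho rho q <-> exists K, forall t, 0 <= t -> prim (energy_density rho q) t <= K.
Proof.
move=> cq; have ce := continuous_energy_density rho cq.
have me : measurable_fun setT (energy_density rho q) by exact: continuous_measurable_fun.
have e0 := energy_density_ge0 rho q.
have E := @ge0_integral_ereal_sup _ mu _ e0 me.
rewrite /L2rho -/(energy_density rho q _); split.
  under eq_integral do rewrite -/(energy_density rho q _).
  move=> h.
  have f : (\int[mu]_(t in `[0%R, +oo[) (energy_density rho q t)%:E)%E \is a fin_num.
    by rewrite ge0_fin_numE// integral_ge0// => t _; rewrite lee_fin.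
  exists (fine (\int[mu]_(t in `[0%R, +oo[) (energy_density rho q t)%:E)%E) => t t0.
  rewrite -lee_fin fineK// -integral_prim//.
  apply: ge0_subset_integral => //=.
  - by apply/measurable_EFinP; exact: measurable_funTS.
  - by move=> v _; rewrite lee_fin.
  - exact: subset_itvl.
move=> [K hK]; under eq_integral do rewrite -/(energy_density rho q _).
rewrite E; apply: (@le_lt_trans _ _ K%:E); last exact: ltry.
apply: ge_ereal_sup => _ [m _ <-].
by rewrite integral_prim// lee_fin hK.
Qed.

Lemma L2rho_cst n (rho : R) (c : 'cV[R]_n) : 0 < rho -> L2rho rho (fun=> c).
Proof.
move=> rho0; apply/L2rhoP; first exact: vcontinuous_cst.
exists (sqnorm c / rho) => t t0.
pose F x := - (sqnorm c / rho) * expR (- rho * x).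
have dF (x : R) : is_derive x 1 F (energy_density rho (fun=> c) x).
  have := is_derive_mul (is_derive_cst (- (sqnorm c / rho)) x 1) (is_derive_expRZ (- rho) x).
  move/is_derive_eq; apply; rewrite /energy_density mul0r add0r mulrA mulrNN.
  by rewrite divfK ?gt_eqF// mulrC.
have cF := is_derive_continuous dF.
have cc := continuous_energy_density rho (@vcontinuous_cst R n 1 c).
have := eq_prim cF cc (fun x _ => dF x) t0.
rewrite /F mulr0 expR0 => h.
have : 0 <= (sqnorm c / rho) * expR (- rho * t).
  by rewrite mulr_ge0 ?expR_ge0 ?divr_ge0 ?sqnorm_ge0// ltW.
lra.
Qed.

Lemma L2rhoD n rho (u v : R -> 'cV[R]_n) : vcontinuous u -> vcontinuous v ->
  L2rho rho u -> L2rho rho v -> L2rho rho (fun t => u t + v t).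
Proof.
move=> cu cv /(L2rhoP _ cu)[K hK] /(L2rhoP _ cv)[L hL].
apply/L2rhoP; first exact: vcontinuousD.
exists (2 * (K + L)) => t t0.
have cu' := continuous_energy_density rho cu.
have cv' := continuous_energy_density rho cv.
apply: (@le_trans _ _ (prim (fun x => 2 * (energy_density rho u x + energy_density rho v x)) t)).
  apply: le_prim => //.
  - by apply: continuous_energy_density; exact: vcontinuousD.
  - by apply: continuous_scale; exact: continuousD_fun.
  - move=> x _; rewrite /energy_density -mulrDr mulrCA ler_wpM2l ?expR_ge0//.
    exact: sqnormD_le.
rewrite primZ//; last exact: continuousD_fun.
by rewrite primD// ler_pM2l// lerD ?hK ?hL.
Qed.

Lemma L2rhoM n m rho (M : 'M[R]_(m, n)) (u : R -> 'cV[R]_n) : vcontinuous u ->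
  L2rho rho u -> L2rho rho (fun t => M *m u t).
Proof.
move=> cu /(L2rhoP _ cu)[K hK]; have [C C0 hC] := sqnorm_mulmx_le M.
have cu' := continuous_energy_density rho cu.
have cM : vcontinuous (fun t => M *m u t).
  by apply: vcontinuousM => //; exact: vcontinuous_cst.
apply/(L2rhoP _ cM); exists (C * K) => t t0.
apply: (@le_trans _ _ (prim (fun x => C * energy_density rho u x) t)).
  apply: le_prim => //.
  - exact: continuous_energy_density.
  - exact: continuous_scale.
  - by move=> x _; rewrite /energy_density mulrCA ler_wpM2l ?expR_ge0.
by rewrite primZ// ler_pM2l// hK.
Qed.

Lemma L2rhoN n rho (u : R -> 'cV[R]_n) : L2rho rho u -> L2rho rho (fun t => - u t).
Proof.
rewrite /L2rho => h.
apply: le_lt_trans h; rewrite le_eqVlt; apply/orP; left; apply/eqP.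
by apply: eq_integral => t _; rewrite sqnormN.
Qed.

Lemma L2rho_clip n rho (u : R -> 'cV[R]_n) : L2rho rho u ->
  L2rho rho (fun t : R => u (Num.max t 0)).
Proof.
rewrite /L2rho => h.
apply: le_lt_trans h; rewrite le_eqVlt; apply/orP; left; apply/eqP.
by apply: eq_integral => t; rewrite inE/= in_itv/= andbT => t0; rewrite max_l.
Qed.

End discounted_L2.
Arguments continuous_energy_density {R} [n] rho [q] _.


Section energy_estimates.
Context {R : realType}.

(** Rescaling u by sqrt(s) and v by its inverse leaves the value of the form unchanged. *)
Lemma bform_young n m (M : 'M[R]_(n, m)) : exists2 K, 0 < K &
  forall s u v, 0 < s -> `|bform M u v| <= K * (s * sqnorm u + s^-1 * sqnorm v).
Proof.
set K := \sum_i \sum_j `|M i j|; have K0 : 0 <= K.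
  by apply: sumr_ge0 => i _; exact: sumr_ge0.
exists (K + 1) => [|s u v s0]; first by rewrite ltr_wpDl.
have q0 : 0 < Num.sqrt s by rewrite sqrtr_gt0.
have := bform_le M (Num.sqrt s *: u) ((Num.sqrt s)^-1 *: v).
rewrite bformZl bformZr mulrA mulfV ?gt_eqF// mul1r !sqnormZ exprVn.
rewrite sqr_sqrtr ?(ltW s0)// => /le_trans; apply; rewrite ler_wpM2r ?lerDl//.
by rewrite addr_ge0// mulr_ge0 ?sqnorm_ge0// ?invr_ge0 ltW.
Qed.

(** The left-hand side of the inequality is exp(rho t) times the derivative of exp(- rho t) z^T H z
    along z' = M z + g: a dissipation inequality with gain C from the input g. *)
Definition lyapunov_data n (rho : R) (M H : 'M[R]_n) (c ga C : R) :=
  [/\ posdef H, [/\ 0 < c, 0 < ga & 0 < C] & forall v g,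
    2 * bform H v (M *m v + g) - rho * bform H v v <=
      - c * sqnorm v - ga * bform H v v + C * sqnorm g].

Lemma hurwitz_lyapunov_data n (rho : R) (M : 'M[R]_n) :
  hurwitz (M - (rho / 2)%:M) ->
  exists H c ga C, lyapunov_data rho M H c ga C.
Proof.
move=> /hurwitz_lyapunov[H pH [c0 c00 hc]].
have [K K0 hK] := bform_bounded H.
have [L L0 hL] := bform_young H.
(* Of the available 2 [c0] |v|^2, half goes to the conclusion; the cross term with g and the term
   [ga] H take [c0] / 2 each, which determines s and [ga]. *)
pose s := c0 / (4 * L).
have s0 : 0 < s by rewrite divr_gt0// mulr_gt0.
pose ga := c0 / (4 * K); have ga0 : 0 < ga by rewrite divr_gt0// mulr_gt0.
exists H, c0, ga, (2 * L * s^-1); split=> //.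
  by split=> //; rewrite !mulr_gt0// invr_gt0.
move=> v g; rewrite bformDr.
have := hc v; rewrite mulmxBl mul_scalar_mx bformDr bformNr bformZr => h1.
have h2 := le_trans (ler_norm _) (hL s v g s0).
have h3 := le_trans (ler_norm _) (hK v v).
have e1 : 2 * (L * (s * sqnorm v)) = c0 / 2 * sqnorm v.
  by rewrite /s; field; rewrite gt_eqF.
have h4 : ga * bform H v v <= c0 / 2 * sqnorm v.
  rewrite (le_trans (ler_wpM2l (ltW ga0) h3))// /ga le_eqVlt; apply/orP; left.
  by apply/eqP; field; rewrite gt_eqF.
have n0 := sqnorm_ge0 v.
lra.
Qed.

Lemma is_derive_weighted_form n (H : 'M[R]_n) k (q : R -> 'cV[R]_n) (t : R) dq :
  symmetric_mx H -> is_vderive q t dq ->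
  is_derive t 1 (fun x => expR (k * x) * bform H (q x) (q x))
    (expR (k * t) * (k * bform H (q t) (q t) + 2 * bform H (q t) dq)).
Proof.
move=> sH hq.
have h := is_derive_mul (is_derive_expRZ k t) (is_vderive_bform H hq hq).
apply: (is_derive_eq h); rewrite (bformC dq (q t) sH); ring.
Qed.

(** The weighted Lyapunov function plus the energy balance so far is nonincreasing. The derivative
    [dz] is separated from the equation because, once noise has been subtracted, the equation is
    known for positive times only. *)
Lemma energy_forward_le n (rho : R) (M H : 'M[R]_n) c ga C (z dz g : R -> 'cV[R]_n) :
  lyapunov_data rho M H c ga C -> vcontinuous g ->
  (forall t, is_vderive z t (dz t)) -> (forall t, 0 < t -> dz t = M *m z t + g t) ->
  forall t, 0 <= t -> c * prim (energy_density rho z) t <=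
    bform H (z 0) (z 0) + C * prim (energy_density rho g) t.
Proof.
move=> [pH [c0 ga0 C0] hL] cg dzE dze t t0.
have cz := is_vderive_continuous dzE.
have ez := continuous_energy_density rho cz; have eg := continuous_energy_density rho cg.
pose F x := expR (- rho * x) * bform H (z x) (z x)
  + (c * prim (energy_density rho z) x - C * prim (energy_density rho g) x).
have dF (x : R) : is_derive x 1 F (expR (- rho * x) * (- rho * bform H (z x) (z x)
     + 2 * bform H (z x) (dz x))
     + (c * energy_density rho z x - C * energy_density rho g x)).
  apply: is_deriveD; first exact: is_derive_weighted_form pH.1 (dzE x).
  apply: is_deriveB.
    have := is_derive_mul (is_derive_cst c x 1) (is_derive_prim x ez).
    by rewrite mul0r add0r.
  have := is_derive_mul (is_derive_cst C x 1) (is_derive_prim x eg).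
  by rewrite mul0r add0r.
have : F t <= F 0.
  apply: (le_is_derive dF) => // x /andP[x0 _]; rewrite (dze _ x0) /energy_density.
  rewrite (mulrCA c) (mulrCA C) -mulrBr -mulrDr pmulr_rle0 ?expR_gt0//.
  have := hL (z x) (g x).
  have := mulr_ge0 (ltW ga0) (psd_ge0 (z x) (posdef_psd pH)); lra.
rewrite /F !prim0 mulr0 expR0 mul1r.
have := psd_ge0 (z t) (posdef_psd pH).
move=> /(mulr_ge0 (expR_ge0 (- rho * t))); lra.
Qed.

Lemma energy_forward n (rho : R) (M H : 'M[R]_n) c ga C (z g : R -> 'cV[R]_n) :
  lyapunov_data rho M H c ga C -> vcontinuous g ->
  (forall t, is_vderive z t (M *m z t + g t)) ->
  L2rho rho g -> L2rho rho z.
Proof.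
move=> hL cg dzE hg; have [pH [c0 ga0 C0] _] := hL.
have cz := is_vderive_continuous dzE; have /(L2rhoP _ cg)[K hK] := hg.
apply/(L2rhoP _ cz).
exists (c^-1 * (bform H (z 0) (z 0) + C * K)) => t t0; rewrite ler_pdivlMl//.
apply: (le_trans (energy_forward_le hL cg dzE (fun t _ => erefl _) t0)).
by rewrite lerD2l ler_pM2l// hK.
Qed.

End energy_estimates.

(** * The backward equation for s *)

Section backward_equation.
Context {R : realType}.

Lemma is_vderive_derivable m n (u : R -> 'M[R]_(m, n)) (t : R) du :
  is_vderive u t du -> derivable u t 1 /\ derive1 u t = du.
Proof.
move=> h; have d : derivable u t 1.
  by apply/derivable_mxP => i j; case: (h i j).
split=> //; rewrite derive1E derive_mx//; apply/matrixP => i j; rewrite mxE.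
by case: (h i j).
Qed.

Lemma derivable_is_vderive m n (u : R -> 'M[R]_(m, n)) (t : R) :
  derivable u t 1 -> is_vderive u t (derive1 u t).
Proof.
move=> d i j; rewrite derive1E derive_mx// mxE; apply: DeriveDef => //.
by move/derivable_mxP : d; exact.
Qed.

(** The constant is an explicit continuous function of M, so it can be integrated in time when M is
    an exponential. *)
Lemma sqnorm_mulmx_entries n m (M : 'M[R]_(n, m)) (v : 'cV[R]_m) :
  sqnorm (M *m v) <= (2 ^+ m * \sum_j sqnorm (col j M)) * sqnorm v.
Proof.
have -> : M *m v = \sum_j v j 0 *: col j M.
  apply/matrixP => i k; rewrite (ord1 k) mxE summxE; apply: eq_bigr => j _.
  by rewrite !mxE mulrC.
apply: (le_trans (sqnorm_sum_le _ _)).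
rewrite /index_enum -enumT size_enum_ord -mulrA ler_wpM2l ?exprn_ge0//.
rewrite mulr_suml; apply: ler_sum => j _; rewrite sqnormZ mulrC ler_wpM2l ?sqnorm_ge0//.
by rewrite /sqnorm (bigD1 j)//= lerDl sumr_ge0// => k _; exact: sqr_ge0.
Qed.

(** Bolzano-Weierstrass, from the compactness of a box of row vectors; the conclusion is phrased
    with the squared Euclidean norm and with indices beyond any k. *)
Lemma cV_bounded_cluster n (x : nat -> 'cV[R]_n) b : (forall m, sqnorm (x m) <= b) ->
  exists p : 'cV[R]_n, forall e k, 0 < e ->
    exists2 m, (k <= m)%N & sqnorm (x m - p) < e.
Proof.
move=> hb; pose A := [set v : 'rV[R]_n | forall i, `[- (b + 1), b + 1]%classic (v ord0 i)].
have cA : compact A.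
  apply: (@rV_compact R n (fun=> `[- (b + 1), b + 1]%classic)) => i.
  exact: segment_compact.

have b0 : 0 <= b by apply: le_trans (hb 0%N); exact: sqnorm_ge0.
have xA m : A (x m)^T.
  move=> i; rewrite /= in_itv/= mxE -ler_norml.
  have h : (x m i 0) ^+ 2 <= b.
    apply: le_trans (hb m); rewrite /sqnorm (bigD1 i)//= lerDl.
    by apply: sumr_ge0 => k _; exact: sqr_ge0.
  rewrite -(@ler_pXn2r _ 2)// ?nnegrE ?addr_ge0// real_normK ?num_real//.
  apply: (le_trans h); have := sqr_ge0 b; lra.
have [p [Ap clp]] : A `&` cluster ((fun m => (x m)^T) @ \oo) !=set0.
  by apply: cA; exists 0%N => // m _; exact: xA.

exists p^T => e k e0.
pose V := [set v : 'rV[R]_n | sqnorm (v^T - p^T) < e].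
have nV : nbhs p V.
  have cf : continuous (fun v : 'rV[R]_n => sqnorm (v^T - p^T)).
    move=> v; rewrite /sqnorm.
    apply: (@cvg_big _ _ _ _ _ add_continuous _ (nbhs v)) => i _.

    have hc := @coord_continuous R 1 n 0 i v.
    have h : (fun w : 'rV[R]_n => (w^T - p^T) i 0) @ nbhs v --> (v^T - p^T) i 0.
      rewrite (_ : (fun w : 'rV[R]_n => _) = fun w : 'rV[R]_n => w 0 i - p 0 i).
        have -> : (v^T - p^T) i 0 = v 0 i - p 0 i by rewrite !mxE.
        exact: (@cvgB _ _ _ (nbhs v) _ _ _ _ _ hc (cvg_cst _)).
      by apply/funext => w; rewrite !mxE.
    by rewrite expr2; under eq_fun do rewrite expr2; exact: (cvgM h h).
  have := cf p; rewrite /continuous_at subrr sqnorm0 => /cvgr_lt; exact.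
have nF : ((fun m => (x m)^T) @ \oo) [set (x m)^T | m in [set m | (k <= m)%N]].
  by exists k => // m /= km; exists m.
have [v [[m /= km <-]]] := clp _ _ nF nV.
by rewrite /V/= trmxK => h; exists m.
Qed.

(* The solution is the limit of solutions with zero terminal value at time
   [m]: their initial values are bounded by the energy estimate. *)
Lemma backward_solution n (rho : R) (N : 'M[R]_n) (g : R -> 'cV[R]_n) :
  hurwitz (N - (rho / 2)%:M) -> vcontinuous g -> L2rho rho g ->
  exists s, (forall t, is_vderive s t ((rho%:M - N) *m s t - g t)) /\ L2rho rho s.
Proof.
move=> /hurwitz_lyapunov_data[K [c [ga [C [pK [c0 ga0 C0] hK]]]]] cg hg.
have /(L2rhoP _ cg)[G hG] := hg.
pose M := rho%:M - N.
pose s x := lin_ode M x (fun t => - g t).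
have cNg : vcontinuous (fun t => - g t) by exact: vcontinuousN.
have ds x t : is_vderive (s x) t (M *m s x t - g t) by exact: is_vderive_lin_ode.
have cs x : vcontinuous (s x) := is_vderive_continuous (ds x).
have es x := continuous_energy_density rho (cs x).
have eg := continuous_energy_density rho cg.
(* For decreasing time the equation for s is dissipative: with zero terminal value, the Lyapunov
   form of N bounds the initial value and the energy by the energy of g alone. *)
have est x t : 0 <= t -> s x t = 0 ->
    bform K x x + c * prim (energy_density rho (s x)) t <= C * G.
  move=> t0 st.
  pose F y := - (expR (- rho * y) * bform K (s x y) (s x y))
    + (c * prim (energy_density rho (s x)) y - C * prim (energy_density rho g) y).
  have dF (y : R) : is_derive y 1 F (- (expR (- rho * y) * (- rho * bform K (s x y) (s x y)
       + 2 * bform K (s x y) (M *m s x y - g y)))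
       + (c * energy_density rho (s x) y - C * energy_density rho g y)).
    apply: is_deriveD; first by apply: is_deriveN; exact: is_derive_weighted_form pK.1 (ds x y).
    apply: is_deriveB.
      have := is_derive_mul (is_derive_cst c y 1) (is_derive_prim y (es x)).
      by rewrite mul0r add0r.
    have := is_derive_mul (is_derive_cst C y 1) (is_derive_prim y eg).
    by rewrite mul0r add0r.
  have : F t <= F 0.
    apply: (le_is_derive dF) => // y _; rewrite /energy_density.
    rewrite (mulrCA c) (mulrCA C) -mulrBr -mulrN -mulrDr pmulr_rle0 ?expR_gt0//.
    have := hK (s x y) (g y).
    rewrite !bformDr bformNr /M mulmxBl mul_scalar_mx bformDr bformZr bformNr.
    have := mulr_ge0 (ltW ga0) (psd_ge0 (s x y) (posdef_psd pK)); lra.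
  rewrite /F st !prim0 mulr0 expR0 bform0l /s lin_ode0 -/(s x).
  have : C * prim (energy_density rho g) t <= C * G by rewrite ler_pM2l// hG.
  lra.
(* The initial value whose solution vanishes at time m. *)
pose x m : 'cV[R]_n := - vprim (fun v => mexp M (- v) *m (- g v)) m%:R.
have xm m : s (x m) m%:R = 0 by rewrite /s /lin_ode addNr mulmx0.
have [k k0 hk] := posdef_coercive pK.
have pe0 y t : 0 <= t -> 0 <= prim (energy_density rho (s y)) t.
  by move=> t0; apply: prim_ge0 => // v; exact: energy_density_ge0.
have bx m : sqnorm (x m) <= C * G / k.
  rewrite ler_pdivlMr// mulrC (le_trans (hk _))//.
  have := est (x m) m%:R (ler0n _ _) (xm m).
  have := mulr_ge0 (ltW c0) (pe0 (x m) m%:R (ler0n _ _)); lra.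
have [p hp] := cV_bounded_cluster bx.
exists (s p); split; first exact: ds.
apply/(L2rhoP _ (cs p)).
exists (2 * (C * G / c + 1)) => t t0.
pose ka v : R := 2 ^+ n * \sum_j sqnorm (col j (mexp M v)).
have cka : continuous ka.
  move=> v; rewrite /ka; apply: cvgMl_tmp; apply: (cvg_big add_continuous) => j _.
  rewrite /sqnorm; apply: (cvg_big add_continuous) => i _.
  have h := @vcontinuous_mexp R n M i j v.
  rewrite expr2 mxE; under eq_fun do rewrite expr2 mxE.
  exact: (cvgM h h).
have cek : continuous (fun v => expR (- rho * v) * ka v).
  by apply: continuousM_fun => //; exact: continuous_expRZ.
pose D := prim (fun v => expR (- rho * v) * ka v) t.
have ka0 v : 0 <= ka v.
  by rewrite mulr_ge0 ?exprn_ge0// sumr_ge0// => j _; exact: sqnorm_ge0.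
have D0 : 0 <= D by apply: prim_ge0 => // v; rewrite mulr_ge0 ?expR_ge0.
have D1 : 0 < D + 1 by rewrite ltr_wpDl.
have D1i : 0 < (D + 1)^-1 by rewrite invr_gt0.
(* The index m is at least t, and x m is so close to p that the difference of the two solutions has
   discounted energy at most 1 on [0, t]; the resulting bound does not depend on t. *)
have [m hm xp] := hp (D + 1)^-1 (Num.trunc t).+1 D1i.
have tm : t <= m%:R.
  rewrite (@le_trans _ _ (Num.trunc t).+1%:R)//; last by rewrite ler_nat.
  by rewrite ltW//; have := @Num.Theory.truncnS_gt R t.
have sD v : s p v - s (x m) v = mexp M v *m (p - x m).
  by rewrite /s /lin_ode -mulmxBr opprD addrACA subrr addr0.
have h1 : prim (energy_density rho (s (x m))) t <= C * G / c.
  apply: (@le_trans _ _ (prim (energy_density rho (s (x m))) m%:R)).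
    apply: prim_homo => //; last by rewrite t0.
    by move=> v; exact: energy_density_ge0.
  rewrite ler_pdivlMr// mulrC.
  have := est (x m) m%:R (ler0n _ _) (xm m).
  have := psd_ge0 (x m) (posdef_psd pK); lra.
apply: (@le_trans _ _ (prim (fun v => 2 * (energy_density rho (s (x m)) v
    + sqnorm (x m - p) * (expR (- rho * v) * ka v))) t)).
  apply: le_prim => //.
    by apply: continuous_scale; apply: continuousD_fun => //; exact: continuous_scale.
  move=> v _; rewrite /energy_density.
  rewrite (mulrCA (sqnorm _)) -mulrDr mulrCA ler_wpM2l ?expR_ge0//.
  rewrite -(subrK (s (x m) v) (s p v)) sD addrC (le_trans (sqnormD_le _ _))//.
  rewrite ler_pM2l// lerD2l (le_trans (sqnorm_mulmx_entries _ _))// mulrC.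
  by rewrite -sqnormN opprB.
rewrite primZ//; last by apply: continuousD_fun => //; exact: continuous_scale.
rewrite primD//; last exact: continuous_scale.
rewrite primZ// -/D ler_pM2l// lerD//.
rewrite (@le_trans _ _ ((D + 1)^-1 * (D + 1)))//.
  apply: ler_pM => //; [exact: sqnorm_ge0|exact: ltW|by rewrite lerDl].
by rewrite mulVf// gt_eqF.
Qed.

End backward_equation.

(** * Existence of s and of the mean field *)

Section mean_field_solutions.
Context {R : realType} {n r : nat}.
Variables (rho : R) (A G Gam Q : 'M[R]_n) (B : 'M[R]_(n, r)) (Rw : 'M[R]_r).
Variables (eta : 'cV[R]_n) (f : R -> 'cV[R]_n).
Hypothesis rho0 : 0 < rho.
Hypothesis hf : C_half rho f.
Variable Pi : 'M[R]_n.
Hypothesis hPi : hurwitz (A + G - B *m invmx Rw *m B^T *m Pi - (rho / 2)%:M).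

(** The homogeneous part of the equation for s has growth rates above rho / 2, so the initial value
    cannot be prescribed freely; it comes from [backward_solution] for the transpose of the Hurwitz
    matrix. *)
Lemma offset_eq_solution : exists s, [/\ vcontinuous s, C_half rho s &
  offset_eq rho A G Gam Q B Rw eta f Pi s].
Proof.
pose N := (A + G - B *m invmx Rw *m B^T *m Pi)^T.
have hN : hurwitz (N - (rho / 2)%:M).
  by have := hurwitz_trmx hPi; rewrite linearB/= tr_scalar_mx.
pose g (t : R) := Pi *m f (Num.max t 0) - etabar Gam Q eta.
have cf := vcontinuous_clip hf.1.
have cPf : vcontinuous (fun t : R => Pi *m f (Num.max t 0)).
  by apply: vcontinuousM => //; exact: vcontinuous_cst.
have cg : vcontinuous g by apply: vcontinuousB => //; exact: vcontinuous_cst.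
have Lg : L2rho rho g.
  apply: L2rhoD => //; first exact: vcontinuous_cst.
    by apply: L2rhoM => //; apply: L2rho_clip; exact: hf.2.
  exact: L2rho_cst.
have [s [ds Ls]] := backward_solution hN cg Lg.
have cs := is_vderive_continuous ds.
exists s; split=> //; first by split=> //; exact: within_vcontinuous.
move=> t t0; have [d ->] := is_vderive_derivable (ds t); split=> //.
rewrite -/N /g max_l ?ltW// mulmxBl mul_scalar_mx.
set X := N *m s t; set Y := Pi *m f t; set Z := etabar _ _ _; set S := rho *: s t.
clearbody X Y Z S.
by apply/matrixP => i j; rewrite !mxE; lra.
Qed.

Lemma mean_field_solution s x0 : vcontinuous s -> C_half rho s ->
  exists xbar, C_half rho xbar /\ mean_field_eq A G B Rw f Pi s x0 xbar.
Proof.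
move=> cs hs.
have [H [c [ga [C hL]]]] := hurwitz_lyapunov_data hPi.
pose g (t : R) := f (Num.max t 0) - B *m invmx Rw *m B^T *m s t.
have cf := vcontinuous_clip hf.1.
have cBs : vcontinuous (fun t => B *m invmx Rw *m B^T *m s t).
  by apply: vcontinuousM => //; exact: vcontinuous_cst.
have cg : vcontinuous g by exact: vcontinuousB.
have Lg : L2rho rho g.
  apply: L2rhoD => //; first exact: vcontinuousN.
    by apply: L2rho_clip; exact: hf.2.
  by apply: L2rhoN; apply: L2rhoM => //; exact: hs.2.
pose x := lin_ode (A + G - B *m invmx Rw *m B^T *m Pi) x0 g.
have dx t := is_vderive_lin_ode (A + G - B *m invmx Rw *m B^T *m Pi) x0 t cg.
have cx : vcontinuous x := is_vderive_continuous dx.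
exists x; split.
  split; first exact: within_vcontinuous.
  exact: energy_forward hL cg dx Lg.
split=> [|t t0]; first exact: lin_ode0.
have [d ->] := is_vderive_derivable (dx t); split=> //.
rewrite -/x /g max_l ?ltW//; move: (x t) => y.
rewrite mulmxBl mulmxDr !mulmxA.
set X := (A + G) *m y; set Y := B *m _ *m _ *m _ *m y; set Z := _ *m s t.
clearbody X Y Z.
by apply/matrixP => i j; rewrite !mxE; lra.
Qed.

End mean_field_solutions.

(** * Brownian increments *)

Section integration_against_density.
Local Open Scope ereal_scope.
Context {d : measure_display} {T : measurableType d} {R : realType}.
Variables (mu nu : {measure set T -> \bar R}) (p : T -> \bar R).
Hypothesis mp : measurable_fun setT p.
Hypothesis p0 : forall x, 0 <= p x.
Hypothesis pfin : forall x, p x \is a fin_num.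
Hypothesis nuE : forall A, measurable A -> nu A = \int[mu]_(x in A) p x.

Import HBNNSimple.

Let density_nnsfun (h : {nnsfun T >-> R}) :
  \int[nu]_x (h x)%:E = \int[mu]_x ((h x)%:E * p x).
Proof.
under [LHS]eq_integral do rewrite fimfunE -fsumEFin//.
rewrite [LHS]ge0_integral_fsum//; last 2 first.
  - by move=> r; exact/measurable_EFinP/measurableT_comp.
  - by move=> n x _; rewrite EFinM nnfun_muleindic_ge0.
under [RHS]eq_integral.
  move=> x _; rewrite fimfunE -fsumEFin// muleC ge0_mule_fsumr; last first.
    by move=> r; rewrite EFinM nnfun_muleindic_ge0.
  over.
rewrite [RHS]ge0_integral_fsum//; last 2 first.
  - move=> r; apply: emeasurable_funM => //.
    by apply/measurable_EFinP; apply/measurableT_comp.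
  - by move=> n x _; rewrite EFinM mule_ge0// nnfun_muleindic_ge0.
apply: eq_fsbigr => r _.
have mr : measurable (h @^-1` [set r]) by exact: measurable_sfunP.
rewrite integralZl_indic_nnsfun//= integral_indic// setIT nuE//.
have [r0|r0] := leP 0%R r; last first.
  have -> : h @^-1` [set r] = set0.
    by rewrite -subset0 => x /= hx; move: r0; rewrite -hx ltNge => /negP; apply.
  rewrite integral_set0 mule0; apply/esym/integral0_eq => x _.
  by rewrite indicE in_set0 mulr0 mule0.
rewrite -ge0_integralZl//; [|exact: measurable_funTS].
rewrite integral_mkcond; apply: eq_integral => x _; rewrite patchE indicE.
by case: ifPn => xr; rewrite ?mulr1 ?mulr0 ?mule0// muleC.
Qed.

(** Proved for simple functions and then by monotone convergence; it turns moments of [normal_prob],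
    given through a density, into Lebesgue integrals. *)
Lemma ge0_integral_density (f : T -> \bar R) : measurable_fun setT f ->
  (forall x, 0 <= f x) -> \int[nu]_x f x = \int[mu]_x (f x * p x).
Proof.
move=> mf f0; pose f_ := nnsfun_approx measurableT mf.
transitivity (limn (fun n => \int[nu]_x (f_ n x)%:E)).
  rewrite -monotone_convergence//=.
  - apply: eq_integral => x /[!inE] xD; apply/esym/cvg_lim => //=.
    exact: cvg_nnsfun_approx.
  - by move=> n; apply: measurableT_comp => //; exact: measurable_funTS.
  - by move=> n x _; rewrite lee_fin.
  - by move=> x _ a b ab; rewrite lee_fin//; exact/lefP/nd_nnsfun_approx.
under eq_fun do rewrite density_nnsfun.
rewrite -monotone_convergence//=.
- apply: eq_integral => x _; apply/cvg_lim => //=.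
  by apply: cvgeMr => //; exact: cvg_nnsfun_approx.
- move=> n; apply: emeasurable_funM => //; exact/measurable_EFinP.
- by move=> n x _; rewrite mule_ge0// lee_fin.
- move=> x _ a b ab; rewrite lee_wpmul2r// lee_fin//; exact/lefP/nd_nnsfun_approx.
Qed.

End integration_against_density.

(** * Second moment of the normal law *)

Section normal_second_moment.
Context {R : realType}.
Local Notation mu := (@lebesgue_measure R).

Lemma normal_pdf_even (s : R) x : s != 0 -> normal_pdf 0 s (- x) = normal_pdf 0 s x.
Proof. by move=> s0; rewrite !normal_pdfE//= /normal_fun !subr0 sqrrN. Qed.

Lemma is_derive_normal_pdf (s : R) (x : R) : s != 0 ->
  is_derive x 1 (normal_pdf 0 s) (- (x / s ^+ 2) * normal_pdf 0 s x).
Proof.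
move=> s0; pose k := - (2 * s ^+ 2)^-1.
have E : normal_pdf 0 s = fun y => normal_peak s * expR (k * (y * y)).
  apply/funext => y; rewrite normal_pdfE//= /normal_fun subr0.
  congr (_ * expR _); rewrite /k; have : s ^+ 2 != 0 by rewrite sqrf_eq0.
  by rewrite -mulr_natl => ?; field.
have d2 : is_derive x 1 (fun y : R => k * (y * y)) (k * (2 * x)).
  have h := is_derive_mul (is_derive_id x (1 : R)) (is_derive_id x (1 : R)).
  apply: (is_derive_eq (is_deriveZ k h)).
  by rewrite /GRing.scale/=; ring.
have d3 := @is_derive1_comp _ expR (fun y : R => k * (y * y)) x _ _
  (is_derive_expR (k * (x * x))) d2.

rewrite {1}E; have := is_deriveZ (normal_peak s) d3.
move/is_derive_eq; apply; rewrite /GRing.scale/= E /k.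
have : s ^+ 2 != 0 by rewrite sqrf_eq0.
by move=> ?; field.
Qed.

Lemma normal_pdf_half (s : R) : s != 0 ->
  (\int[mu]_(x in `[0%R, +oo[) (normal_pdf 0 s x)%:E = (2^-1)%:E)%E.
Proof.
move=> s0.
have := @ge0_symfun_integralT _ _ (normal_pdf_ge0 0 s) (@continuous_normal_pdf R 0 s s0)
  (fun x => esym (normal_pdf_even x s0)).
rewrite integral_normal_pdf -set_itvcy => h.
have f : (\int[mu]_(x in `[0%R, +oo[) (normal_pdf 0 s x)%:E)%E \is a fin_num.
  rewrite ge0_fin_numE ?integral_ge0// => [|x _]; last by rewrite lee_fin normal_pdf_ge0.
  rewrite ltey; apply/eqP => e; move: h; rewrite e.
  by rewrite mulry gtr0_sg// mul1e.
rewrite -(fineK f); congr EFin.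
move: h; rewrite -(fineK f) -EFinM => -[]; lra.
Qed.

(** Integration by parts: s^2 (prim p - x p) is a primitive of x^2 p, and x p(x) vanishes at
    infinity. *)
Lemma normal_second_moment_half (s : R) : s != 0 ->
  (\int[mu]_(x in `[0%R, +oo[) (x ^+ 2 * normal_pdf 0 s x)%:E = (s ^+ 2 / 2)%:E)%E.
Proof.
move=> s0; pose p := normal_pdf 0 s.
have cp : continuous p by exact: continuous_normal_pdf.
have cf : continuous (fun x : R => x ^+ 2 * p x).
  by apply: continuousM_fun => //; exact: sqr_continuous.
have f0 x : 0 <= x ^+ 2 * p x by rewrite mulr_ge0 ?sqr_ge0 ?normal_pdf_ge0.
pose F x := s ^+ 2 * (prim p x - x * p x).
have dF (x : R) : is_derive x 1 F (x ^+ 2 * p x).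
  have h1 := is_derive_mul (is_derive_id x (1 : R)) (is_derive_normal_pdf x s0).
  have h2 := is_deriveB (is_derive_prim x cp) h1.
  apply: (is_derive_eq (is_deriveZ (s ^+ 2) h2)).
  have : s ^+ 2 != 0 by rewrite sqrf_eq0.
  by rewrite /GRing.scale/= -/p => ?; field.
have cF := is_derive_continuous dF.
have FE m : prim (fun x => x ^+ 2 * p x) m%:R = F m%:R.
  have := eq_prim cF cf (fun x _ => dF x) (ler0n R m).
  by rewrite /F prim0 mul0r subrr mulr0 add0r => ->.
have l1 : (F n%:R)%:E @[n --> \oo] --> (\int[mu]_(x in `[0%R, +oo[) (x ^+ 2 * p x)%:E)%E.
  have := @ge0_cvgn_integral _ mu _ f0 (continuous_measurable_fun cf).
  by under eq_fun do rewrite (integral_prim cf (ler0n R _)) FE.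
have l2 : prim p n%:R @[n --> \oo] --> (2^-1 : R).
  have := @ge0_cvgn_integral _ mu _ (normal_pdf_ge0 0 s) (continuous_measurable_fun cp).
  rewrite normal_pdf_half//.
  under eq_fun do rewrite (integral_prim cp (ler0n R _)).
  by move=> /fine_cvgP[].
have l3 : n%:R * p n%:R @[n --> \oo] --> (0 : R).
  (* With y = n^2 / (2 s^2), the inequality y <= exp y bounds n^2 exp(- y) by 2 s^2, hence n p(n) by
     K / n. *)
  pose K := normal_peak s * (2 * s ^+ 2).
  have K0 : 0 <= K.
    by rewrite mulr_ge0 ?normal_peak_ge0// mulr_ge0// sqr_ge0.
  have b n : 0 <= n.+1%:R * p n.+1%:R <= K / n.+1%:R.
    rewrite mulr_ge0 ?normal_pdf_ge0//= /p normal_pdfE//= /normal_fun subr0.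
    have n0 : 0 < n.+1%:R :> R by [].
    rewrite ler_pdivlMr//.
    rewrite (_ : _ * n.+1%:R = normal_peak s *
      (n.+1%:R ^+ 2 * expR (- n.+1%:R ^+ 2 / (s ^+ 2 *+ 2)))); last by ring.
    rewrite /K ler_wpM2l ?normal_peak_ge0//.
    have s2 : 0 < s ^+ 2 *+ 2 by rewrite mulrn_wgt0// exprn_even_gt0.
    have n2 : 0 < n.+1%:R ^+ 2 :> R by rewrite exprn_gt0.
    set y := n.+1%:R ^+ 2 / (s ^+ 2 *+ 2).
    have y0 : 0 < y by rewrite divr_gt0.
    rewrite mulNr -/y expRN ler_pdivrMr ?expR_gt0//.

    rewrite (@le_trans _ _ (2 * s ^+ 2 * y))//.
      by rewrite /y mulr_natl mulrCA mulfV ?mulr1// gt_eqF.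
    rewrite ler_wpM2l// ?mulr_natl ?(ltW s2)//.
    by rewrite (le_trans _ (expR_ge1Dx y))// lerDr.
  rewrite -cvg_shiftS.
  apply: (@squeeze_cvgr _ _ _ _ (fun=> 0) (fun n => K / n.+1%:R)).
  - by apply: nearW => n; exact: b.
  - exact: cvg_cst.
  - rewrite -(mulr0 K); apply: cvgMl_tmp; exact: cvg_harmonic.
have l4 : F n%:R @[n --> \oo] --> (s ^+ 2 / 2 : R).
  have -> : s ^+ 2 / 2 = s ^+ 2 * (2^-1 - 0) by rewrite subr0.
  by apply: cvgMl_tmp; exact: cvgB.
have l5 : (F n%:R)%:E @[n --> \oo] --> (s ^+ 2 / 2)%:E.
  exact: (cvg_comp _ _ l4).
by rewrite -(cvg_lim _ l1)// (cvg_lim _ l5).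
Qed.

Lemma normal_second_moment (s : R) : s != 0 ->
  (\int[normal_prob 0 s]_x (x ^+ 2)%:E = (s ^+ 2)%:E)%E.
Proof.
move=> s0; rewrite (@ge0_integral_density _ _ R mu (normal_prob 0 s)
  (fun x => (normal_pdf 0 s x)%:E)) //; last 4 first.
- by apply/measurable_EFinP; exact: measurable_normal_pdf.
- by move=> x; rewrite lee_fin normal_pdf_ge0.
- by apply/measurable_EFinP; apply: measurable_funX.
- by move=> x; rewrite lee_fin sqr_ge0.
under eq_integral do rewrite -EFinM.
rewrite ge0_symfun_integralT.
- rewrite -set_itvcy normal_second_moment_half// -EFinM; congr EFin; lra.
- by move=> x; apply: mulr_ge0; [exact: sqr_ge0|exact: normal_pdf_ge0].
- apply: continuousM_fun; first exact: sqr_continuous.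
  exact: continuous_normal_pdf.
- by move=> x /=; rewrite sqrrN normal_pdf_even.
Qed.

End normal_second_moment.

(** * Square-integrable random variables and independence *)

Section square_integrable.
Context {d : measure_display} {T : measurableType d} {R : realType}.
Variable P : probability T R.
Implicit Types X Y U V : T -> R.

Definition sqint X := measurable_fun setT X /\
  (\int[P]_w (X w ^+ 2)%:E < +oo)%E.

Definition ip X Y : R := \int[P]_w (X w * Y w).

Lemma sqint_cst c : sqint (fun=> c).
Proof.
by split=> //; rewrite integral_cst//= probability_setT mule1 ltry.
Qed.

Lemma measurable_sqr X : measurable_fun setT X ->
  measurable_fun setT (fun w => (X w ^+ 2)%:E).
Proof. by move=> mX; apply/measurable_EFinP; exact: measurable_funX. Qed.

Lemma sqint_integrable X Y : sqint X -> sqint Y ->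
  P.-integrable setT (EFin \o (fun w => X w * Y w)).
Proof.
move=> [mX iX] [mY iY]; apply/integrableP; split.
  by apply/measurable_EFinP; exact: measurable_funM.
apply: (@le_lt_trans _ _ (\int[P]_w ((X w ^+ 2)%:E + (Y w ^+ 2)%:E)))%E.
  apply: ge0_le_integral => //.
  - by apply/measurable_EFinP; apply: measurableT_comp => //; exact: measurable_funM.
  - by apply: emeasurable_funD; exact: measurable_sqr.
  - move=> w _ /=; rewrite -EFinD lee_fin normrM.
    rewrite -(real_normK (num_real (X w))) -(real_normK (num_real (Y w))).
    have := sqr_ge0 (`|X w| - `|Y w|).
    have := sqr_ge0 `|X w|; have := sqr_ge0 `|Y w|; nra.
rewrite ge0_integralD//; last 4 first.
- by move=> w _; rewrite lee_fin sqr_ge0.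
- exact: measurable_sqr.
- by move=> w _; rewrite lee_fin sqr_ge0.
- exact: measurable_sqr.
by rewrite lte_add_pinfty.
Qed.

Lemma sqint_integrable1 X : sqint X -> P.-integrable setT (EFin \o X).
Proof.
move=> hX; have := sqint_integrable hX (sqint_cst 1).
by rewrite (_ : (fun w => X w * 1) = X)//; apply/funext => w; rewrite mulr1.
Qed.

Lemma ipE X : sqint X -> (ip X X)%:E = (\int[P]_w (X w ^+ 2)%:E)%E.
Proof.
move=> hX; rewrite /ip /Rintegral fineK.
  by apply: eq_integral => w _; rewrite expr2.
by apply: integrable_fin_num => //; exact: sqint_integrable.
Qed.

Lemma sqintD X Y : sqint X -> sqint Y -> sqint (fun w => X w + Y w).
Proof.
move=> hX hY; have [mX iX] := hX; have [mY iY] := hY.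
split; first exact: measurable_funD.
apply: (@le_lt_trans _ _ (\int[P]_w (2%:E * ((X w ^+ 2)%:E + (Y w ^+ 2)%:E))))%E.
  apply: ge0_le_integral => //.
  - by move=> w _; rewrite lee_fin sqr_ge0.
  - by apply: measurable_sqr; exact: measurable_funD.
  - by apply: emeasurable_funM => //; apply: emeasurable_funD; exact: measurable_sqr.
  - move=> w _ /=; rewrite -EFinD -EFinM lee_fin.
    have := sqr_ge0 (X w - Y w); nra.
rewrite ge0_integralZl//; last 2 first.
- by apply: emeasurable_funD; exact: measurable_sqr.
- by move=> w _; rewrite -EFinD lee_fin addr_ge0 ?sqr_ge0.
rewrite ge0_integralD//; last 4 first.
- by move=> w _; rewrite lee_fin sqr_ge0.
- exact: measurable_sqr.
- by move=> w _; rewrite lee_fin sqr_ge0.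
- exact: measurable_sqr.
by rewrite lte_mul_pinfty// lte_add_pinfty.
Qed.

Lemma sqintZ c X : sqint X -> sqint (fun w => c * X w).
Proof.
move=> [mX iX]; split; first exact: measurable_funM.
under eq_integral do rewrite exprMn EFinM.
rewrite ge0_integralZl//; last 3 first.
- exact: measurable_sqr.
- by move=> w _; rewrite lee_fin sqr_ge0.
- by rewrite lee_fin sqr_ge0.
by rewrite lte_mul_pinfty// lee_fin sqr_ge0.
Qed.

Lemma sqintB X Y : sqint X -> sqint Y -> sqint (fun w => X w - Y w).
Proof.
move=> hX hY; have := sqintD hX (sqintZ (- 1) hY).
by under eq_fun do rewrite mulN1r.
Qed.

Lemma sqint_mulbool (b : T -> bool) X : measurable_fun setT b -> sqint X ->
  sqint (fun w => if b w then X w else 0).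
Proof.
move=> mb [mX iX].
have mbX : measurable_fun setT (fun w => if b w then X w else 0).
  exact: measurable_fun_ifT.
split=> //; apply: le_lt_trans iX.
apply: ge0_le_integral => //.
- by move=> w _; rewrite lee_fin sqr_ge0.
- exact: measurable_sqr.
- exact: measurable_sqr.
- by move=> w _; rewrite lee_fin; case: ifP => // _; rewrite expr0n/= sqr_ge0.
Qed.

Lemma ipC X Y : ip X Y = ip Y X.
Proof. by apply: eq_Rintegral => w _; rewrite mulrC. Qed.

Lemma ipDl X Y U : sqint X -> sqint Y -> sqint U ->
  ip (fun w => X w + Y w) U = ip X U + ip Y U.
Proof.
move=> hX hY hU; rewrite /ip -RintegralD//.
- by apply: eq_Rintegral => w _; rewrite mulrDl.
- exact: sqint_integrable.
- exact: sqint_integrable.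
Qed.

Lemma ipZl c X U : sqint X -> sqint U -> ip (fun w => c * X w) U = c * ip X U.
Proof.
move=> hX hU; rewrite /ip -RintegralZl//; last exact: sqint_integrable.
by apply: eq_Rintegral => w _; rewrite mulrA.
Qed.

Lemma ip_sqrD X Y : sqint X -> sqint Y ->
  ip (fun w => X w + Y w) (fun w => X w + Y w) = ip X X + 2 * ip X Y + ip Y Y.
Proof.
move=> hX hY; have hXY := sqintD hX hY.
by rewrite ipDl// ipC [ip Y _]ipC !ipDl// (ipC Y X); ring.
Qed.

Lemma ipBl X Y U : sqint X -> sqint Y -> sqint U ->
  ip (fun w => X w - Y w) U = ip X U - ip Y U.
Proof.
move=> hX hY hU; rewrite -[LHS](addrK (ip Y U)) -ipDl//; last exact: sqintB.
by congr (_ - _); apply: eq_Rintegral => w _; rewrite subrK.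
Qed.

Lemma ip_sqrB X Y : sqint X -> sqint Y ->
  ip (fun w => X w - Y w) (fun w => X w - Y w) = ip X X - 2 * ip X Y + ip Y Y.
Proof.
move=> hX hY; have hXY := sqintB hX hY.
by rewrite ipBl// ipC [ip Y _]ipC !ipBl// (ipC Y X); ring.
Qed.

Lemma le_ip X Y : sqint X -> sqint Y -> (forall w, X w ^+ 2 <= Y w ^+ 2) ->
  ip X X <= ip Y Y.
Proof.
move=> hX hY h; rewrite -lee_fin !ipE//; apply: ge0_le_integral => //.
- by move=> w _; rewrite lee_fin sqr_ge0.
- by apply: measurable_sqr; exact: hX.1.
- by apply: measurable_sqr; exact: hY.1.
- by move=> w _; rewrite lee_fin.
Qed.

(** Chebyshev's inequality, through which second moments control exit events. *)
Lemma sqint_tail X (e : R) : sqint X -> 0 < e ->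
  (P [set w | (e < `|X w|)%R] <= (e ^- 2 * ip X X)%:E)%E.
Proof.
move=> hX e0; have [mX iX] := hX.
have mA : measurable [set w | e < `|X w|].
  have mn : measurable_fun setT (fun w => `|X w|) by exact: measurableT_comp.
  have := mn measurableT _ (measurable_itv `]e, +oo[); rewrite setTI.
  congr (measurable _); apply/seteqP; split => w /=; by rewrite in_itv/= andbT.

rewrite EFinM ipE// -ge0_integralZl//; last 3 first.
- exact: measurable_sqr.
- by move=> w _; rewrite lee_fin sqr_ge0.
- by rewrite lee_fin invr_ge0 exprn_ge0// ltW.
rewrite -[leLHS]mul1e -[leLHS](@integral_cst _ _ _ P)// integral_mkcond.
apply: ge0_le_integral => //.
- by move=> w _; rewrite patchE; case: ifP.
- exact/(measurable_restrictT _ mA).1.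
- by apply: emeasurable_funM => //; exact: measurable_sqr.
move=> w _; rewrite patchE -EFinM; case: ifPn => [|_]; last first.
  by rewrite lee_fin mulr_ge0 ?invr_ge0 ?sqr_ge0.
rewrite inE/= => h; rewrite lee_fin -exprVn -exprMn -[leLHS](expr1n _ 2).
rewrite -[leRHS]real_normK ?num_real// ler_pXn2r ?nnegrE//.
rewrite normrM gtr0_norm ?invr_gt0// mulrC ler_pdivlMr// mul1r; exact: ltW.
Qed.

Definition indep_rv U V := forall A B, measurable A -> measurable B ->
  P (U @^-1` A `&` V @^-1` B) = (P (U @^-1` A) * P (V @^-1` B))%E.

(** Independence says that the law of the pair and the product of the laws agree on rectangles,
    hence everywhere; Fubini's theorem then factors the integral. *)
Lemma indep_rv_ip U V : sqint U -> sqint V -> indep_rv U V ->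
  ip U V = (\int[P]_w U w) * (\int[P]_w V w).
Proof.
move=> hU hV iUV; have [mU _] := hU; have [mV _] := hV.
have mUV : measurable_fun setT (fun w => (U w, V w)) by exact: measurable_fun_pair.
pose mfU := isMeasurableFun.Build _ _ _ _ _ mU.
pose mfV := isMeasurableFun.Build _ _ _ _ _ mV.
pose mfUV := isMeasurableFun.Build _ _ _ _ _ mUV.
pose U' : {mfun T >-> R} := HB.pack U mfU.
pose V' : {mfun T >-> R} := HB.pack V mfV.
pose UV' : {mfun T >-> (R * R)%type} := HB.pack (fun w => (U w, V w)) mfUV.
pose muU := distribution P U'; pose muV := distribution P V'.
pose muUV := distribution P UV'.
pose f (z : R * R) : \bar R := (z.1 * z.2)%:E.
have mf : measurable_fun setT f.
  by apply/measurable_EFinP; exact: measurable_funM.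
have prodE : forall S : set (R * R), measurable S -> (muU \x muV)%E S = muUV S.
  apply: product_measure_unique => A B mA mB.
  exact: iUV.
have iU := sqint_integrable1 hU; have iV := sqint_integrable1 hV.
have iUV' := sqint_integrable hU hV.
have ef : (\int[muUV]_z f z = \int[(muU \x muV)%E]_z f z)%E.
  by apply: eq_measure_integral => A mA _; exact/esym/prodE.
have iprod : (muU \x muV)%E.-integrable setT f.
  apply/integrableP; split=> //.
  rewrite (_ : (\int[_]_x _ = \int[muUV]_z `|f z|)%E); last first.
    by apply: eq_measure_integral => A mA _; exact: prodE.
  rewrite ge0_integral_distribution//.
    by have /integrableP[] := iUV'.
  by apply: measurableT_comp.
have e1 : (\int[muUV]_z f z = \int[P]_w (U w * V w)%:E)%E.
  by rewrite integral_distribution.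
have eU : (\int[muU]_x x%:E = \int[P]_w (U w)%:E)%E.
  by rewrite integral_distribution//; exact/measurable_EFinP.
have eV : (\int[muV]_x x%:E = \int[P]_w (V w)%:E)%E.
  by rewrite integral_distribution//; exact/measurable_EFinP.
have fU : (\int[P]_w (U w)%:E)%E \is a fin_num by exact: integrable_fin_num.
have fV : (\int[P]_w (V w)%:E)%E \is a fin_num by exact: integrable_fin_num.
have iV' : muV.-integrable setT (EFin \o id).
  by apply/(@integrable_pushforward _ _ _ _ _ _ mV); [exact/measurable_EFinP|exact: iV|].
have iU' : muU.-integrable setT (EFin \o id).
  by apply/(@integrable_pushforward _ _ _ _ _ _ mU); [exact/measurable_EFinP|exact: iU|].
rewrite /ip /Rintegral -fineM//; congr fine.
rewrite -e1 ef -integral12_prod_meas1// /fubini_F.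
rewrite -eV -eU.
have fV' : (\int[muV]_x x%:E)%E \is a fin_num by rewrite eV.
rewrite -(fineK fV') -integralZr//; apply: eq_integral => x _.
rewrite /f/=; under eq_integral do rewrite EFinM.
by rewrite integralZl// fineK.
Qed.

End square_integrable.

Section brownian_increments.
Context {d : measure_display} {T : measurableType d} {R : realType}.
Variables (P : probability T R) (W : R -> T -> R).
Hypothesis bW : brownian P W.
Local Notation mu := (@lebesgue_measure R).

Lemma brownian_measurable t : 0 <= t -> measurable_fun setT (W t).
Proof. by case: bW => + _ _ _ _; exact. Qed.

Lemma brownian_inc_moment s t : 0 <= s -> s < t ->
  (\int[P]_w ((W t w - W s w) ^+ 2)%:E = (t - s)%:E)%E.
Proof.
move=> s0 st; have [_ _ law _ _] := bW.
have mI : measurable_fun setT (fun w => W t w - W s w).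
  by apply: measurable_funB; apply: brownian_measurable => //; rewrite ltW// (le_lt_trans s0).
have mI' : measurable_fun setT ((fun w => W t w - W s w) : T -> measurableTypeR R) by exact: mI.
pose mfI := isMeasurableFun.Build _ _ _ _ _ mI'.
pose I' : {mfun T >-> measurableTypeR R} := HB.pack (fun w => W t w - W s w) mfI.
have ts : 0 < Num.sqrt (t - s) by rewrite sqrtr_gt0 subr_gt0.
have e1 : (\int[distribution P I']_x (x ^+ 2)%:E = \int[P]_w ((W t w - W s w) ^+ 2)%:E)%E.
  rewrite ge0_integral_distribution//.
    by apply/measurable_EFinP; exact: measurable_funX.
  by move=> y; rewrite lee_fin sqr_ge0.
have e2 : (\int[distribution P I']_x (x ^+ 2)%:E =
    \int[normal_prob 0 (Num.sqrt (t - s))]_x (x ^+ 2)%:E)%E.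
  by apply: eq_measure_integral => A mA _; exact: law.
by rewrite -e1 e2 normal_second_moment ?gt_eqF// sqr_sqrtr// subr_ge0 ltW.
Qed.

Definition inc s t w := W t w - W s w.

Lemma sqint_inc s t : 0 <= s -> 0 <= t -> sqint P (inc s t).
Proof.
have lt a b : 0 <= a -> a < b -> sqint P (inc a b).
  move=> a0 ab; split; last by rewrite brownian_inc_moment// ltry.
  by apply: measurable_funB; apply: brownian_measurable => //; rewrite ltW// (le_lt_trans a0).
move=> s0 t0; have [st|ts|->] := ltgtP s t; first exact: lt.
  have := sqintZ (- 1) (lt _ _ t0 ts).
  by congr sqint; apply/funext => w; rewrite /inc mulN1r opprB.
have -> : inc t t = fun=> 0 by apply/funext => w; rewrite /inc subrr.
exact: sqint_cst.
Qed.

Lemma ip_inc_sq s t : 0 <= s -> 0 <= t -> ip P (inc s t) (inc s t) = `|t - s|.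
Proof.
have lt a b : 0 <= a -> a < b -> ip P (inc a b) (inc a b) = b - a.
  move=> a0 ab; have b0 : 0 <= b by rewrite ltW// (le_lt_trans a0).
  by apply: EFin_inj; rewrite ipE ?brownian_inc_moment//; exact: sqint_inc.
move=> s0 t0; have [st|ts|->] := ltgtP s t.
- by rewrite lt// ger0_norm// subr_ge0 ltW.
- rewrite distrC ger0_norm ?subr_ge0 ?(ltW ts)// -(lt _ _ t0 ts).
  by apply: eq_Rintegral => w _; rewrite /inc; ring.

- rewrite subrr normr0 /ip.
  under eq_Rintegral do rewrite /inc subrr mul0r.
  by rewrite Rintegral_cst// mul0r.
Qed.

(** Polarization of E (W_t - W_s)^2 = |t - s|: covariances of increments follow from their
    variances. *)
Lemma ip_inc a b c e : 0 <= a -> 0 <= b -> 0 <= c -> 0 <= e ->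
  ip P (inc a b) (inc c e) =
  2^-1 * (`|b - c| + `|e - a| - `|e - b| - `|c - a|).
Proof.
move=> a0 b0 c0 e0.
have sD : forall p q, 0 <= p -> 0 <= q -> sqint P (inc p q) by exact: sqint_inc.
have h (p q r : R) : 0 <= p -> 0 <= q -> 0 <= r ->
    2 * ip P (inc p q) (inc p r) = `|q - p| + `|r - p| - `|r - q|.
  move=> p0 q0 r0; rewrite -!ip_inc_sq//.
  have -> : inc q r = fun w => inc p r w - inc p q w.
    by apply/funext => w; rewrite /inc; ring.
  by rewrite ip_sqrB ?(ipC _ (inc p r)); [ring|exact: sD|exact: sD].
have -> : inc c e = fun w => inc a e w - inc a c w.
  by apply/funext => w; rewrite /inc; ring.
rewrite ipC ipBl; [|exact: sD..].
have h1 := h a b e a0 b0 e0; have h2 := h a b c a0 b0 c0.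
rewrite (ipC _ (inc a e)) (ipC _ (inc a c)).
rewrite (distrC b c); lra.
Qed.

Lemma sigma_of_subset s s' : s <= s' ->
  sigma_of [set u | 0 <= u <= s] W `<=` sigma_of [set u | 0 <= u <= s'] W.
Proof.
move=> ss'; apply: sub_sigma_algebra2 => A [u /= /andP[u0 us] hA].
by exists u => //=; rewrite u0 (le_trans us).
Qed.

Definition past s : set (set T) :=
  \bigcup_(i in [set u | 0 <= u <= s]) preimage_set_system setT (W i) measurable.

(** Stated as measurability from a retyped space, so that the usual rules for sums, comparisons and
    tests apply to adapted variables. *)
Definition adapted s (U : T -> R) :=
  measurable_fun (setT : set (g_sigma_algebraType (past s)))
    (U : g_sigma_algebraType (past s) -> R).

Lemma adapted_sigma_of s U A : adapted s U -> measurable A ->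
  sigma_of [set u | 0 <= u <= s] W (U @^-1` A).
Proof. by move=> mU mA; have := mU measurableT _ mA; rewrite setTI. Qed.

Lemma sigma_ofT (V : T -> R) A : measurable A ->
  sigma_of [set: unit] (fun=> V) (V @^-1` A).
Proof. by move=> mA; apply: sub_sigma_algebra; exists tt => //; exists A; rewrite ?setTI. Qed.

Lemma adapted_indep s a b U : 0 <= s -> s <= a -> a < b -> adapted s U ->
  indep_rv P U (inc a b).
Proof.
move=> s0 sa ab aU A B mA mB; have [_ _ _ ind _] := bW.
apply: (ind a b) => //; first exact: le_trans s0 sa.
  by apply: (sigma_of_subset sa); exact: adapted_sigma_of.
exact: sigma_ofT.
Qed.

Lemma adapted_W s u : 0 <= u <= s -> adapted s (W u).
Proof.
move=> us _ A mA; rewrite setTI; apply: sub_sigma_algebra.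
by exists u => //; exists A; rewrite ?setTI.
Qed.

(* Two consecutive increments of equal length are orthogonal by the second
   moments, and independent with the same mean, so this mean vanishes. *)
Lemma inc_mean0 s t : 0 <= s -> s < t -> \int[P]_w inc s t w = 0.
Proof.
move=> s0 st; set u := t + (t - s).
have tu : t < u by rewrite ltrDl subr_gt0.
have t0 : 0 <= t by rewrite ltW// (le_lt_trans s0).
have u0 : 0 <= u by rewrite ltW// (le_lt_trans t0).
have aI : adapted t (inc s t).
  by apply: measurable_funB; apply: adapted_W; rewrite ?s0 ?t0 ?lexx ?(ltW st).
have := indep_rv_ip (sqint_inc s0 t0) (sqint_inc t0 u0) (adapted_indep t0 (lexx t) tu aI).
rewrite ip_inc// subrr normr0 /u.
rewrite [`|t + (t - s) - s|]ger0_norm; last by lra.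
rewrite [`|t + (t - s) - t|]ger0_norm; last by lra.
rewrite [`|t - s|]ger0_norm; last by lra.
have -> : \int[P]_w inc t (t + (t - s)) w = \int[P]_w inc s t w; last first.
  move=> h; apply/eqP; rewrite -sqrf_eq0 expr2 -h; apply/eqP; lra.
have [_ _ law _ _] := bW.
have ht := sqint_inc t0 u0; have hs := sqint_inc s0 t0.
pose I1 : {mfun T >-> R} := HB.pack (inc t u) (isMeasurableFun.Build _ _ _ _ _ ht.1).
pose I2 : {mfun T >-> R} := HB.pack (inc s t) (isMeasurableFun.Build _ _ _ _ _ hs.1).
have e1 : (\int[distribution P I1]_x x%:E = \int[P]_w (inc t u w)%:E)%E.
  by rewrite integral_distribution//; exact: sqint_integrable1.
have e2 : (\int[distribution P I2]_x x%:E = \int[P]_w (inc s t w)%:E)%E.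
  by rewrite integral_distribution//; exact: sqint_integrable1.
rewrite /Rintegral -/u -e1 -e2; congr fine.
apply: eq_measure_integral => A mA _.
have l1 := law t u t0 tu A mA; have l2 := law s t s0 st A mA.
have ee : u - t = t - s by rewrite /u addrC addKr.
rewrite ee -l2 in l1; exact: l1.
Qed.

Lemma adapted_ip0 s a b U : 0 <= s -> s <= a -> a <= b -> adapted s U ->
  sqint P U -> ip P U (inc a b) = 0.
Proof.
move=> s0 sa; rewrite le_eqVlt => /predU1P[<-|ab] aU hU.
  rewrite /ip; under eq_Rintegral do rewrite /inc subrr mulr0.
  by rewrite Rintegral_cst// mul0r.
have a0 : 0 <= a := le_trans s0 sa.
rewrite (indep_rv_ip hU (sqint_inc a0 (ltW (le_lt_trans a0 ab))) (adapted_indep s0 sa ab aU)).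
by rewrite inc_mean0// mulr0.
Qed.

Lemma adapted_le s s' U : s <= s' -> adapted s U -> adapted s' U.
Proof.
move=> ss' aU _ A mA; rewrite setTI; apply: (sigma_of_subset ss').
exact: adapted_sigma_of.
Qed.

End brownian_increments.

(** * Wiener integrals of deterministic functions *)

Section step_functions.
Context {R : realType}.
Local Notation mu := (@lebesgue_measure R).

(* A triple [(c, a, b)] stands for [c] times the indicator function of [[a, b[]. *)
Definition fstep (l : seq (R * R * R)) (u : R) : R :=
  \sum_(p <- l) p.1.1 * \1_(`[p.1.2, p.2[%classic : set R) u.

Definition steps_in (s t : R) (l : seq (R * R * R)) :=
  all (fun p => [&& s <= p.1.2, p.1.2 <= p.2 & p.2 <= t]) l.

Lemma fstep_bound l u : `|fstep l u| <= \sum_(p <- l) `|p.1.1|.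
Proof.
rewrite /fstep (le_trans (ler_norm_sum _ _ _))//; apply: ler_sum => p _.
by rewrite normrM indicE; case: (_ \in _); rewrite ?normr1 ?normr0 ?mulr1 ?mulr0.
Qed.

Lemma measurable_fstep l : measurable_fun setT (fstep l).
Proof.
rewrite /fstep; apply: measurable_sum => p; apply: measurable_funM => //.
Qed.

Lemma fstepM_integrable s t l l' :
  mu.-integrable `[s, t] (EFin \o (fun u => fstep l u * fstep l' u)).
Proof.
apply: measurable_bounded_integrable => //.
- rewrite /= lebesgue_measure_itv/=; case: ifP => _; exact: ltry.
- by apply: measurable_funTS; apply: measurable_funM; exact: measurable_fstep.
- exists ((\sum_(p <- l) `|p.1.1|) * (\sum_(p <- l') `|p.1.1|)); split.
    exact: num_real.
  move=> M hM u _ /=; rewrite normrM (le_trans _ (ltW hM))//.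
  by rewrite ler_pM// fstep_bound.
Qed.

Lemma fstep1 a b : fstep [:: (1, a, b)] = \1_(`[a, b[%classic : set R).
Proof. by apply/funext => u; rewrite /fstep big_seq1 mul1r. Qed.

(** Both sides are the length of the overlap of the two intervals. The right-hand side has the form
    of [ip_inc], so that the two lemmas together are the Ito isometry for indicator functions. *)
Lemma integral_fstep1 s t a b c e : s <= a -> a <= b -> b <= t ->
  s <= c -> c <= e -> e <= t ->
  \int[mu]_(u in `[s, t]) (fstep [:: (1, a, b)] u * fstep [:: (1, c, e)] u) =
  2^-1 * (`|b - c| + `|e - a| - `|e - b| - `|c - a|).
Proof.
move=> sa ab bt sc ce et.
transitivity (fine (mu (`[Num.max a c, Num.min b e[%classic : set R))).
  rewrite /Rintegral -[mu _]mul1e -integral_cst//= integral_mkcond; congr fine.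
  rewrite [RHS]integral_mkcond; apply: eq_integral => u _.
  rewrite !patchE !fstep1 !indicE !mem_setE !in_itv/= ge_max lt_min.
  case: ifPn => h; last first.
    case: ifPn => // /andP[/andP[au cu] /andP[ub ue]]; exfalso; move: h.
    by rewrite (le_trans sa au) (le_trans (ltW ub) bt).
  case: (a <= u) => //=; rewrite ?mul0r//.
  by case: (u < b); case: (c <= u); case: (u < e); rewrite /= ?mulr1 ?mulr0.
rewrite lebesgue_measure_itv/= lte_fin.
have E : `|b - c| + `|e - a| - `|e - b| - `|c - a| =
   2 * (if Num.max a c < Num.min b e then Num.min b e - Num.max a c else 0).
  rewrite !maxEle !minEle.
  have nE (x y : R) : `|x - y| = if y <= x then x - y else y - x.
    by case: leP => xy; [rewrite ger0_norm ?subr_ge0|rewrite distrC ger0_norm// subr_ge0 ltW].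
  rewrite !nE; case: (leP a c) => ac; case: (leP b e) => be; case: ltP => h;
    case: (leP c b) => cb; case: (leP a e) => ae; clear -ab ce ac be h cb ae; lra.

rewrite E mulrA mulVf ?mul1r ?pnatr_eq0//; by case: ifP.
Qed.

Lemma fstep_cons p l u : fstep (p :: l) u = p.1.1 * fstep [:: (1, p.1.2, p.2)] u + fstep l u.
Proof. by rewrite /fstep big_cons big_seq1/= mul1r. Qed.

Lemma fstep_cat l l' u : fstep (l ++ l') u = fstep l u + fstep l' u.
Proof. by rewrite /fstep big_cat. Qed.

End step_functions.

Section step_integrals.
Context {d : measure_display} {T : measurableType d} {R : realType}.
Variables (P : probability T R) (W : R -> T -> R).
Hypothesis bW : brownian P W.
Local Notation mu := (@lebesgue_measure R).

Definition istep (l : seq (R * R * R)) (w : T) : R :=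
  \sum_(p <- l) p.1.1 * inc W p.1.2 p.2 w.

Lemma istep_cat l l' w : istep (l ++ l') w = istep l w + istep l' w.
Proof. by rewrite /istep big_cat. Qed.

Lemma sqint_istep s t l : 0 <= s -> steps_in s t l -> sqint P (istep l).
Proof.
move=> s0; rewrite /istep; elim: l => [|p l IH] /=.
  by move=> _; under eq_fun do rewrite big_nil; exact: sqint_cst.
move=> /andP[/and3P[sp pp pt] hl]; under eq_fun do rewrite big_cons.
apply: sqintD; last exact: IH.
apply/sqintZ/(sqint_inc bW); first exact: le_trans s0 sp.
by rewrite (le_trans s0)// (le_trans sp).
Qed.

(** The Ito isometry for step functions, by bilinearity in the two lists, starting from single
    steps. *)
Lemma ip_istep s t l l' : 0 <= s -> steps_in s t l -> steps_in s t l' ->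
  ip P (istep l) (istep l') = \int[mu]_(u in `[s, t]) (fstep l u * fstep l' u).
Proof.
move=> s0.
have base a b : s <= a -> a <= b -> b <= t -> forall l, steps_in s t l ->
    ip P (istep l) (inc W a b) =
    \int[mu]_(u in `[s, t]) (fstep l u * fstep [:: (1, a, b)] u).
  move=> sa ab bt; elim=> [_|[[k c] e] m IH /=].
    rewrite /ip /istep; under eq_Rintegral do rewrite big_nil mul0r.
    rewrite Rintegral_cst// mul0r; under eq_Rintegral do rewrite /fstep big_nil mul0r.
    by rewrite Rintegral_cst// mul0r.
  move=> /andP[/and3P[/= sc ce et] hm].
  have a0 := le_trans s0 sa; have c0 := le_trans s0 sc.
  have b0 := le_trans a0 ab; have e0 := le_trans c0 ce.
  have hI := sqint_inc bW a0 b0; have hJ := sqint_inc bW c0 e0.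
  rewrite (_ : istep _ = fun w => k * inc W c e w + istep m w); last first.
    by apply/funext => w; rewrite /istep big_cons.
  rewrite ipDl//; [|exact: sqintZ|exact: sqint_istep hm].
  rewrite ipZl// IH// (ipC P (inc W c e)) (ip_inc bW)//.
  rewrite -(integral_fstep1 sa ab bt sc ce et).
  rewrite -RintegralZl//; last exact: fstepM_integrable.
  rewrite -RintegralD//; last 2 first.
  - have := fstepM_integrable s t [:: (k, a, b)] [:: (1, c, e)].
    congr (_.-integrable _ _); apply/funext => u /=.
    by rewrite fstep_cons /= {2}/fstep big_nil addr0 mulrA.
  - exact: fstepM_integrable.
  apply: eq_Rintegral => u _; rewrite fstep_cons /=; ring.
elim: l => [_ _|[[k a] b] l IH /= /andP[/and3P[/= sa ab bt] hl] hl'].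
  rewrite /ip /istep; under eq_Rintegral do rewrite big_nil mul0r.
  rewrite Rintegral_cst// mul0r; under eq_Rintegral do rewrite /fstep big_nil mul0r.
  by rewrite Rintegral_cst// mul0r.
have a0 := le_trans s0 sa; have b0 := le_trans a0 ab.
have hI := sqint_inc bW a0 b0; have hL := sqint_istep s0 hl'.
rewrite (_ : istep _ = fun w => k * inc W a b w + istep l w); last first.
  by apply/funext => w; rewrite /istep big_cons.
rewrite ipDl//; [|exact: sqintZ|exact: sqint_istep hl].
rewrite ipZl// IH// (ipC P (inc W a b)) (base _ _ sa ab bt)//.
rewrite -RintegralZl//; last exact: fstepM_integrable.
rewrite -RintegralD//; last 2 first.
- have := fstepM_integrable s t [:: (k, a, b)] l'.
  congr (_.-integrable _ _); apply/funext => u /=.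
  by rewrite fstep_cons /= {2}/fstep big_nil addr0 -mulrA (mulrC (fstep l' u)).
- exact: fstepM_integrable.
by apply: eq_Rintegral => u _; rewrite fstep_cons /=; ring.
Qed.

Lemma ip_istep_le s t l S : 0 <= s -> s <= t -> steps_in s t l ->
  (forall u, s <= u < t -> `|fstep l u| <= S) ->
  ip P (istep l) (istep l) <= S ^+ 2 * (t - s).
Proof.
move=> s0 st hl hS; rewrite (ip_istep s0 hl hl).
have [->|tneqs] := eqVneq s t.
  by rewrite set_itv1 Rintegral_set1 subrr mulr0.
have lt_st : s < t by rewrite lt_neqAle tneqs.
rewrite -Rintegral_itv_bndo_bndc; last first.
  apply: (integrableS _ _ _ (fstepM_integrable s t l l)) => //.
  by apply: subset_itvl; rewrite bnd_simp.
have -> : t - s = fine (mu (`[s, t[%classic : set R)).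
  by rewrite lebesgue_measure_itv/= lte_fin lt_st.
rewrite -Rintegral_cst//; apply: le_Rintegral => //.
- apply: (integrableS _ _ _ (fstepM_integrable s t l l)) => //.
  by apply: subset_itvl; rewrite bnd_simp.
- apply: measurable_bounded_integrable => //.
    by rewrite /= lebesgue_measure_itv/= lte_fin lt_st ltry.
  exists (`|S ^+ 2|); split; first exact: num_real.
  by move=> M hM u _; exact: ltW.
- move=> u; rewrite /= in_itv/= => su.
  by rewrite -expr2 -real_normK ?num_real// ler_pXn2r ?nnegrE ?hS// (le_trans _ (hS _ su)).
Qed.

End step_integrals.

Section clipping.
Context {R : realType}.
Implicit Types (s t u c : R) (l : seq (R * R * R)).

Definition clamp s t c : R := Num.min (Num.max c s) t.

(** Restriction to [s, t[: end points are clamped and steps outside become degenerate, so the list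
    keeps its shape and its coefficients. *)
Definition clip s t l := [seq (p.1.1, clamp s t p.1.2, clamp s t p.2) | p <- l].

Lemma clamp_ge s t c : s <= t -> s <= clamp s t c.
Proof. by move=> st; rewrite /clamp le_min le_max lexx orbT. Qed.

Lemma clamp_le s t c : clamp s t c <= t.
Proof. by rewrite /clamp ge_min lexx orbT. Qed.

Lemma le_clamp s t c c' : c <= c' -> clamp s t c <= clamp s t c'.
Proof.
by move=> cc; rewrite /clamp le_min !ge_min !ge_max !le_max cc !lexx !orbT.


Qed.

Lemma clip_steps_in a b s t l : s <= t -> steps_in a b l -> steps_in s t (clip s t l).
Proof.
move=> st; elim: l => //= -[[k c] e] l IH /andP[/and3P[/= ac ce eb] /IH ->].
by rewrite clamp_ge// le_clamp// clamp_le.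
Qed.

Lemma fstep_clip s t u l : s <= u < t -> fstep (clip s t l) u = fstep l u.
Proof.
move=> /andP[su ut]; rewrite /fstep big_map; apply: eq_bigr => -[[k c] e] _ /=.
congr (_ * _); rewrite !indicE !mem_setE !in_itv/= /clamp ge_min lt_min ge_max.
by rewrite lt_max ut su (leNgt t) ut andbT orbF (ltNge u s) su orbF andbT.
Qed.

Definition oppl l := [seq (- p.1.1, p.1.2, p.2) | p <- l].

Lemma fstep_opp l u : fstep (oppl l) u = - fstep l u.
Proof. by rewrite /fstep big_map -sumrN; apply: eq_bigr => p _; rewrite mulNr. Qed.

Lemma steps_in_opp s t l : steps_in s t (oppl l) = steps_in s t l.
Proof. by rewrite /steps_in all_map. Qed.

Lemma clip_opp s t l : clip s t (oppl l) = oppl (clip s t l).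
Proof. by rewrite /clip /oppl -!map_comp. Qed.

Lemma clip_cat s t l l' : clip s t (l ++ l') = clip s t l ++ clip s t l'.
Proof. exact: map_cat. Qed.

Lemma steps_in_cat s t l l' : steps_in s t (l ++ l') = steps_in s t l && steps_in s t l'.
Proof. exact: all_cat. Qed.

End clipping.

(** * Maximal inequality for step integrals *)

Section maximal_inequality.
Context {d : measure_display} {T : measurableType d} {R : realType}.
Variables (P : probability T R) (W : R -> T -> R).
Hypothesis bW : brownian P W.
Local Notation mu := (@lebesgue_measure R).
Local Notation istep := (istep W).

Lemma istep_opp l w : istep (oppl l) w = - istep l w.
Proof. by rewrite /istep big_map -sumrN; apply: eq_bigr => p _; rewrite mulNr. Qed.

Definition iproc l (t : R) : T -> R := istep (clip 0 t l).

Lemma istep_clip l (s t : R) w : 0 <= s <= t ->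
  istep (clip s t l) w = iproc l t w - iproc l s w.
Proof.
move=> /andP[s0 st].
rewrite /iproc /istep !big_map -sumrB; apply: eq_bigr => -[[k c] e] _ /=.
rewrite -mulrBr; congr (_ * _); rewrite /inc.
suff h x : W (clamp s t x) w = W (clamp 0 t x) w - W (clamp 0 s x) w + W s w.
  by rewrite !h; ring.
rewrite /clamp.
have [xs|sx] := leP x s.
  rewrite (min_idPl st) (_ : Num.min (Num.max x 0) t = Num.min (Num.max x 0) s); first ring.
  have h : Num.max x 0 <= s by rewrite ge_max xs.
  by rewrite (min_idPl h) (min_idPl (le_trans h st)).
rewrite (max_idPl (ltW (le_lt_trans s0 sx))) (min_idPr (ltW sx)); ring.
Qed.

Lemma iproc0 l w : iproc l 0 w = 0.
Proof.
rewrite /iproc /istep big_map big1// => -[[k c] e] _ /=; rewrite /inc.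
by rewrite /clamp !(min_idPr _) ?le_max ?lexx ?orbT// subrr mulr0.
Qed.

Lemma adapted_sum s (l : seq (R * R * R)) (F : R * R * R -> T -> R) :
  (forall p, adapted W s (F p)) -> adapted W s (fun w => \sum_(p <- l) F p w).
Proof. by move=> h; apply: measurable_sum => p; exact: h. Qed.

Lemma adapted_istep_clip s t l : 0 <= s <= t -> adapted W t (istep (clip s t l)).
Proof.
move=> /andP[s0 st]; rewrite /istep.
have -> : (fun w => \sum_(p <- clip s t l) p.1.1 * inc W p.1.2 p.2 w) =
  fun w => \sum_(p <- l) p.1.1 * inc W (clamp s t p.1.2) (clamp s t p.2) w.
  by apply/funext => w; rewrite big_map.
apply: adapted_sum => p; apply: measurable_funM; first exact: measurable_cst.
by apply: measurable_funB; apply: adapted_W; rewrite clamp_le (le_trans s0)// clamp_ge.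
Qed.

Lemma continuous_iproc l w : continuous (fun t : R => iproc l (Num.max t 0) w).
Proof.
have [_ _ _ _ cW] := bW.
have cV : continuous (fun t : R => W (Num.max t 0) w).
  exact: continuous_clip (cW w).

have -> : (fun t : R => iproc l (Num.max t 0) w) = fun t =>
  \sum_(p <- l) p.1.1 * (W (Num.max (clamp 0 (Num.max t 0) p.2) 0) w
                      - W (Num.max (clamp 0 (Num.max t 0) p.1.2) 0) w).
  apply/funext => t; rewrite /iproc /istep big_map; apply: eq_bigr => p _.
  by rewrite /inc !(max_idPl (clamp_ge _ _)) ?le_max ?lexx ?orbT.
have cc x : continuous (fun t : R => clamp 0 (Num.max t 0) x).
  move=> t; apply: (@continuous_min _ _ (fun=> Num.max x 0) (fun t : R => Num.max t 0)).
    exact: cvg_cst.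
  by apply: (@continuous_max _ _ id (fun=> 0)); [exact: cvg_id|exact: cvg_cst].
have cWc x : continuous (fun t : R => W (Num.max (clamp 0 (Num.max t 0) x) 0) w).
  by move=> t; apply: (@continuous_comp _ _ _ (fun t : R => clamp 0 (Num.max t 0) x)
    (fun t : R => W (Num.max t 0) w)); [exact: cc|exact: cV].
move=> t; apply: (@cvg_big _ _ _ _ _ add_continuous) => // p _.
by apply: cvgMl_tmp; apply: cvgB; exact: cWc.
Qed.

Section discrete_grid.
Variables (l : seq (R * R * R)) (S e : R) (tk : nat -> R) (a b : R).
Hypotheses (tk0 : tk 0%N = 0) (tkS : forall k, tk k <= tk k.+1).
Hypothesis hl : steps_in a b l.

Let tk_ge0 k : 0 <= tk k.
Proof. by elim: k => [|k IH]; rewrite ?tk0// (le_trans IH). Qed.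

(* The partial sums are frozen after their first exit from [[-e, e]]: the
   increments stay orthogonal, so that the second moment remains controlled. *)
Fixpoint stopped k : T -> R :=
  if k is k'.+1 then fun w => stopped k' w +
    (if `|stopped k' w| <= e then istep (clip (tk k') (tk k'.+1) l) w else 0)
  else fun=> 0.

(** Once beyond e the stopped sum no longer moves, so an exit at any earlier grid time is still
    visible at step k. *)
Lemma stoppedP k w : e < `|stopped k w| \/
  stopped k w = iproc l (tk k) w /\ forall j, (j <= k)%N -> `|iproc l (tk j) w| <= e.
Proof.
have [e0|e0] := ltP e 0; first by left; rewrite (lt_le_trans e0).
elim: k => [|k [IH|[IH1 IH2]]] /=.
- right; rewrite tk0 iproc0; split=> // j; rewrite leqn0 => /eqP ->.
  by rewrite tk0 iproc0 normr0.
- by left; rewrite leNgt IH/= addr0.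
- rewrite IH1 IH2// istep_clip ?tk_ge0 ?tkS//.
  rewrite addrC subrK; have [h|h] := ltP e `|iproc l (tk k.+1) w|; first by left.
  by right; split=> // j; rewrite leq_eqVlt => /predU1P[->//|]; exact: IH2.
Qed.

Lemma adapted_stopped k : adapted W (tk k) (stopped k).
Proof.
elim: k => [|k IH] /=; first exact: measurable_cst.
apply: measurable_funD; first exact: adapted_le IH.
apply: measurable_fun_ifT.
- apply: measurable_fun_ler; last exact: measurable_cst.
  by apply: measurableT_comp; [exact: normr_measurable|exact: adapted_le IH].
- by apply: adapted_istep_clip; rewrite tk_ge0 tkS.
- exact: measurable_cst.
Qed.

Lemma sqint_stopped k : sqint P (stopped k).
Proof.
elim: k => [|k IH] /=; first exact: sqint_cst.
apply: sqintD => //; apply: sqint_mulbool.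
  by apply: measurable_fun_ler; [apply: measurableT_comp => //; exact: IH.1|].
by apply: (sqint_istep bW (tk_ge0 k) (clip_steps_in (tkS k) hl)).
Qed.

Lemma ip_stopped k : (forall u, 0 <= u < tk k -> `|fstep l u| <= S) ->
  ip P (stopped k) (stopped k) <= S ^+ 2 * tk k.
Proof.
elim: k => [|k IH] hS.
  by rewrite tk0 mulr0 /ip; under eq_Rintegral do rewrite mulr0; rewrite Rintegral_cst// mul0r.
have {}IH : ip P (stopped k) (stopped k) <= S ^+ 2 * tk k.
  by apply: IH => u /andP[u0 ut]; apply: hS; rewrite u0 (lt_le_trans ut).
pose bb w := `|stopped k w| <= e.
pose D := istep (clip (tk k) (tk k.+1) l).
have hcl := clip_steps_in (tkS k) hl.
have hD : sqint P D := sqint_istep bW (tk_ge0 k) hcl.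
have mb : measurable_fun setT bb.
  apply: measurable_fun_ler; last exact: measurable_cst.
  by apply: measurableT_comp => //; exact: (sqint_stopped k).1.
have hbD := sqint_mulbool mb hD.
have hY := sqint_stopped k; have hbY := sqint_mulbool mb hY.
rewrite [stopped k.+1]/= ip_sqrD//.
(* The indicator of not having left is moved to the factor known at time tk k, which is orthogonal
   to the next increment. *)
have -> : ip P (stopped k) (fun w => if bb w then D w else 0) =
          ip P (fun w => if bb w then stopped k w else 0) D.
  by apply: eq_Rintegral => w _; case: ifP => _; rewrite ?mulr0 ?mul0r.
have -> : ip P (fun w => if bb w then stopped k w else 0) D = 0.
  have aY : adapted W (tk k) (fun w => if bb w then stopped k w else 0).
    apply: measurable_fun_ifT; [|exact: adapted_stopped|exact: measurable_cst].
    apply: measurable_fun_ler; last exact: measurable_cst.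
    by apply: measurableT_comp; [exact: normr_measurable|exact: adapted_stopped].
  rewrite ipC /D /istep; move: hcl; elim: (clip _ _ _) => [_|[[c x] y] m IHm /=].
    rewrite /ip; under eq_Rintegral do rewrite big_nil mul0r.
    by rewrite Rintegral_cst// mul0r.
  move=> /andP[/and3P[/= tx xy yt] hm].
  have x0 := le_trans (tk_ge0 k) tx; have hx := sqint_inc bW x0 (le_trans x0 xy).
  under eq_fun do rewrite big_cons.
  rewrite ipDl//; [|exact: sqintZ|exact: (sqint_istep bW (tk_ge0 k) hm)].
  rewrite ipZl// ipC (adapted_ip0 bW (tk_ge0 k) tx xy aY hbY) mulr0 add0r.
  exact: IHm.
have hDD : ip P D D <= S ^+ 2 * (tk k.+1 - tk k).
  apply: (ip_istep_le bW (tk_ge0 k) (tkS k) hcl) => u /andP[u1 u2].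
  by rewrite fstep_clip ?u1// hS// u2 (le_trans (tk_ge0 k)).
have : ip P (fun w => if bb w then D w else 0) (fun w => if bb w then D w else 0) <= ip P D D.
  by apply: le_ip => // w; case: ifP => // _; rewrite expr0n/= sqr_ge0.
lra.
Qed.

(** If some partial sum leaves [-e, e], the stopped sum ends outside; Chebyshev's inequality at the
    last step thus bounds the whole maximum. *)
Lemma grid_maximal_inequality k : 0 < e ->
  (forall u, 0 <= u < tk k -> `|fstep l u| <= S) ->
  (P [set w | (exists2 j, (j <= k)%N & e < `|iproc l (tk j) w|)%R]
     <= (e ^- 2 * (S ^+ 2 * tk k))%:E)%E.
Proof.
move=> e0 hS; have hY := sqint_stopped k.
have ms (X : T -> R) : measurable_fun setT X -> measurable [set w : T | e < `|X w|].
  move=> mX; have mn : measurable_fun setT (fun w => `|X w|) by exact: measurableT_comp.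
  have := mn measurableT _ (measurable_itv `]e, +oo[); rewrite setTI.
  by congr (measurable _); apply/seteqP; split => w /=; rewrite in_itv/= andbT.
apply: (@le_trans _ _ (P [set w | (e < `|stopped k w|)%R])); last first.
  apply: (le_trans (sqint_tail hY e0)); rewrite lee_fin ler_pM2l ?invr_gt0 ?exprn_gt0//.
  exact: ip_stopped.
apply: le_measure; rewrite ?inE.
- rewrite (_ : [set w | _] = \bigcup_(j in [set j | (j <= k)%N]) [set w | e < `|iproc l (tk j) w|]); last first.
    by apply/seteqP; split => w /= [j ? ?]; exists j.
  apply: bigcup_measurable => j _; apply: ms.
  exact: (sqint_istep bW (lexx 0) (clip_steps_in (tk_ge0 j) hl)).1.
- by apply: ms; exact: hY.1.
- move=> w /= [j jk hj]; have [//|[_ h]] := stoppedP k w.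
  by move: hj; rewrite ltNge h.
Qed.

End discrete_grid.

(** By path continuity an exit at some time entails an exit at a point of a dyadic grid of [0, L].
    The event is thus an increasing union of grid events, which gives its measurability and, in the
    limit, the bound. *)
Lemma iproc_maximal_inequality l (a b S e L : R) : steps_in a b l -> 0 < e -> 0 < L ->
  (forall u, 0 <= u < L -> `|fstep l u| <= S) ->
  measurable [set w | exists2 t, 0 <= t <= L & e < `|iproc l t w|] /\
  (P [set w | (exists2 t, 0 <= t <= L & e < `|iproc l t w|)%R]
     <= (e ^- 2 * (S ^+ 2 * L))%:E)%E.
Proof.
move=> hl e0 L0 hS.
pose g (M j : nat) : R := L * j%:R / (2 ^+ M).
pose A M := [set w : T | exists2 j, (j <= 2 ^ M)%N & e < `|iproc l (g M j) w|].
have p0 M : 0 < (2 ^+ M : R) by rewrite exprn_gt0.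
have g0 M : g M 0%N = 0 by rewrite /g mulr0 mul0r.
have gS M k : g M k <= g M k.+1.
  by rewrite /g ler_pM2r ?invr_gt0// ler_pM2l// ler_nat.
have gE M : g M (2 ^ M)%N = L by rewrite /g natrX mulfK ?gt_eqF.
have gge M j : 0 <= g M j by rewrite /g mulr_ge0 ?invr_ge0 ?(ltW (p0 M)) ?mulr_ge0 ?(ltW L0).
have mA M : measurable (A M).
  rewrite (_ : A M = \bigcup_(j in [set j | (j <= 2 ^ M)%N]) [set w | e < `|iproc l (g M j) w|]); last first.
    by apply/seteqP; split => w /= [j ? ?]; exists j.
  apply: bigcup_measurable => j _.
  have mX := (sqint_istep bW (lexx 0) (clip_steps_in (gge M j) hl)).1.
  have mn : measurable_fun setT (fun w => `|iproc l (g M j) w|) by exact: measurableT_comp.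
  have := mn measurableT _ (measurable_itv `]e, +oo[); rewrite setTI.
  by congr (measurable _); apply/seteqP; split => w /=; rewrite in_itv/= andbT.
have AU : [set w | exists2 t, 0 <= t <= L & e < `|iproc l t w|] = \bigcup_M A M.
  apply/seteqP; split => w /=; last first.
    move=> [M _ [j jM hj]]; exists (g M j) => //; rewrite gge/= -[leRHS](gE M).
    by rewrite /g ler_pM2r ?invr_gt0// ler_pM2l// ler_nat.
  move=> [t /andP[t0 tL] ht].
  have cX := @continuous_iproc l w t.
  have /cvgrPdist_lt /(_ (`|iproc l t w| - e)) := cX.
  rewrite subr_gt0 (max_idPl t0) => /(_ ht) /nbhs_ballP[dd/= dd0 hd].
  have [M hM] : exists M, L / 2 ^+ M < dd.
    have [M hM] : exists M : nat, L / dd < M%:R.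
      by exists (Num.truncn (L / dd)).+1; rewrite truncnS_gt.
    exists M; rewrite ltr_pdivrMr// mulrC -ltr_pdivrMr// (lt_trans hM)//.
    by rewrite -natrX ltr_nat ltn_expl.
  exists M => //=; pose j := Num.truncn (t * 2 ^+ M / L).
  have tj : 0 <= t * 2 ^+ M / L by rewrite divr_ge0 ?mulr_ge0 ?(ltW (p0 M)) ?(ltW L0).
  have /andP[j1 j2] := truncn_itv tj; rewrite -/j in j1 j2.
  have gt_ : g M j <= t.
    rewrite /g ler_pdivrMr// mulrC; move: j1; rewrite ler_pdivlMr//.
  exists j.
    have : j%:R <= (2 ^ M)%:R :> R.
      rewrite (le_trans j1)// natrX ler_pdivrMr// mulrC ler_pM2l//.
    by rewrite ler_nat.
  have hball : ball t dd (g M j).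
    rewrite /ball/= ger0_norm ?subr_ge0//.
    apply: le_lt_trans hM; move: j2; rewrite ltr_pdivrMr// -(natr1 j) mulrDl mul1r.
    move=> h2; rewrite /g lerBlDr -mulrDl ler_pdivlMr//; rewrite (mulrC L); lra.
  have := hd _ hball; rewrite /= (max_idPl (gge M j)) => h.
  have := ler_dist_dist (iproc l t w) (iproc l (g M j) w).
  have := ler_norm (`|iproc l t w| - `|iproc l (g M j) w|).
  lra.
rewrite AU; split; first exact: bigcup_measurable.
have cP : P \o A @ \oo --> P (\bigcup_M A M).
  apply: nondecreasing_cvg_mu => //; first exact: bigcup_measurable.
  apply/nondecreasing_seqP => M; apply/subsetPset => w /= [j jM hj].
  (* Grid M + 1 contains grid M at the even indices. *)
  exists (j * 2)%N; first by rewrite expnSr leq_mul2r.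
  suff -> : g M.+1 (j * 2)%N = g M j by [].
  by rewrite /g exprSr natrM mulrA -mulf_div divff ?mulr1 ?pnatr_eq0.
rewrite -(cvg_lim _ cP)//; apply: lime_le; first by apply/cvg_ex; eexists; exact: cP.
apply: nearW => M /=; rewrite -[X in (_ * (_ * X))%R](gE M).
apply: (grid_maximal_inequality (g0 M) (gS M) hl e0) => u.
by rewrite gE; exact: hS.
Qed.

End maximal_inequality.

(** * Uniform approximation by step functions *)

Section step_approximation.
Context {R : realType}.
Implicit Types (g : R -> R).

Lemma continuous_uniform_segment g (L e : R) : continuous g -> 0 < e ->
  exists2 dl, 0 < dl & forall x y, 0 <= x <= L -> `|y - x| < dl -> `|g y - g x| < e.
Proof.
move=> cg e0.
have /compact_near_coveringP/near_covering_withinP := @segment_compact R 0 L.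
move=> /(_ R (0 : R)^'+ (fun dl x => forall y, `|y - x| < dl -> `|g y - g x| < e)).
case.
- move=> x _; have e2 : 0 < e / 2 by rewrite divr_gt0.
  have /cvgrPdist_lt /(_ _ e2) /nbhs_ballP[h/= h0 hh] := cg x.
  have h2 : 0 < h / 2 by rewrite divr_gt0.
  exists (ball x (h / 2), [set dl : R | dl < h / 2]) => /=.
    split; first by apply/nbhs_ballP; exists (h / 2).
    by apply: nbhs_right_lt.
  move=> [x' dl]/= [hx' hdl] _ y hy.
  have hy2 : ball x h y.
    rewrite /ball/= in hx' *; have := ler_distD x' x y; rewrite (distrC x' y); lra.
  have hx2 : ball x h x' by rewrite /ball/= in hx' *; lra.
  have h3 := hh _ hy2; have h4 := hh _ hx2; rewrite /= in h3 h4.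
  have := ler_distD (g x) (g y) (g x'); rewrite (distrC (g y) (g x)); lra.
move=> dd /= dd0 hd.
exists (dd / 2); first by rewrite divr_gt0.
move=> x y x0L hxy; apply: (hd (dd / 2)) => //=.
- by rewrite sub0r normrN gtr0_norm ?divr_gt0//; lra.
- by rewrite divr_gt0.
Qed.

Definition grid_list g (tk : nat -> R) n : seq (R * R * R) :=
  [seq (g (tk k), tk k, tk k.+1) | k <- iota 0 n].

Lemma fstep_grid_list g tk n u : (forall k, tk k <= tk k.+1) ->
  (tk n <= u -> fstep (grid_list g tk n) u = 0) /\
  (tk 0%N <= u < tk n -> exists2 k, tk k <= u < tk k.+1 &
     fstep (grid_list g tk n) u = g (tk k)).
Proof.
move=> tkS; elim: n => [|n [IH1 IH2]].
  rewrite /grid_list/= /fstep big_nil; split=> // /andP[h1 h2].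
  by move: (le_lt_trans h1 h2); rewrite ltxx.
have e : grid_list g tk n.+1 = grid_list g tk n ++ [:: (g (tk n), tk n, tk n.+1)].
  rewrite /grid_list (_ : iota 0 n.+1 = iota 0 n ++ [:: n]) ?map_cat//.
  by rewrite -addn1 iotaD add0n.
have e1 : fstep [:: (g (tk n), tk n, tk n.+1)] u =
    g (tk n) * (tk n <= u < tk n.+1)%R%:R.

  by rewrite /fstep big_seq1/= indicE mem_setE in_itv.
rewrite e fstep_cat e1; split.
  move=> h; rewrite IH1 ?(le_trans (tkS n))// add0r (ltNge u) h andbF mulr0//.
move=> /andP[h1 h2]; have [h3|h3] := leP (tk n) u.
  by exists n; rewrite ?h3 ?h2// IH1// add0r mulr1.
have [k hk hk2] := IH2 (introT andP (conj h1 h3)).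
by exists k => //; rewrite hk2 mulr0 addr0.
Qed.

(** The partition used by [wiener_sum], named so that left-point sums become step integrals. *)
Definition wgrid (t : R) (m k : nat) : R := t * k%:R / m%:R.

Lemma wgrid_le t m k : 0 <= t -> wgrid t m k <= wgrid t m k.+1.
Proof.
by move=> t0; rewrite /wgrid ler_wpM2r ?invr_ge0// ler_wpM2l// ler_nat.
Qed.

Lemma wgrid_itv t m k : 0 <= t -> (k <= m)%N -> (0 < m)%N -> 0 <= wgrid t m k <= t.
Proof.
move=> t0 km m0; rewrite /wgrid divr_ge0 ?mulr_ge0//= ler_pdivrMr ?ltr0n//.
by rewrite ler_wpM2l// ler_nat.
Qed.

Lemma wgrid_steps_in g t m : 0 <= t -> (0 < m)%N -> steps_in 0 t (grid_list g (wgrid t m) m).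
Proof.
move=> t0 m0; apply/allP => p /mapP[k]; rewrite mem_iota add0n => /= km ->/=.
have /andP[-> _] := wgrid_itv t0 (ltnW km) m0.
by have /andP[_ ->] := wgrid_itv t0 km m0; rewrite wgrid_le.
Qed.

(** Uniform continuity on [0, L]; the threshold m0 is uniform in t because the mesh t / m is at most
    L / m. *)
Lemma grid_list_approx g (L e : R) : continuous g -> 0 <= L -> 0 < e ->
  exists m0 : nat, forall m t, (m0 <= m)%N -> (0 < m)%N -> 0 <= t <= L ->
  forall u, 0 <= u < t -> `|fstep (grid_list g (wgrid t m) m) u - g u| <= e.
Proof.
move=> cg L0 e0; have [dl dl0 hdl] := continuous_uniform_segment L cg e0.
exists (Num.truncn (L / dl)).+1 => m t hm m0 /andP[t0 tL] u /andP[u0 ut].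
have hm' : L / dl < m%:R.
  by rewrite (lt_le_trans (truncnS_gt _))// ler_nat.
have [_ /(_ _)[]] := @fstep_grid_list g (wgrid t m) m u (fun k => wgrid_le m k t0).
  by rewrite /wgrid mulr0 mul0r u0/= mulfK// pnatr_eq0 -lt0n.
move=> k /andP[k1 k2] ->; apply/ltW/hdl; first by rewrite u0 (le_trans (ltW ut)).
rewrite distrC ger0_norm ?subr_ge0//.
have : wgrid t m k.+1 - wgrid t m k = t / m%:R.
  by rewrite /wgrid -mulrBl -mulrBr -natr1 [_ + 1]addrC addrK mulr1.
have : t / m%:R < dl.
  rewrite ltr_pdivrMr ?ltr0n// (le_lt_trans tL)// mulrC -ltr_pdivrMr//.
lra.
Qed.

(** The rate 8^-j is fast enough to survive, in the maximal inequality, the division by the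
    thresholds 2^-j and the growth of the interval [0, j + 1]. *)
Lemma step_approximation g : continuous g -> exists l : nat -> seq (R * R * R),
  forall j, steps_in 0 j.+1%:R (l j) /\
  forall u, 0 <= u < j.+1%:R -> `|fstep (l j) u - g u| <= 8 ^- j.
Proof.
move=> cg; suff h (j : nat) : exists l, steps_in 0 j.+1%:R l /\
    forall u, 0 <= u < j.+1%:R -> `|fstep l u - g u| <= 8 ^- j.
  by have [l hl] := choice h; exists l.
have [|m0 hm] := grid_list_approx cg (ler0n _ j.+1) (_ : 0 < 8 ^- j).
  by rewrite invr_gt0 exprn_gt0.
exists (grid_list g (wgrid j.+1%:R m0.+1) m0.+1); split.
  exact: wgrid_steps_in.
by apply: hm; rewrite // lexx ler0n.
Qed.

End step_approximation.

Section fast_sequences.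
Context {R : realType}.

Lemma fast_cauchy (u : nat -> R) n0 :
  (forall j, (n0 <= j)%N -> `|u j.+1 - u j| <= 2 ^- j) ->
  cvgn u /\ forall j, (n0 <= j)%N -> `|limn u - u j| <= 2 * 2 ^- j.
Proof.
move=> hu.
have p0 k : 0 < (2 : R) ^- k by rewrite invr_gt0 exprn_gt0.
have tele j m : (n0 <= j)%N -> (j <= m)%N -> `|u m - u j| <= 2 * 2 ^- j.
  (* This sharper bound is the one that induction on m - j preserves. *)
  move=> nj jm; suff : `|u m - u j| <= 2 * 2 ^- j - 2 * 2 ^- m.
    by have := p0 m; lra.
  rewrite -(subnKC jm); elim: (m - j)%N => [|k IH]; first by rewrite addn0 !subrr normr0.
  have := hu (j + k)%N (leq_trans nj (leq_addr _ _)).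
  have := ler_distD (u (j + k)%N) (u (j + k).+1) (u j).
  rewrite addnS (_ : (2 : R) ^- (j + k).+1 = 2 ^- (j + k) / 2); last by rewrite exprSr invfM.
  lra.
have cu : cvgn u.
  apply/cauchy_cvgP/cauchy_ballP => e e0.
  have [M hM] : exists M, 8 / e < 2 ^+ M.
    exists (Num.truncn (8 / e)).+1; rewrite (lt_trans (truncnS_gt _))//.
    by rewrite -natrX ltr_nat ltn_expl.
  have hM' : 8 * 2 ^- M < e.
    by rewrite ltr_pdivrMr ?exprn_gt0// mulrC -ltr_pdivrMr.
  pose K := maxn n0 M.
  have hK : 2 ^- K <= (2 : R) ^- M.
    by rewrite lef_pV2 ?posrE ?exprn_gt0// ler_weXn2l ?ler1n// leq_maxr.
  rewrite near_map2; exists ([set i | (K <= i)%N], [set i | (K <= i)%N]) => /=.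
    by split; exists K.
  move=> [a b]/= [Ka Kb]; rewrite /ball/=.
  have h1 := tele K a (leq_maxl _ _) Ka; have h2 := tele K b (leq_maxl _ _) Kb.
  have := ler_distD (u K) (u a) (u b); rewrite (distrC (u K)); have := p0 M; lra.
split=> // j nj.
have c1 : (fun m => `|u m - u j|) @ \oo --> `|limn u - u j|.
  by apply: cvg_norm; apply: cvgB => //; exact: cvg_cst.
rewrite -(cvg_lim _ c1)//; apply: limr_le; first by apply/cvg_ex; eexists; exact: c1.
by exists j => // m /= jm; exact: tele.
Qed.

End fast_sequences.

Section fatou_second_moment.
Context {d : measure_display} {T : measurableType d} {R : realType}.
Variable P : probability T R.

(** By Fatou's lemma, second moments can be estimated on step approximations and carried over to an
    almost sure limit. *)
Lemma second_moment_limit_le (X : nat -> T -> R) (Z : T -> R) (C : R) :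
  (forall j, sqint P (X j)) -> measurable_fun setT Z ->
  {ae P, forall w, X j w @[j --> \oo] --> Z w} ->
  (\forall j \near \oo, ip P (X j) (X j) <= C) ->
  (\int[P]_w (Z w ^+ 2)%:E <= C%:E)%E.
Proof.
move=> hX mZ hc [n0 _ hC].
pose F j w := (X (j + n0)%N w ^+ 2)%:E.
have mF j : measurable_fun setT (F j) by apply: measurable_sqr; exact: (hX _).1.
apply: (@le_trans _ _ (\int[P]_w limn_einf (F^~ w))%E).
  apply: ae_ge0_le_integral => //.
  - by move=> w _; rewrite lee_fin sqr_ge0.
  - exact: measurable_sqr.
  - move=> w _; rewrite limn_einf_lim; apply: lime_ge; first exact: is_cvg_einfs.
    by apply: nearW => k; apply: le_ereal_inf_tmp => _ [j _ <-]; rewrite lee_fin sqr_ge0.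
  - rewrite (_ : (fun w => _) = (fun w => - limn_esup (fun j => - F j w)))%E.
      apply: measurableT_comp; first exact: oppe_measurable.
      by apply: measurable_fun_limn_esup => j; apply: measurableT_comp (mF j).
    apply/funext => w; rewrite -limn_einfN; congr limn_einf.
    by apply/funext => j /=; rewrite opprK.

  apply: filterS hc => w hw _.
  have /cvg_limn_einf_sup[-> _] : F ^~ w @ \oo --> (Z w ^+ 2)%:E.
    apply: cvg_EFin; first exact: nearW.
    have hw' : (fun j => X (j + n0)%N w) @ \oo --> Z w by move: hw; rewrite -(cvg_shiftn n0).
    exact: (cvgM hw' hw').
  exact: lexx.
apply: (le_trans (fatou _ _ _ _)) => //.
  by move=> j w _; rewrite lee_fin sqr_ge0.
rewrite limn_einf_lim; apply: lime_le; first exact: is_cvg_einfs.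
apply: nearW => k; apply: (@le_trans _ _ (\int[P]_w F k w)%E).
  by apply: ereal_inf_lbound; exists k => //=.
rewrite -ipE// lee_fin; apply: hC => /=; exact: leq_addl.
Qed.

End fatou_second_moment.

(** * A continuous version of the Wiener integral *)

Section wiener_integral.
Context {d : measure_display} {T : measurableType d} {R : realType}.
Variables (P : probability T R) (W : R -> T -> R).
Hypothesis bW : brownian P W.
Local Notation mu := (@lebesgue_measure R).
Local Notation istep := (istep W).
Local Notation iproc := (iproc W).

Lemma iproc_cat l l' t w : iproc (l ++ l') t w = iproc l t w + iproc l' t w.
Proof. by rewrite /iproc clip_cat istep_cat. Qed.

Lemma iproc_opp l t w : iproc (oppl l) t w = - iproc l t w.
Proof. by rewrite /iproc clip_opp istep_opp. Qed.

Lemma fstep_end (s t : R) l : steps_in s t l -> fstep l t = 0.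
Proof.
elim: l => [_|[[k c] e] l IH /= /andP[/and3P[_ _ /= et] /IH h]].
  by rewrite /fstep big_nil.
rewrite /fstep big_cons -/(fstep l t) h addr0 indicE mem_setE in_itv/= (ltNge t) et.
by rewrite andbF mulr0.
Qed.

Lemma le_steps_in (s t t' : R) l : t <= t' -> steps_in s t l -> steps_in s t' l.
Proof.
move=> tt; elim: l => //= -[[k c] e] l IH /andP[/and3P[-> -> et] /IH ->].
by rewrite (le_trans et).
Qed.

Section approximating_sequence.
Variables (g : R -> R) (l : nat -> seq (R * R * R)).
Hypothesis cg : continuous g.
Hypothesis hl : forall j, steps_in 0 j.+1%:R (l j) /\
  forall u, 0 <= u < j.+1%:R -> `|fstep (l j) u - g u| <= 8 ^- j.

Let p2 k : 0 < (2 : R) ^- k. Proof. by rewrite invr_gt0 exprn_gt0. Qed.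

(* By the maximal inequality these events have summable probabilities, and
   outside of their limsup the approximations converge locally uniformly. *)
Definition jump_event j : set T :=
  [set w | exists2 t, 0 <= t <= j.+1%:R & 2 ^- j < `|iproc (l j.+1 ++ oppl (l j)) t w|].

(** On [0, j + 1[ the two step functions differ by at most 2 * 8^-j, so the maximal inequality with
    threshold 2^-j gives at most 4 (j + 1) 16^-j. The weaker bound 8 / 2^(j + 1) is the general term
    of a series whose sum is at most 8. *)
Lemma jump_eventP j : measurable (jump_event j) /\
  (P (jump_event j) <= (8 / (2 ^ j.+1)%:R)%:E)%E.
Proof.
have hs : steps_in 0 j.+2%:R (l j.+1 ++ oppl (l j)).
  rewrite steps_in_cat steps_in_opp (hl _).1/=; apply: le_steps_in (hl j).1.
  by rewrite ler_nat.
have [|mE hE] := iproc_maximal_inequality bW hs (p2 j) (ltr0Sn _ j) (_ : forall u,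
  0 <= u < j.+1%:R -> `|fstep (l j.+1 ++ oppl (l j)) u| <= 2 * 8 ^- j).
  move=> u /andP[u0 uj]; rewrite fstep_cat fstep_opp.
  have h1 : `|fstep (l j) u - g u| <= 8 ^- j by apply: (hl j).2; rewrite u0.
  have h2 : `|fstep (l j.+1) u - g u| <= 8 ^- j.+1.
    by apply: (hl _).2; rewrite u0 (lt_trans uj)// ltr_nat.
  have h3 : (8 : R) ^- j.+1 <= 8 ^- j.
    by rewrite lef_pV2 ?posrE ?exprn_gt0// ler_weXn2l ?ler1n.
  have := ler_distD (g u) (fstep (l j.+1) u) (fstep (l j) u).
  rewrite (distrC (g u)); move: h1 h2 h3; set a := 8 ^- j; set b := 8 ^- _.

  lra.
split=> //; apply: (le_trans hE)
; rewrite lee_fin.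
have j2 : j.+1%:R <= (2 : R) ^+ j by rewrite -natrX ler_nat ltn_expl.
have e8 : (8 : R) ^- j = 2 ^- j * 2 ^- j * 2 ^- j.
  by rewrite -!invfM -!exprMn; congr (_ ^- _); ring.
rewrite natrX e8 exprVn invrK.
have ->: (2 ^+ j) ^+ 2 * ((2 * (2 ^- j * 2 ^- j * 2 ^- j)) ^+ 2 * j.+1%:R) =
  4 * (2 ^+ j * 2 ^- j) ^+ 2 * (2 ^- j) ^+ 3 * (2 ^- j * j.+1%:R) :> R.
  ring.
rewrite mulfV ?gt_eqF ?exprn_gt0// expr1n mulr1.
have h1 : 2 ^- j * j.+1%:R <= 1 :> R by rewrite mulrC ler_pdivrMr ?exprn_gt0// mul1r.
have h2 : (2 : R) ^- j <= 1 by rewrite invf_le1 ?exprn_gt0// exprn_ege1// ler1n.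
have h0 := p2 j; move: h1 h2 h0; set y := 2 ^- j; set z := y * _ => h1 h2 h0.
have z0 : 0 <= z by rewrite mulr_ge0// ltW.
have y3 : y ^+ 3 <= y.
  by rewrite -[leRHS]mulr1 exprS ler_pM2l// expr2 mulr_ile1// ltW.
have : 4 * y ^+ 3 * z <= 4 * y * 1.
  by apply: ler_pM => //; [rewrite mulr_ge0 ?exprn_ge0// ltW|rewrite ler_pM2l].
have -> : 8 / 2 ^+ j.+1 = 4 * y by rewrite /y exprS invfM mulrA; congr (_ * _); lra.
lra.
Qed.

Definition bad_set : set T := lim_sup_set jump_event.

Lemma measurable_bad_set : measurable bad_set.
Proof.
apply: bigcap_measurable => // n _; apply: bigcup_measurable => j _.
exact: (jump_eventP j).1.
Qed.

(** Borel-Cantelli: the probabilities of the jump events are summable. *)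
Lemma bad_set0 : P bad_set = 0%E.
Proof.
apply: lim_sup_set_cvg0; first by move=> k; exact: (jump_eventP k).1.
have := @epsilon_trick R (fun=> 0%E) 8 xpredT (fun=> lexx _) (ler0n _ 8).
rewrite [X in (_ <= X + _)%E]eseries0// add0e => h.
apply: (@le_lt_trans _ _ (8%:E)%E); last exact: ltry.
apply: le_trans h; apply: lee_nneseries => // j _; rewrite add0e.
exact: (jump_eventP j).2.
Qed.

Lemma good_pathP w : (~` bad_set) w -> exists n0 : nat, forall j (t : R), (n0 <= j)%N ->
  0 <= t <= j.+1%:R -> `|iproc (l j.+1) t w - iproc (l j) t w| <= 2 ^- j.
Proof.
rewrite /bad_set /lim_sup_set /= -[(~ _)]/((~` _) w) setC_bigcap => -[n0 _ h].
exists n0 => j t nj tj; rewrite leNgt; apply/negP => hj.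
apply: h; exists j => //; exists t => //; by rewrite iproc_cat iproc_opp.
Qed.

(** On the null set [bad_set] the value is set to 0, so that every path, and not only almost every
    path, is continuous, as [closed_loop] requires. *)
Definition wint (t : R) (w : T) : R :=
  if w \in ~` bad_set then limn (fun j => iproc (l j) t w) else 0.

(** The starting index depends on w and L only: the convergence is uniform in t <= L, and continuity
    in time is read off from it. *)
Lemma wint_approx w (L : R) : (~` bad_set) w -> exists n0 : nat, forall j (t : R),
  (n0 <= j)%N -> 0 <= t <= L ->
  (fun j => iproc (l j) t w) @ \oo --> wint t w /\
  `|wint t w - iproc (l j) t w| <= 2 * 2 ^- j.
Proof.
move=> gw; have [n0 h] := good_pathP gw.
exists (maxn n0 (Num.truncn L).+1) => j t; rewrite geq_max => /andP[nj Lj] /andP[t0 tL].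
rewrite /wint mem_set//.
have [|h1 h2] := @fast_cauchy R (fun j => iproc (l j) t w) (maxn n0 (Num.truncn L).+1).
  move=> k; rewrite geq_max => /andP[nk Lk]; apply: h => //; rewrite t0 (le_trans tL)//.
  rewrite (le_trans (ltW (truncnS_gt L)))// ler_nat; exact: leqW.
by split=> //; apply: h2; rewrite geq_max nj.
Qed.

Lemma measurable_iproc j (t : R) : 0 <= t -> sqint P (iproc (l j) t).
Proof.
by move=> t0; exact: (sqint_istep bW (lexx 0) (clip_steps_in t0 (hl j).1)).
Qed.

Lemma ae_wint_cvg (t : R) : 0 <= t ->
  {ae P, forall w, (fun j => iproc (l j) t w) @ \oo --> wint t w}.
Proof.
move=> t0; exists bad_set; split; [exact: measurable_bad_set|exact: bad_set0|].
move=> w; apply: contra_notP => gw; have [n0 h] := wint_approx t gw.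
by apply: (h n0 t _ _).1 => //; rewrite t0 lexx.
Qed.

Lemma measurable_wint (t : R) : 0 <= t -> measurable_fun setT (wint t).
Proof.
move=> t0; apply: (@measurable_fun_cvg _ _ _ _
    (fun j w => if w \in ~` bad_set then iproc (l j) t w else 0)).
  move=> j; apply: measurable_fun_ifT => //; last exact: (measurable_iproc j t0).1.
  apply: (measurable_fun_bool true); rewrite setTI (_ : _ @^-1` _ = ~` bad_set).
    by apply: measurableC; exact: measurable_bad_set.
  by apply/seteqP; split => w /=; [move/set_mem|move/mem_set].

move=> w _; have [gw|bw] := pselect ((~` bad_set) w); last first.
  by rewrite /wint memNset//; exact: cvg_cst.
rewrite mem_set//; have [n0 h] := wint_approx t gw.

by apply: (h n0 t _ _).1 => //; rewrite t0 lexx.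
Qed.

Lemma wint0 w : wint 0 w = 0.
Proof.
rewrite /wint; case: ifP => // _; under eq_fun do rewrite iproc0.
exact: lim_cst.
Qed.

Lemma continuous_wint w : continuous (fun t : R => wint (Num.max t 0) w).
Proof.
have [gw|bw] := pselect ((~` bad_set) w); last first.
  have -> : (fun t : R => wint (Num.max t 0) w) = fun=> 0.
    by apply/funext => t; rewrite /wint memNset.
  exact: cst_continuous.
move=> t; apply/cvgrPdist_lt => e e0.
have [n0 h] := wint_approx (Num.max t 0 + 1) gw.
(* Two approximation errors of at most 2 * 2^-K each are to stay below e / 2, the other half being
   left for the continuity of the approximating path. *)
have [M hM] : exists M, 8 / e < 2 ^+ M.
  exists (Num.truncn (8 / e)).+1; rewrite (lt_trans (truncnS_gt _))//.
  by rewrite -natrX ltr_nat ltn_expl.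
have {}hM : 8 * 2 ^- M < e.
  by rewrite ltr_pdivrMr ?exprn_gt0// mulrC -ltr_pdivrMr.
pose K := maxn n0 M.
have hK : 2 ^- K <= (2 : R) ^- M.
  by rewrite lef_pV2 ?posrE ?exprn_gt0// ler_weXn2l ?ler1n// leq_maxr.
have /cvgrPdist_lt/(_ _ (divr_gt0 e0 (ltr0Sn _ 1))) hcont := @continuous_iproc _ _ _ _ _ bW (l K) w t.
near=> u.
have hu : 0 <= Num.max u 0 <= Num.max t 0 + 1.
  rewrite le_max lexx orbT/= ge_max addr_ge0 ?le_max ?lexx ?orbT// andbT.
  have : u < t + 1 by near: u; apply: lt_nbhsl; lra.
  by move=> /ltW/le_trans; apply; rewrite lerD2r le_max lexx.
have ht : 0 <= Num.max t 0 <= Num.max t 0 + 1.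
  by rewrite le_max lexx orbT/= lerDl.
have [_ hu'] := h K _ (leq_maxl _ _) hu; have [_ ht'] := h K _ (leq_maxl _ _) ht.
have : `|iproc (l K) (Num.max t 0) w - iproc (l K) (Num.max u 0) w| < e / 2.
  by near: u.
move: ht' hu'; set a := wint _ _; set b := wint _ _; set c := iproc _ _ _; set f := iproc _ _ _.
have := ler_distD c a b; have := ler_distD f c b; rewrite (distrC f b).
have := p2 M; lra.
Unshelve. all: by end_near. Qed.

(** The left-point sum and the j-th approximation are step integrals of functions within e of g,
    hence within 2 e of each other; the isometry bounds their distance and Fatou's lemma lets j tend
    to infinity. *)
Lemma wint_sum_le (t e : R) : 0 <= t -> 0 < e -> \forall m \near \oo,
  (\int[P]_w ((istep (grid_list g (wgrid t m) m) w - wint t w) ^+ 2)%:E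
     <= ((2 * e) ^+ 2 * t)%:E)%E.
Proof.
move=> t0 e0; have [m0 hm0] := grid_list_approx cg t0 e0.
exists m0.+1 => // m /= m0m; have mp : (0 < m)%N by exact: leq_ltn_trans m0m.
have hg := wgrid_steps_in g t0 mp.
have hY := sqint_istep bW (lexx 0) hg.
apply: (@second_moment_limit_le _ _ _ _ (fun j w => istep (grid_list g (wgrid t m) m) w - iproc (l j) t w)).
- by move=> j; apply: sqintB => //; exact: measurable_iproc.
- by apply: measurable_funB; [exact: hY.1|exact: measurable_wint].
- apply: filterS (ae_wint_cvg t0) => w hw.
  by apply: cvgB => //; exact: cvg_cst.
have [M hM] : exists M, 1 / e < 8 ^+ M.
  exists (Num.truncn (1 / e)).+1; rewrite (lt_trans (truncnS_gt _))//.
  by rewrite -natrX ltr_nat ltn_expl.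
have {}hM : 8 ^- M < e.
  by rewrite -[X in X < _]mul1r ltr_pdivrMr ?exprn_gt0// mulrC -ltr_pdivrMr.
exists (maxn M (Num.truncn t).+1) => // j /=; rewrite geq_max => /andP[Mj tj].
have tj' : t <= j.+1%:R.
  by rewrite (le_trans (ltW (truncnS_gt t)))// ler_nat leqW.
have hc := clip_steps_in t0 (hl j).1.
pose c := grid_list g (wgrid t m) m ++ oppl (clip 0 t (l j)).
have ec : (fun w => istep (grid_list g (wgrid t m) m) w - iproc (l j) t w) = istep c.
  by apply/funext => w; rewrite /c istep_cat istep_opp.
rewrite ec -[X in _ * X]subr0; apply: (ip_istep_le bW (lexx 0) t0).
  by rewrite /c steps_in_cat steps_in_opp hg hc.
move=> u ut; rewrite /c fstep_cat fstep_opp fstep_clip//.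
have h1 := hm0 m t (ltnW m0m) mp (introT andP (conj t0 (lexx t))) u ut.
have h2 : `|fstep (l j) u - g u| <= 8 ^- j.
  by apply: (hl j).2; case/andP: ut => -> /= /lt_le_trans; apply.
have h3 : (8 : R) ^- j <= 8 ^- M.
  by rewrite lef_pV2 ?posrE ?exprn_gt0// ler_weXn2l ?ler1n.
have := ler_distD (g u) (fstep (grid_list g (wgrid t m) m) u) (fstep (l j) u).
rewrite (distrC (g u)); lra.
Qed.

(** The approximations that cover [s, t] are within 1 of g, so their squares are at most 2 (g^2 +
    1); the isometry and Fatou's lemma transfer this rough bound, which suffices for finiteness of
    the discounted energy. *)
Lemma wint_increment_le (s t : R) : 0 <= s -> s <= t ->
  (\int[P]_w ((wint t w - wint s w) ^+ 2)%:E
     <= (\int[mu]_(u in `[s, t]) (2 * (g u ^+ 2 + 1)))%:E)%E.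
Proof.
move=> s0 st; have t0 := le_trans s0 st.
apply: (@second_moment_limit_le _ _ _ _ (fun j w => iproc (l j) t w - iproc (l j) s w)).
- by move=> j; apply: sqintB; exact: measurable_iproc.
- by apply: measurable_funB; exact: measurable_wint.
- apply: filterS2 (ae_wint_cvg t0) (ae_wint_cvg s0) => w h1 h2; exact: cvgB.
exists (Num.truncn t).+1 => // j /= tj.
have tj' : t <= j.+1%:R.
  by rewrite (le_trans (ltW (truncnS_gt t)))// ler_nat leqW.
have hc := clip_steps_in st (hl j).1.
have ec : (fun w => iproc (l j) t w - iproc (l j) s w) = istep (clip s t (l j)).
  by apply/funext => w; rewrite istep_clip// s0.
rewrite ec (ip_istep bW s0 hc hc); apply: le_Rintegral => //.
- exact: fstepM_integrable.
- apply: continuous_integrable => u.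
  apply: cvgMl_tmp; apply: cvgD; last exact: cvg_cst.
  by apply: (@continuous_comp _ _ _ g (fun x => x ^+ 2)); [exact: cg|exact: exprn_continuous].

move=> u; rewrite /= in_itv/= => /andP[su ut]; rewrite -expr2.
have hg : 0 <= g u ^+ 2 by rewrite sqr_ge0.
move: ut; rewrite le_eqVlt => /predU1P[->|ut].
  by rewrite (fstep_end hc) expr0n/= mulr_ge0// addr_ge0// sqr_ge0.
rewrite fstep_clip ?su//.
have : `|fstep (l j) u - g u| <= 8 ^- j.
  by apply: (hl j).2; rewrite (le_trans s0 su) (lt_le_trans ut).
have : (8 : R) ^- j <= 1 by rewrite invf_le1 ?exprn_gt0// exprn_ege1// ler1n.
rewrite ler_norml => h1 /andP[h2 h3].
set y := fstep _ _ in h2 h3 *; have := sqr_ge0 (y - 2 * g u).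
have : (y - g u) ^+ 2 <= 1.
  rewrite -real_normK ?num_real// exprn_ile1//; rewrite ler_norml; lra.
nra.
Qed.

End approximating_sequence.

Theorem wiener_continuous_version (g : R -> R) : continuous g ->
  exists J : R -> T -> R,
  [/\ forall t, 0 <= t -> measurable_fun setT (J t),
      forall w, J 0 w = 0,
      forall w, continuous (fun t : R => J (Num.max t 0) w),
      forall t e : R, 0 <= t -> 0 < e -> \forall m \near \oo,
        (\int[P]_w ((istep (grid_list g (wgrid t m) m) w - J t w) ^+ 2)%:E
          <= ((2 * e) ^+ 2 * t)%:E)%E &
      forall s t, 0 <= s -> s <= t -> (\int[P]_w ((J t w - J s w) ^+ 2)%:E
        <= (\int[mu]_(u in `[s, t]) (2 * (g u ^+ 2 + 1)))%:E)%E].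
Proof.
move=> cg; have [l hl] := step_approximation cg; exists (wint l); split.
- by move=> t t0; exact: (measurable_wint hl).
- exact: wint0.
- exact: continuous_wint.
- by move=> t e t0 e0; exact: (wint_sum_le cg hl).
- by move=> s t s0 st; exact: (wint_increment_le cg hl).
Qed.

End wiener_integral.

(** * Joint measurability and Tonelli's theorem *)

Section continuous_random_paths.
Context {d : measure_display} {T : measurableType d} {R : realType}.
Local Notation mu := (@lebesgue_measure R).
Implicit Types (h : R -> T -> R).

Definition dyadic (m k : nat) : R := k%:R / 2 ^+ m.

Lemma dyadic_le m k : dyadic m k <= dyadic m k.+1.
Proof. by rewrite /dyadic ler_pM2r ?invr_gt0 ?exprn_gt0// ler_nat. Qed.

(* The process is the limit of its piecewise constant approximations on dyadic
   grids. *)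
Lemma measurable_continuous_paths h :
  (forall t, 0 <= t -> measurable_fun setT (h t)) ->
  (forall w, continuous (fun t : R => h (Num.max t 0) w)) ->
  measurable_fun (setT : set (T * measurableTypeR R)) (fun z => if 0 <= z.2 then h z.2 z.1 else 0).
Proof.
move=> mh ch.
(* The 4^m cells of width 2^-m cover [0, 2^m[, so every time is eventually covered by ever finer
   cells. *)
pose F m (z : T * measurableTypeR R) : R :=
  fstep (grid_list (h^~ z.1) (dyadic m) (4 ^ m)) z.2.
have p2 m : 0 < (2 : R) ^+ m by rewrite exprn_gt0.
apply: (@measurable_fun_cvg _ _ _ _ F).
  move=> m; rewrite /F /fstep /grid_list.
  under eq_fun do rewrite big_map.
  apply: measurable_sum => k /=; apply: measurable_funM.
    apply: (measurableT_comp (mh _ _)); last exact: measurable_fst.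
    by rewrite /dyadic divr_ge0// ltW.
  apply: (@measurableT_comp _ _ _ _ _ _ (\1_(`[dyadic m k, dyadic m k.+1[%classic : set R) : measurableTypeR R -> R)).
    exact: measurable_indic.
  exact: measurable_snd.
move=> [w t] _ /=; have [t0|t0] := leP 0 t; last first.
  apply: cvg_near_cst; apply: nearW => m; rewrite /F /fstep /grid_list big_map big1// => k _ /=.
  rewrite indicE mem_setE in_itv/= leNgt (lt_le_trans t0) ?mulr0//.
  by rewrite /dyadic divr_ge0// ltW.
apply/cvgrPdist_lt => e e0.
have /cvgrPdist_lt/(_ _ e0)/nbhs_ballP[dl/= dl0 hdl] := ch w t.
rewrite (max_idPl t0) in hdl.
exists (maxn (Num.truncn t).+1 (Num.truncn (1 / dl)).+1) => // m /=.
rewrite geq_max => /andP[tm dm].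
have tm' : t < 2 ^+ m.
  rewrite (lt_le_trans (truncnS_gt t))// -natrX ler_nat (leq_trans tm)//.
  exact/ltnW/ltn_expl.
have dm' : 2 ^- m < dl.
  rewrite -[X in X < _]mul1r ltr_pdivrMr// mulrC -ltr_pdivrMr//.
  rewrite (lt_le_trans (truncnS_gt _))// -natrX ler_nat (leq_trans dm)//.
  exact/ltnW/ltn_expl.
have [_ /(_ _)[]] := @fstep_grid_list R (h^~ w) (dyadic m) (4 ^ m) t (dyadic_le m).
  rewrite /dyadic mul0r t0/= (lt_le_trans tm')// ler_pdivlMr//.
  by rewrite -!natrX -natrM ler_nat -expnMn.
move=> k /andP[k1 k2]; rewrite /F /= => ->.
have k0 : 0 <= dyadic m k by rewrite /dyadic divr_ge0// ltW.
have := hdl (dyadic m k); rewrite /= (max_idPl k0); apply.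
rewrite /ball/= ger0_norm ?subr_ge0//.
have : dyadic m k.+1 - dyadic m k = 2 ^- m.
  by rewrite /dyadic -mulrBl -natr1 [_ + 1]addrC addrK mul1r.
lra.
Qed.

Section tonelli.
Variables (P : probability T R) (h : R -> T -> R).
Hypothesis mh : forall t, 0 <= t -> measurable_fun setT (h t).
Hypothesis ch : forall w, continuous (fun t : R => h (Num.max t 0) w).
Hypothesis h0 : forall t w, 0 <= h t w.

Let F (z : T * measurableTypeR R) : \bar R := (if 0 <= z.2 then h z.2 z.1 else 0)%:E.

Let mF : measurable_fun setT F.
Proof. by apply/measurable_EFinP; exact: (measurable_continuous_paths mh ch). Qed.

Let F0 z : (0 <= F z)%E.
Proof. by rewrite /F lee_fin; case: ifP. Qed.

Let FE w : (\int[mu]_(t in `[0%R, +oo[) (h t w)%:E = \int[mu]_t F (w, t))%E.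
Proof.
rewrite [LHS]integral_mkcond; apply: eq_integral => t _.
rewrite patchE /F/= mem_setE in_itv/= andbT; by case: ifP.
Qed.

Lemma measurable_path_integral :
  measurable_fun setT (fun w => \int[mu]_(t in `[0%R, +oo[) (h t w)%:E)%E.
Proof.
under eq_fun do rewrite FE.
exact: (@measurable_fun_fubini_tonelli_F _ _ T (measurableTypeR R) R mu F).
Qed.

Lemma measurable_path_moment :
  measurable_fun (`[0%R, +oo[%classic : set R) (fun t => \int[P]_w (h t w)%:E)%E.
Proof.
have mG : measurable_fun (setT : set (measurableTypeR R)) (fun t => \int[P]_w F (w, t))%E.
  exact: (@measurable_fun_fubini_tonelli_G _ _ T (measurableTypeR R) R P F).
have mG' : measurable_fun (setT : set R) (fun t => \int[P]_w F (w, t))%E := mG.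
apply: (eq_measurable_fun (fun t => \int[P]_w F (w, t))%E); last exact: measurable_funTS.
by move=> t; rewrite inE/= in_itv/= andbT => t0; rewrite /F/= t0.
Qed.

Lemma tonelli_path_integral :

  (\int[P]_w \int[mu]_(t in `[0%R, +oo[) (h t w)%:E =
   \int[mu]_(t in `[0%R, +oo[) \int[P]_w (h t w)%:E)%E.
Proof.
under eq_integral do rewrite FE.
rewrite (@fubini_tonelli _ _ T (measurableTypeR R) R P mu F)//.
rewrite [RHS]integral_mkcond; apply: eq_integral => t _.
rewrite patchE mem_setE in_itv/= andbT /F/=.
by case: ifP => // _; rewrite integral0.
Qed.

End tonelli.

End continuous_random_paths.

Section extended_real_limits.
Context {R : realType}.

Lemma cvge0P (u : nat -> \bar R) : (forall m, 0 <= u m)%E ->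
  u @ \oo --> 0%E <-> forall e : R, 0 < e -> \forall m \near \oo, (u m <= e%:E)%E.
Proof.
move=> u0; split.
  move=> /fine_cvgP[fu cu] e e0.
  have /cvgrPdist_le/(_ _ e0) h := cu.
  near=> m; have fm : u m \is a fin_num by near: m.
  rewrite -(fineK fm) lee_fin.
  have : `|0 - (fine \o u) m| <= e by near: m.
  by rewrite sub0r normrN ger0_norm// fine_ge0.
move=> h; apply/fine_cvgP; split.
  by apply: filterS (h 1 ltr01) => m hm; rewrite ge0_fin_numE// (le_lt_trans hm)// ltry.
apply/cvgrPdist_le => e e0; apply: filterS (h e e0) => m hm.
rewrite sub0r normrN ger0_norm ?fine_ge0// -lee_fin fineK//.
by rewrite ge0_fin_numE// (le_lt_trans hm)// ltry.
Unshelve. all: by end_near. Qed.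

End extended_real_limits.

Section vector_valued.
Context {d : measure_display} {T : measurableType d} {R : realType} {n : nat}.
Variable P : probability T R.
Implicit Types X Y : T -> 'cV[R]_n.

Definition vmeasurable X := forall j, measurable_fun setT (fun w => X w j 0).

Lemma vmeasurableB X Y : vmeasurable X -> vmeasurable Y -> vmeasurable (fun w => X w - Y w).
Proof.
by move=> mX mY j; under eq_fun do rewrite !mxE; apply: measurable_funD => //;
  apply: measurableT_comp.
Qed.

Lemma measurable_sqnorm X : vmeasurable X -> measurable_fun setT (fun w => sqnorm (X w)).
Proof. by move=> mX; rewrite /sqnorm; apply: measurable_sum => j; exact: measurable_funX. Qed.

Lemma integral_sqnorm X : vmeasurable X ->
  (\int[P]_w (sqnorm (X w))%:E = \sum_(j < n) \int[P]_w (X w j 0 ^+ 2)%:E)%E.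
Proof.
move=> mX; rewrite -ge0_integral_sum//.
- by apply: eq_integral => w _; rewrite /sqnorm sumEFin.
- by move=> j; apply: measurable_sqr.
- by move=> j w _; rewrite lee_fin sqr_ge0.
Qed.

Lemma sqnorm_integral_ge0 X : (0 <= \int[P]_w (sqnorm (X w))%:E)%E.
Proof. by apply: integral_ge0 => w _; rewrite lee_fin sqnorm_ge0. Qed.

Lemma le_integral_sqnormB X Y : vmeasurable X -> vmeasurable Y ->
  (\int[P]_w (sqnorm (X w - Y w))%:E <=
   2%:E * (\int[P]_w (sqnorm (X w))%:E + \int[P]_w (sqnorm (Y w))%:E))%E.
Proof.
move=> mX mY; have sX := measurable_sqnorm mX; have sY := measurable_sqnorm mY.
rewrite -ge0_integralD//; last 4 first.
- by move=> w _; rewrite lee_fin sqnorm_ge0.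
- exact/measurable_EFinP.
- by move=> w _; rewrite lee_fin sqnorm_ge0.
- exact/measurable_EFinP.
rewrite -ge0_integralZl//; last 2 first.
- by apply: emeasurable_funD; exact/measurable_EFinP.
- by move=> w _; rewrite -EFinD lee_fin addr_ge0 ?sqnorm_ge0.
apply: ge0_le_integral => //.
- by move=> w _; rewrite lee_fin sqnorm_ge0.
- by apply/measurable_EFinP/measurable_sqnorm/vmeasurableB.
- by apply: emeasurable_funM => //; apply: emeasurable_funD; exact/measurable_EFinP.
- by move=> w _; rewrite -EFinD -EFinM lee_fin sqnormB_le.
Qed.

Lemma ae_eq0_sqnorm X : vmeasurable X ->
  (\int[P]_w (sqnorm (X w))%:E <= 0)%E -> {ae P, forall w, X w = 0}.
Proof.
move=> mX h.
have := @ae_eq_integral_abs _ _ _ P setT measurableT (fun w => (sqnorm (X w))%:E).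
have ms : measurable_fun setT (fun w => (sqnorm (X w))%:E).
  exact/measurable_EFinP/measurable_sqnorm.
move=> /(_ ms)[+ _].
have -> : (\int[P]_w `|(sqnorm (X w))%:E| = 0)%E.
  apply/eqP; rewrite eq_le; apply/andP; split; last exact: integral_ge0.
  apply: le_trans h; rewrite le_eqVlt; apply/orP; left; apply/eqP.
  by apply: eq_integral => w _; rewrite /= ger0_norm// sqnorm_ge0.
move=> /(_ erefl); apply: filterS => w /(_ I)[]/eqP.
by rewrite sqnorm_eq0 => /eqP.
Qed.

End vector_valued.

Section extension.
Context {R : realType} {d d' : measure_display}.
Context {T : measurableType d} {T' : measurableType d'}.
Variables (P : probability T R) (P' : probability T' R) (p : T' -> T).
Hypothesis ext : prob_extension P P' p.

Lemma extension_integral (h : T -> \bar R) : measurable_fun setT h ->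
  (forall w, 0 <= h w)%E -> (\int[P']_w h (p w) = \int[P]_w h w)%E.
Proof.
move=> mh h0; have [mp pE] := ext.
have := @ge0_integral_pushforward _ _ _ _ R p mp P' setT h measurableT mh (fun w _ => h0 w).
rewrite preimage_setT => <-.
by apply: eq_measure_integral => A mA _; exact: pE.
Qed.

End extension.

(** * Vector-valued Wiener integrals *)

Section wiener_integrals.
Context {d : measure_display} {T : measurableType d} {R : realType} {n : nat}.
Variable P : probability T R.
Implicit Types (sigma : R -> 'cV[R]_n) (W : R -> T -> R).

Lemma wiener_sum_entry sigma W (t : R) m w j : 0 <= t ->
  wiener_sum sigma W t m w j 0 =
  istep W (grid_list (fun u => sigma (Num.max u 0) j 0) (wgrid t m) m) w.
Proof.
move=> t0; rewrite /wiener_sum /istep /grid_list big_map summxE.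
rewrite -[m in iota 0 m]subn0 -/(index_iota 0 m) big_mkord; apply: eq_bigr => k _ /=.
rewrite mxE mulrC /inc /wgrid max_l// mulr_ge0 ?invr_ge0// mulr_ge0//.
Qed.

Lemma vmeasurable_wiener_sum sigma W (t : R) m : 0 <= t ->
  (forall u, 0 <= u -> measurable_fun setT (W u)) ->
  vmeasurable (wiener_sum sigma W t m).
Proof.
move=> t0 mW j; rewrite /wiener_sum; under eq_fun do rewrite summxE.
apply: measurable_sum => k; under eq_fun do rewrite mxE.
apply: measurable_funM => //; apply: measurable_funB; apply: mW;
  by rewrite mulr_ge0 ?invr_ge0// mulr_ge0.
Qed.

(** A solution comes with some Wiener integral at each time; uniqueness allows it to be replaced by
    the continuous version. *)
Lemma wiener_integral_unique sigma W (t : R) I I' : 0 <= t ->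
  (forall u, 0 <= u -> measurable_fun setT (W u)) ->
  is_wiener_integral P sigma W t I -> is_wiener_integral P sigma W t I' ->
  {ae P, forall w, I w = I' w}.
Proof.
move=> t0 mW [mI cI] [mI' cI'].
suff : {ae P, forall w, I' w - I w = 0}.
  by apply: filterS => w /eqP; rewrite subr_eq0 => /eqP.
apply: ae_eq0_sqnorm; first exact: vmeasurableB.
apply/lee_addgt0Pr => e e0; rewrite add0e.
have e4 : 0 < e / 4 by rewrite divr_gt0.
have s0 J : (forall m, 0 <= \int[P]_w (sqnorm (wiener_sum sigma W t m w - J w))%:E)%E.
  by move=> m; exact: sqnorm_integral_ge0.
have h1 := (cvge0P (s0 I)).1 cI _ e4.
have h2 := (cvge0P (s0 I')).1 cI' _ e4.
have [m [m1 m2]] : exists m, (\int[P]_w (sqnorm (wiener_sum sigma W t m w - I w))%:E <= (e / 4)%:E)%E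
   /\ (\int[P]_w (sqnorm (wiener_sum sigma W t m w - I' w))%:E <= (e / 4)%:E)%E.
  by have [m _ hm] := filterI h1 h2; exists m; exact: (hm m (leqnn m)).
have mS : vmeasurable (wiener_sum sigma W t m) := @vmeasurable_wiener_sum sigma W t m t0 mW.
have := le_integral_sqnormB P (vmeasurableB mS mI) (vmeasurableB mS mI').
under eq_integral do rewrite opprB addrC subrKA.
move=> /le_trans; apply.
have -> : e%:E = (2%:E * ((e / 4)%:E + (e / 4)%:E))%E.
  by rewrite -EFinD -EFinM; congr EFin; lra.
by rewrite lee_pmul2l// leeD.
Qed.

Lemma wiener_integral_extension {d'} {T' : measurableType d'} (P' : probability T' R)
    (p : T' -> T) sigma W (t : R) I : 0 <= t ->
  (forall u, 0 <= u -> measurable_fun setT (W u)) -> prob_extension P P' p ->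
  is_wiener_integral P sigma W t I ->
  is_wiener_integral P' sigma (fun u => W u \o p) t (I \o p).
Proof.
move=> t0 mW ext [mI cI]; have [mp _] := ext; split.
  by move=> j; exact: (measurableT_comp (mI j) mp).
apply: cvg_trans cI; rewrite (_ : (fun m => _) = (fun m =>
   \int[P]_w (sqnorm (wiener_sum sigma W t m w - I w))%:E))%E; first exact: cvg_id.
apply/funext => m.
rewrite -(extension_integral ext (h := fun w => (sqnorm (wiener_sum sigma W t m w - I w))%:E))//.
- apply/measurable_EFinP/measurable_sqnorm/vmeasurableB => //.
  exact: vmeasurable_wiener_sum.
- by move=> w; rewrite lee_fin sqnorm_ge0.
Qed.

Lemma wiener_path sigma W : brownian P W -> vcontinuous (fun t : R => sigma (Num.max t 0)) ->
  exists J : R -> T -> 'cV[R]_n,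
  [/\ forall t, 0 <= t -> vmeasurable (J t),
      forall w, J 0 w = 0,
      forall w, vcontinuous (fun t : R => J (Num.max t 0) w),
      forall t, 0 <= t -> is_wiener_integral P sigma W t (J t) &
      forall t, 0 <= t -> (\int[P]_w (sqnorm (J t w))%:E <=
        (prim (fun u => 2 * (sqnorm (sigma (Num.max u 0)) + n%:R)) t)%:E)%E].
Proof.
move=> bW cs; have mW := brownian_measurable bW.
have [J hJ] := choice (fun j : 'I_n => wiener_continuous_version bW (cs j 0)).
pose JJ t w : 'cV[R]_n := \col_j J j t w.
have mJ t : 0 <= t -> vmeasurable (JJ t).
  by move=> t0 j; under eq_fun do rewrite mxE; have [h _ _ _ _] := hJ j; exact: h.
exists JJ; split=> //.
- by move=> w; apply/matrixP => i k; rewrite !mxE; have [_ -> _ _ _] := hJ i.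
- move=> w i k; rewrite (_ : (fun t => _) = fun t : R => J i (Num.max t 0) w).
    by have [_ _ h _ _] := hJ i; exact: h.
  by apply/funext => t; rewrite mxE.
- move=> t t0; split; first exact: mJ.
  apply/cvge0P; first by move=> m; exact: sqnorm_integral_ge0.
  (* Chosen so that n coordinates with error (2 e')^2 t add up to at most e; the added 1 covers t =
     0. *)
  move=> e e0; pose e' := Num.sqrt (e / (n%:R * 4 * t + 1)).
  have q0 : 0 < n%:R * 4 * t + 1 by rewrite ltr_wpDl// !mulr_ge0.
  have e'0 : 0 < e' by rewrite sqrtr_gt0 divr_gt0.
  have he : n%:R * ((2 * e') ^+ 2 * t) <= e.
    rewrite exprMn sqr_sqrtr; last by apply: divr_ge0; exact: ltW.

    have h1 : n%:R * 4 * t / (n%:R * 4 * t + 1) <= 1.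
      by rewrite ler_pdivrMr// mul1r lerDl.
    have := ler_wpM2l (ltW e0) h1; rewrite mulr1 => h2; apply: le_trans h2.
    by rewrite
 le_eqVlt; apply/orP; left; apply/eqP; move: (_ + 1)^-1 => y; ring.

  have : \forall m \near \oo, forall j : 'I_n,
      (\int[P]_w ((istep W (grid_list (fun u : R => sigma (Num.max u 0) j 0) (wgrid t m) m) w - J j t w) ^+ 2)%:E <= ((2 * e') ^+ 2 * t)%:E)%E.
    by apply: filter_forall => j; have [_ _ _ h _] := hJ j; exact: h.
  apply: filterS => m hm.
  rewrite integral_sqnorm; last by apply: vmeasurableB; [exact: vmeasurable_wiener_sum|exact: mJ].
  apply: (@le_trans _ _ (\sum_(j < n) ((2 * e') ^+ 2 * t)%:E)%E).
    apply: lee_sum => j _; apply: le_trans (hm j); rewrite le_eqVlt; apply/orP; left.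
    by apply/eqP; apply: eq_integral => w _; rewrite !mxE wiener_sum_entry.
  rewrite sumEFin lee_fin sumr_const card_ord (le_trans _ he)//.
  by rewrite [leRHS]mulr_natl.



- move=> t t0; rewrite integral_sqnorm; last exact: mJ.
  pose ph (j : 'I_n) (u : R) := 2 * (sigma (Num.max u 0) j 0 ^+ 2 + 1).
  have cph j : continuous (ph j).
    apply: continuous_scale; apply: continuousD_fun; last exact: cst_continuous.
    by move=> u; apply: (@continuous_comp _ _ _ (fun u : R => sigma (Num.max u 0) j 0) (fun x => x ^+ 2));
      [exact: cs|exact: exprn_continuous].
  have -> : prim (fun u => 2 * (sqnorm (sigma (Num.max u 0)) + n%:R)) t = \sum_(j < n) prim (ph j) t.
    have sumP (s : seq 'I_n) : prim (fun u => \sum_(j <- s) ph j u) t = \sum_(j <- s) prim (ph j) t.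
      elim: s => [|j s IH].
        under eq_fun do rewrite big_nil.
        rewrite big_nil -[RHS](mul0r (prim (fun=> 0) t)) -primZ//; last exact: cst_continuous.
        by under [in RHS]eq_fun do rewrite mul0r.
      under eq_fun do rewrite big_cons.
      rewrite big_cons primD ?IH//.
      by move=> u; apply: (@cvg_big _ _ _ _ _ add_continuous) => // i _; exact: cph.
    rewrite -sumP; congr (prim _ t); apply/funext => u.
    by rewrite /ph -mulr_sumr big_split/= sumr_const card_ord.
  rewrite -sumEFin; apply: lee_sum => j _.
  rewrite primE//; have [_ J0 _ _ h] := hJ j; have := h 0 t (lexx 0) t0.
  by under eq_integral do rewrite J0 subr0; under [X in _ -> (X <= _)%E]eq_integral do rewrite mxE.
Qed.

End wiener_integrals.

(** * Energy of the closed loop *)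

Section linear_primitives.
Context {R : realType} {n : nat}.
Implicit Types u v : R -> 'cV[R]_n.

Lemma eq_vprim u v t : 0 <= t -> (forall x, 0 <= x <= t -> u x = v x) ->
  vprim u t = vprim v t.
Proof.
by move=> t0 h; apply/matrixP => i j; rewrite !mxE; apply: eq_in_prim => // x hx; rewrite h.
Qed.

Lemma vprimD u v t : vcontinuous u -> vcontinuous v -> 0 <= t ->
  vprim (fun x => u x + v x) t = vprim u t + vprim v t.
Proof.
move=> cu cv t0; apply/matrixP => i j; rewrite !mxE -primD//.
by congr prim; apply/funext => x; rewrite mxE.
Qed.

Lemma vprimZ k u t : vcontinuous u -> 0 <= t ->
  vprim (fun x => k *: u x) t = k *: vprim u t.
Proof.
move=> cu t0; apply/matrixP => i j; rewrite !mxE -primZ//.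
by congr prim; apply/funext => x; rewrite mxE.
Qed.

Lemma vprimB u v t : vcontinuous u -> vcontinuous v -> 0 <= t ->
  vprim (fun x => u x - v x) t = vprim u t - vprim v t.
Proof.
move=> cu cv t0; rewrite vprimD//; last exact: vcontinuousN.
congr (_ + _); rewrite -scaleN1r -vprimZ//; congr vprim.
by apply/funext => x; rewrite scaleN1r.
Qed.

Lemma vprim_sum (I : Type) (s : seq I) (u : I -> R -> 'cV[R]_n) t :
  (forall i, vcontinuous (u i)) -> 0 <= t ->
  vprim (fun x => \sum_(i <- s) u i x) t = \sum_(i <- s) vprim (u i) t.
Proof.
move=> cu t0; elim: s => [|i s IH].
  under eq_fun do rewrite big_nil; rewrite big_nil.
  rewrite -[RHS](scale0r (vprim (fun=> 0) t)) -vprimZ//; last exact: vcontinuous_cst.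
  by congr vprim; apply/funext => x; rewrite scaler0.
under eq_fun do rewrite big_cons.
by rewrite big_cons vprimD ?IH//; exact: vcontinuous_sum.
Qed.

End linear_primitives.

Section additive_noise.
Context {R : realType} {n : nat}.

Lemma le_prim_energy (rho k : R) m (u : R -> 'cV[R]_n) (v : R -> 'cV[R]_m) t :
  vcontinuous u -> vcontinuous v -> 0 <= t ->
  (forall x, 0 <= x <= t -> sqnorm (u x) <= k * sqnorm (v x)) ->
  prim (energy_density rho u) t <= k * prim (energy_density rho v) t.
Proof.
move=> cu cv t0 h; have eu := continuous_energy_density rho cu.
have ev := continuous_energy_density rho cv.
rewrite -primZ//; apply: le_prim => //; first exact: continuous_scale.
by move=> x hx; rewrite /energy_density mulrCA ler_wpM2l ?expR_ge0// h.
Qed.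

Lemma prim_energyD_le (rho : R) (u v : R -> 'cV[R]_n) t :
  vcontinuous u -> vcontinuous v -> 0 <= t ->
  prim (energy_density rho (fun x => u x + v x)) t <=
  2 * (prim (energy_density rho u) t + prim (energy_density rho v) t).
Proof.
move=> cu cv t0; have eu := continuous_energy_density rho cu.
have ev := continuous_energy_density rho cv.
rewrite -primD// -primZ//; last exact: continuousD_fun.
apply: le_prim => //.
- exact/continuous_energy_density/vcontinuousD.
- by apply: continuous_scale; exact: continuousD_fun.
move=> x _; rewrite /energy_density -mulrDr mulrCA ler_wpM2l ?expR_ge0//.
exact: sqnormD_le.
Qed.

(** The noise J is merely continuous, so y need not be differentiable; y - J is, and it solves z' =
    M z + M J, an equation with input M J to which the Lyapunov estimate applies. *)
Lemma additive_noise_energy (rho : R) (M : 'M[R]_n) : hurwitz (M - (rho / 2)%:M) ->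
  exists2 K, 0 <= K & forall y J : R -> 'cV[R]_n, vcontinuous y -> vcontinuous J ->
    (forall t, 0 <= t -> y t = y 0 + vprim (fun v => M *m y v) t + J t) ->
    forall t, 0 <= t -> prim (energy_density rho y) t <=
      K * (sqnorm (y 0) + prim (energy_density rho J) t).
Proof.
move=> hM; have [H [c [ga [C hL]]]] := hurwitz_lyapunov_data hM.
have [pH [c0 ga0 C0] _] := hL.
have [KH KH0 hKH] := bform_bounded H.
have [KM KM0 hKM] := sqnorm_mulmx_le M.
exists (2 * (c^-1 * (2 * KH)) + 2 * (c^-1 * (C * KM)) + 2).
  by rewrite !addr_ge0 ?mulr_ge0 ?invr_ge0// ltW.
move=> y J cy cJ hy t t0.
have cMy : vcontinuous (fun v => M *m y v) by apply: vcontinuousM => //; exact: vcontinuous_cst.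
have cMJ : vcontinuous (fun v => M *m J v) by apply: vcontinuousM => //; exact: vcontinuous_cst.
(* Defined through the drift rather than as y - J, with which it agrees for t >= 0 only; hence the
   equation for z at positive times. *)
pose z t := y 0 + vprim (fun v => M *m y v) t.
have dz x : is_vderive z x (M *m y x).
  rewrite -[M *m y x]add0r; apply: is_vderiveD; first exact: is_vderive_cst.
  exact: is_vderive_vprim.
have cz := is_vderive_continuous dz.
have hd (x : R) : 0 < x -> M *m y x = M *m z x + M *m J x.
  by move=> x0; rewrite -mulmxDr; congr (_ *m _); exact: hy (ltW x0).
have := energy_forward_le hL cMJ dz hd t0.
have -> : z 0 = y 0 by rewrite /z vprim0 addr0.
move=> h1.
have h2 : prim (energy_density rho (fun v => M *m J v)) t <= KM * prim (energy_density rho J) t.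
  exact: le_prim_energy.
have h3 : prim (energy_density rho y) t <= 2 * (prim (energy_density rho z) t + prim (energy_density rho J) t).
  rewrite (_ : prim (energy_density rho y) t = prim (energy_density rho (fun x => z x + J x)) t).
    exact: prim_energyD_le.
  apply: eq_in_prim => // v /andP[v0 _]; rewrite /energy_density; congr (_ * sqnorm _).
  exact: hy.
have pJ : 0 <= prim (energy_density rho J) t.
  by apply: prim_ge0 => // v; exact: energy_density_ge0.
have h4 := hKH (y 0) (y 0); have s0 := sqnorm_ge0 (y 0).
have h5 : prim (energy_density rho z) t <= c^-1 * (2 * KH * sqnorm (y 0) + C * (KM * prim (energy_density rho J) t)).
  rewrite ler_pdivlMl//; apply: (le_trans h1); apply: lerD; last by rewrite ler_pM2l.
  by apply: (le_trans (ler_norm _)); apply: (le_trans h4); rewrite -mulr2n -mulr_natl; lra.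
set a := c^-1 * (2 * KH); set b := c^-1 * (C * KM).
have a0 : 0 <= a by rewrite !mulr_ge0 ?invr_ge0// ltW.
have b0 : 0 <= b by rewrite !mulr_ge0 ?invr_ge0// ltW.
have h6 : c^-1 * (2 * KH * sqnorm (y 0) + C * (KM * prim (energy_density rho J) t)) =
   a * sqnorm (y 0) + b * prim (energy_density rho J) t by rewrite /a /b; ring.
rewrite h6 in h5; apply: (le_trans h3).
have := mulr_ge0 a0 pJ; have := mulr_ge0 b0 s0; nra.
Qed.

End additive_noise.

(** * Population mean and deviations along a path *)

Section closed_loop_paths.
Context {R : realType} {n r N : nat}.
Variables (rho : R) (A G P Pi : 'M[R]_n) (B : 'M[R]_(n, r)) (Rw : 'M[R]_r).
Hypothesis N0 : (0 < N)%N.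
Variables (s xbar f : R -> 'cV[R]_n).
Hypotheses (cs : vcontinuous s) (cxbar : vcontinuous xbar) (cf : vcontinuous f).
Local Notation Abar := (A - B *m invmx Rw *m B^T *m P).

Definition mean (x : 'I_N -> 'cV[R]_n) : 'cV[R]_n := N%:R^-1 *: \sum_(i < N) x i.

Definition drift (x : 'I_N -> R -> 'cV[R]_n) (i : 'I_N) (v : R) :=
  A *m x i v + B *m control_law B Rw P Pi s xbar v (x i v) + G *m mean (x^~ v) + f v.

Let h (m : 'cV[R]_n) (v : R) :=
  G *m m - B *m invmx Rw *m B^T *m ((Pi - P) *m xbar v + s v) + f v.

(** The feedback through x_i is absorbed in Abar; the remaining term [h] is common to all agents and
    cancels in deviations from the mean. *)
Lemma driftE x i v : drift x i v = Abar *m x i v + h (mean (x^~ v)) v.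
Proof.
rewrite /drift /h /control_law mulmxN (mulmxA B) (mulmxA B (invmx Rw)).
move: (mean _) (x i v) => m y; set S := B *m invmx Rw *m B^T.
rewrite (mulmxBl A) -(mulmxA S P y) !(mulmxDr S).
move: (A *m y) (S *m (P *m y)) (S *m _) (S *m s v) (G *m m) (f v) => a b c e g k.
by apply/matrixP => i' j'; rewrite !mxE; lra.
Qed.

Variables (x J : 'I_N -> R -> 'cV[R]_n).
Hypotheses (cx : forall i, vcontinuous (x i)) (cJ : forall i, vcontinuous (J i)).
Hypothesis xE : forall i t, 0 <= t -> x i t = x i 0 + vprim (drift x i) t + J i t.
Hypothesis xbarE : forall t, 0 <= t -> xbar t = xbar 0 + vprim (fun v =>
  (A + G) *m xbar v - B *m invmx Rw *m B^T *m (Pi *m xbar v + s v) + f v) t.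

Let mx (v : R) := mean (x^~ v).
Let mJ (v : R) := mean (J^~ v).

Lemma vcontinuous_mean (y : 'I_N -> R -> 'cV[R]_n) : (forall i, vcontinuous (y i)) ->
  vcontinuous (fun v => mean (y^~ v)).
Proof. by move=> cy; apply/vcontinuousZ/vcontinuous_sum. Qed.

Let ch : vcontinuous (fun v => h (mx v) v).
Proof.
have cm := vcontinuous_mean cx.
apply: vcontinuousD => //; apply: vcontinuousB.
  by apply: vcontinuousM => //; exact: vcontinuous_cst.
apply: vcontinuousM; first exact: vcontinuous_cst.
by apply: vcontinuousD => //; apply: vcontinuousM => //; exact: vcontinuous_cst.
Qed.

Let cAx (M : 'M[R]_n) (u : R -> 'cV[R]_n) : vcontinuous u -> vcontinuous (fun v => M *m u v).
Proof. by move=> cu; apply: vcontinuousM => //; exact: vcontinuous_cst. Qed.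

Let cdrift i : vcontinuous (drift x i).
Proof.
have -> : drift x i = fun v => Abar *m x i v + h (mx v) v by apply/funext => v; exact: driftE.
by apply: vcontinuousD => //; exact: cAx.
Qed.

Lemma mean_driftE v : mean (fun i => drift x i v) = Abar *m mx v + h (mx v) v.
Proof.
rewrite /mean; under eq_bigr do rewrite driftE.
rewrite big_split/= sumr_const card_ord scalerDr -mulmx_sumr -scalerMnr scalerMnl.
by rewrite -(mulr_natr N%:R^-1) mulVf ?pnatr_eq0 -?lt0n// scale1r scalemxAr.
Qed.

Lemma mean_path t : 0 <= t ->
  mx t = mx 0 + vprim (fun v => Abar *m mx v + h (mx v) v) t + mJ t.
Proof.
move=> t0; rewrite /mx /mJ /mean; under eq_bigr do rewrite xE//.
rewrite !big_split/= !scalerDr; congr (_ + _ + _).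
rewrite -vprim_sum// -vprimZ//; last exact: vcontinuous_sum.
by congr vprim; apply/funext => v; rewrite -mean_driftE.
Qed.

Lemma deviation_path i t : 0 <= t -> x i t - mx t = (x i 0 - mx 0) +
  vprim (fun v => Abar *m (x i v - mx v)) t + (J i t - mJ t).
Proof.
move=> t0; rewrite [in LHS]mean_path// [in LHS](xE i t0).
have -> : vprim (fun v => Abar *m (x i v - mx v)) t =
    vprim (drift x i) t - vprim (fun v => Abar *m mx v + h (mx v) v) t.
  rewrite -vprimB//; last by apply: vcontinuousD => //; apply: cAx; exact: vcontinuous_mean.
  congr vprim; apply/funext => v; rewrite driftE mulmxBr.
  move: (h _ _) (Abar *m x i v) (Abar *m mx v) => a b c.
  by apply/matrixP => i' j'; rewrite !mxE; lra.
move: (x i 0) (vprim _ t) (mx 0) (vprim _ t) (J i t) (mJ t) => a b c e g k.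
by apply/matrixP => i' j'; rewrite !mxE; lra.
Qed.

(** The feedback acts on the population mean through P and on xbar through Pi - P, whereas the
    equation of xbar contains Pi; the difference is P applied to the error, and s and f cancel. *)
Lemma mean_error_path t : 0 <= t -> mx t - xbar t = (mx 0 - xbar 0) +
  vprim (fun v => (Abar + G) *m (mx v - xbar v)) t + mJ t.
Proof.
move=> t0; rewrite [in LHS]mean_path// [in LHS](xbarE t0).
have -> : vprim (fun v => (Abar + G) *m (mx v - xbar v)) t =
    vprim (fun v => Abar *m mx v + h (mx v) v) t - vprim (fun v =>
  (A + G) *m xbar v - B *m invmx Rw *m B^T *m (Pi *m xbar v + s v) + f v) t.
  rewrite -vprimB//; last 2 first.
  - by apply: vcontinuousD => //; apply: cAx; exact: vcontinuous_mean.
  - apply: vcontinuousD => //; apply: vcontinuousB; first exact: cAx.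
    apply: vcontinuousM; first exact: vcontinuous_cst.
    by apply: vcontinuousD => //; exact: cAx.
  congr vprim; apply/funext => v; rewrite /h; move: (mx v) (xbar v) (s v) (f v) => m y z k.
  set S := B *m invmx Rw *m B^T.
  rewrite !mulmxBr !mulmxDl !mulNmx !(mulmxDr S) !mulmxN -(mulmxA S P m) -(mulmxA S P y).
  move: (A *m m) (A *m y) (S *m (P *m m)) (S *m (P *m y)) (G *m m) (G *m y) (S *m (Pi *m y)) (S *m z) => a1 a2 a3 a4 a5 a6 a7 a8.
  by apply/matrixP => i' j'; rewrite !mxE; lra.
move: (mx 0) (vprim _ t) (xbar 0) (vprim _ t) (mJ t) => a b c e g.
by apply/matrixP => i' j'; rewrite !mxE; lra.
Qed.

End closed_loop_paths.

Section closed_loop_energy.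
Context {R : realType} {n r N : nat}.

Lemma prim_sum (I : Type) (l : seq I) (u : I -> R -> R) t : (forall i, continuous (u i)) ->
  0 <= t -> prim (fun v => \sum_(i <- l) u i v) t = \sum_(i <- l) prim (u i) t.
Proof.
move=> cu t0; elim: l => [|i l IH].
  under eq_fun do rewrite big_nil.
  rewrite big_nil -[RHS](mul0r (prim (fun=> 0) t)) -primZ//; last exact: cst_continuous.
  by under [in RHS]eq_fun do rewrite mul0r.
under eq_fun do rewrite big_cons.
rewrite big_cons primD ?IH//.
by move=> v; apply: (@cvg_big _ _ _ _ _ add_continuous) => // j _; exact: cu.
Qed.

Definition mean_const : R := N%:R^-1 ^+ 2 * 2 ^+ size (index_enum 'I_N).

Lemma mean_const_ge0 : 0 <= mean_const.
Proof. by rewrite mulr_ge0 ?exprn_ge0 ?invr_ge0. Qed.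

Lemma sqnorm_mean_le (y : 'I_N -> 'cV[R]_n) :
  sqnorm (mean y) <= mean_const * \sum_j sqnorm (y j).
Proof.
rewrite /mean /mean_const sqnormZ -[leRHS]mulrA ler_wpM2l ?exprn_ge0 ?invr_ge0//.
exact: sqnorm_sum_le.
Qed.

Lemma prim_energy_mean_le rho (y : 'I_N -> R -> 'cV[R]_n) t : (forall i, vcontinuous (y i)) ->
  0 <= t -> prim (energy_density rho (fun v => mean (y^~ v))) t <=
    mean_const * \sum_j prim (energy_density rho (y j)) t.
Proof.
move=> cy t0; have ce j := continuous_energy_density rho (cy j).
rewrite -prim_sum// -primZ//; last first.
  by move=> v; apply: (@cvg_big _ _ _ _ _ add_continuous) => // j _; exact: ce.
apply: le_prim => //.
- exact/continuous_energy_density/vcontinuous_mean.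
- apply: continuous_scale.
  by move=> v; apply: (@cvg_big _ _ _ _ _ add_continuous) => // j _; exact: ce.
move=> v _; rewrite /energy_density -mulr_sumr mulrCA ler_wpM2l ?expR_ge0//.
exact: sqnorm_mean_le.
Qed.

Lemma prim_energyN rho m (u : R -> 'cV[R]_m) t :
  prim (energy_density rho (fun v => - u v)) t = prim (energy_density rho u) t.
Proof. by congr prim; apply/funext => v; rewrite /energy_density sqnormN. Qed.

Lemma prim_energyM_le (rho : R) m (M : 'M[R]_(m, n)) : exists2 K, 0 <= K &
  forall (u : R -> 'cV[R]_n) t, vcontinuous u -> 0 <= t ->
  prim (energy_density rho (fun v => M *m u v)) t <= K * prim (energy_density rho u) t.
Proof.
have [K K0 hK] := sqnorm_mulmx_le M; exists K; first exact: ltW.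
move=> u t cu t0; apply: le_prim_energy => //.
by apply: vcontinuousM => //; exact: vcontinuous_cst.
Qed.

(** The decomposition x_i = (x_i - mean) + (mean - xbar) + xbar reduces the bound to
    [additive_noise_energy] for Abar and Abar + G. The constant K is chosen before the paths, and
    the bound is linear in the initial squares and noise energies, so that expectations can be taken
    afterwards. *)
Lemma closed_loop_energy (rho : R) (A G P Pi : 'M[R]_n) (B : 'M[R]_(n, r)) (Rw : 'M[R]_r)
    (s xbar f : R -> 'cV[R]_n) :
  (0 < N)%N -> vcontinuous s -> vcontinuous xbar -> vcontinuous f ->
  L2rho rho s -> L2rho rho xbar ->
  hurwitz (A - B *m invmx Rw *m B^T *m P - (rho / 2)%:M) ->
  hurwitz (A - B *m invmx Rw *m B^T *m P + G - (rho / 2)%:M) ->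
  (forall t, 0 <= t -> xbar t = xbar 0 + vprim (fun v =>
    (A + G) *m xbar v - B *m invmx Rw *m B^T *m (Pi *m xbar v + s v) + f v) t) ->
  exists2 K, 0 <= K & forall x J : 'I_N -> R -> 'cV[R]_n,
    (forall i, vcontinuous (x i)) -> (forall i, vcontinuous (J i)) ->
    (forall i t, 0 <= t -> x i t = x i 0 + vprim (drift A G P Pi B Rw s xbar f x i) t + J i t) ->
    forall i t, 0 <= t ->
    prim (fun v => expR (- rho * v) *
      (sqnorm (x i v) + sqnorm (control_law B Rw P Pi s xbar v (x i v)))) t <=
    K * (1 + \sum_j sqnorm (x j 0) + \sum_j prim (energy_density rho (J j)) t).
Proof.
move=> N0 cs cX cf /(L2rhoP _ cs)[LS hLS] /(L2rhoP _ cX)[LX hLX] h1 h2 hX.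
have LS0 : 0 <= LS by have := hLS 0 (lexx 0); rewrite prim0.
have LX0 : 0 <= LX by have := hLX 0 (lexx 0); rewrite prim0.
have [K1 K10 hK1] := additive_noise_energy h1.
have [K2 K20 hK2] := additive_noise_energy h2.
have [KU KU0 hKU] := prim_energyM_le rho (invmx Rw *m B^T).
have [KP KP0 hKP] := prim_energyM_le rho P.
have [KD KD0 hKD] := prim_energyM_le rho (Pi - P).
have ca0 := mean_const_ge0; set ca := mean_const in ca0.
set X0 := sqnorm (xbar 0); have X00 : 0 <= X0 := sqnorm_ge0 _.
(* These constants collect the factors 2 from squaring sums; the summand 1 in the final bound
   absorbs the contributions of xbar and s. *)
pose Ke := K1 * (4 * (1 + ca)); pose Ky := K2 * (3 * ca + 2 * X0).
have Ke0 : 0 <= Ke by rewrite mulr_ge0// mulr_ge0// addr_ge0.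
have Ky0 : 0 <= Ky by rewrite mulr_ge0// addr_ge0 ?mulr_ge0.
pose Kx := 2 * (2 * (Ke + Ky) + LX).
have Kx0 : 0 <= Kx by rewrite !(mulr_ge0, addr_ge0).
pose Ku := KU * (2 * (2 * (KP * Kx + KD * LX) + LS)).
have Ku0 : 0 <= Ku by rewrite !(mulr_ge0, addr_ge0).
exists (Kx + Ku); first exact: addr_ge0.
move=> x J cx cJ hx i t t0.
set Sx := \sum_j _; set SJ := \sum_j _; set D := 1 + Sx + SJ.
have Sx0 : 0 <= Sx by apply: sumr_ge0 => j _; exact: sqnorm_ge0.
have pe m (u : R -> 'cV[R]_m) : 0 <= prim (energy_density rho u) t.
  by apply: prim_ge0 => // v; exact: energy_density_ge0.
have SJ0 : 0 <= SJ by apply: sumr_ge0 => j _.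
have leSx : sqnorm (x i 0) <= Sx.
  by rewrite /Sx (bigD1 i)//= lerDl; apply: sumr_ge0 => j _; exact: sqnorm_ge0.
have leSJ : prim (energy_density rho (J i)) t <= SJ.
  by rewrite /SJ (bigD1 i)//= lerDl; apply: sumr_ge0.
have D1 : 1 <= D by rewrite /D; lra.
have D0 : 0 <= D by lra.
pose m v := mean (x^~ v); pose mJ v := mean (J^~ v).
have cm : vcontinuous m := vcontinuous_mean cx.
have cmJ : vcontinuous mJ := vcontinuous_mean cJ.
have hm0 : sqnorm (m 0) <= ca * Sx := sqnorm_mean_le _.
have hmJ : prim (energy_density rho mJ) t <= ca * SJ := prim_energy_mean_le rho cJ t0.
have Ee : prim (energy_density rho (fun v => x i v - m v)) t <= Ke * D.
  apply: (le_trans (hK1 _ (fun v => J i v - mJ v) _ _ _ _ t0)).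
  - exact: vcontinuousB.
  - exact: vcontinuousB.
  - by move=> v v0; exact: (deviation_path N0 cs cX cf cx hx i v0).
  rewrite /Ke -mulrA ler_wpM2l//.
  have := sqnormB_le (x i 0) (m 0).
  have := prim_energyD_le rho (cJ i) (vcontinuousN cmJ) t0; rewrite prim_energyN.
  have := mulr_ge0 ca0 SJ0; have := mulr_ge0 ca0 Sx0; rewrite /D; lra.

have Ey : prim (energy_density rho (fun v => m v - xbar v)) t <= Ky * D.
  apply: (le_trans (hK2 _ mJ _ _ _ _ t0)) => //.
  - exact: vcontinuousB.
  - by move=> v v0; exact: (mean_error_path N0 cs cX cf cx hx hX v0).

  rewrite /Ky -mulrA ler_wpM2l//.
  have := sqnormB_le (m 0) (xbar 0); rewrite -/X0.
  have : X0 * 1 <= X0 * D by rewrite ler_wpM2l.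
  have : ca * Sx + ca * SJ <= ca * D by rewrite -mulrDr ler_wpM2l// /D; lra.
  have := mulr_ge0 ca0 SJ0; have := mulr_ge0 ca0 Sx0; lra.
have LXD : LX * 1 <= LX * D by rewrite ler_wpM2l.
have LSD : LS * 1 <= LS * D by rewrite ler_wpM2l.
have Ex : prim (energy_density rho (x i)) t <= Kx * D.
  have -> : x i = fun v => ((x i v - m v) + (m v - xbar v)) + xbar v.
    by apply/funext => v; rewrite subrKA subrK.
  apply: (le_trans (prim_energyD_le rho _ cX t0)).
    by apply: vcontinuousD; exact: vcontinuousB.
  have := prim_energyD_le rho (vcontinuousB (cx i) cm) (vcontinuousB cm cX) t0.
  have := hLX t t0; rewrite /Kx; lra.
have cPx : vcontinuous (fun v => P *m x i v) by apply: vcontinuousM => //; exact: vcontinuous_cst.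
have cDx : vcontinuous (fun v => (Pi - P) *m xbar v) by apply: vcontinuousM => //; exact: vcontinuous_cst.
have cw : vcontinuous (fun v => P *m x i v + (Pi - P) *m xbar v + s v).
  by apply: vcontinuousD => //; exact: vcontinuousD.
have Eu : prim (energy_density rho (fun v => control_law B Rw P Pi s xbar v (x i v))) t <= Ku * D.
  rewrite /control_law prim_energyN.
  apply: (le_trans (hKU _ _ cw t0)); rewrite /Ku -mulrA ler_wpM2l//.
  apply: (le_trans (prim_energyD_le rho (vcontinuousD cPx cDx) cs t0)).
  have := prim_energyD_le rho cPx cDx t0.
  have := hKP _ _ (cx i) t0; have := hKD _ _ cX t0.
  have := ler_wpM2l KP0 Ex; have := ler_wpM2l KD0 (hLX t t0); have := ler_wpM2l KD0 LXD.
  have := hLS t t0; lra.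
rewrite mulrDl.
have cu : vcontinuous (fun v => control_law B Rw P Pi s xbar v (x i v)).
  by apply/vcontinuousN; apply: vcontinuousM => //; exact: vcontinuous_cst.
have -> : (fun v => expR (- rho * v) *
      (sqnorm (x i v) + sqnorm (control_law B Rw P Pi s xbar v (x i v)))) =
   fun v => energy_density rho (x i) v + energy_density rho (fun v => control_law B Rw P Pi s xbar v (x i v)) v.
  by apply/funext => v; rewrite /energy_density mulrDr.
rewrite primD//; [exact: lerD| |]; exact: continuous_energy_density.
Qed.

End closed_loop_energy.

Section half_line.
Context {R : realType}.
Local Notation mu := (@lebesgue_measure R).

Lemma half_line_integral_le (f : R -> R) (C : \bar R) : continuous f -> (forall v, 0 <= f v) ->
  (forall t, 0 <= t -> ((prim f t)%:E <= C)%E) ->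
  (\int[mu]_(t in `[0%R, +oo[) (f t)%:E <= C)%E.
Proof.
move=> cf f0 h.
have mf : measurable_fun setT f by exact: continuous_measurable_fun.
rewrite (@ge0_integral_ereal_sup _ mu _ f0 mf).
by apply: ge_ereal_sup => _ [m _ <-]; rewrite integral_prim// h.
Qed.

Lemma prim_le_half_line (f : R -> R) t : continuous f -> (forall v, 0 <= f v) -> 0 <= t ->
  ((prim f t)%:E <= \int[mu]_(t in `[0%R, +oo[) (f t)%:E)%E.
Proof.
move=> cf f0 t0; rewrite -integral_prim//.
have mf : measurable_fun setT f by exact: continuous_measurable_fun.
apply: ge0_subset_integral => //=.
- by apply/measurable_EFinP; exact: measurable_funTS.
- by move=> v _; rewrite lee_fin.
- exact: subset_itvl.
Qed.

(** Integration by parts against exp(- rho v), with a boundary term of favourable sign. With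
    [prim ph] bounding the variance of the noise, it makes this variance integrable after
    discounting. *)
Lemma discounted_prim_le (rho : R) (ph : R -> R) t : 0 < rho -> continuous ph ->
  (forall v, 0 <= ph v) -> 0 <= t ->
  rho * prim (fun v => expR (- rho * v) * prim ph v) t <= prim (fun v => expR (- rho * v) * ph v) t.
Proof.
move=> rho0 cph ph0 t0.
have cG := continuous_prim cph; have ce := @continuous_expRZ R (- rho).
have ceG : continuous (fun v => expR (- rho * v) * prim ph v) by exact: continuousM_fun.
have cep : continuous (fun v => expR (- rho * v) * ph v) by exact: continuousM_fun.
pose F t := rho * prim (fun v => expR (- rho * v) * prim ph v) t
  + (expR (- rho * t) * prim ph t - prim (fun v => expR (- rho * v) * ph v) t).
have dF (x : R) : is_derive x 1 F (rho * (expR (- rho * x) * prim ph x) +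
   ((- rho * expR (- rho * x)) * prim ph x + expR (- rho * x) * ph x - expR (- rho * x) * ph x)).
  apply: is_deriveD.
    have := is_derive_mul (is_derive_cst rho x 1) (is_derive_prim x ceG).
    by rewrite mul0r add0r.
  apply: is_deriveB; last exact: is_derive_prim.
  exact: is_derive_mul (is_derive_expRZ _ _) (is_derive_prim _ _).
have : F t <= F 0 by apply: (le_is_derive dF) => // x _; rewrite addrK mulrA; lra.
rewrite /F !prim0 !mulr0 subr0 addr0.
have := mulr_ge0 (expR_ge0 (- rho * t)) (prim_ge0 ph0 t0); lra.
Qed.

(** Almost sure equalities can be collected over countably many times; the dyadic ones are dense in
    the half-line. *)
Lemma eq0_dyadic (F : R -> R) : continuous F -> (forall m k, F (dyadic m k) = 0) ->
  forall t, 0 <= t -> F t = 0.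
Proof.
move=> cF hF t t0; apply/eqP; apply: contraT => Ft.
have /cvgrPdist_lt/(_ `|F t|) := cF t.
rewrite normr_gt0 => /(_ Ft)/nbhs_ballP[dl/= dl0 hdl].
have p2 m : 0 < (2 : R) ^+ m by rewrite exprn_gt0.
pose m := (Num.truncn (1 / dl)).+1.
have dm : 2 ^- m < dl.
  rewrite -[X in X < _]mul1r ltr_pdivrMr// mulrC -ltr_pdivrMr//.
  by rewrite (lt_trans (truncnS_gt _))// -natrX ltr_nat ltn_expl.
pose k := Num.truncn (t * 2 ^+ m).
have /truncn_itv/andP[k1 k2] : 0 <= t * 2 ^+ m by rewrite mulr_ge0// ltW.
rewrite -/k in k1 k2.
have := hdl (dyadic m k); rewrite /= hF subr0 ltxx; apply.
have h1 : dyadic m k <= t by rewrite /dyadic ler_pdivrMr.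
have h2 : t < dyadic m k.+1 by rewrite /dyadic ltr_pdivlMr.
rewrite /ball/= ger0_norm ?subr_ge0//.
have : dyadic m k.+1 - dyadic m k = 2 ^- m :> R.
  by rewrite /dyadic -mulrBl -natr1 [_ + 1]addrC addrK mul1r.
lra.
Qed.

End half_line.

(** * Discounted energy of the noise *)

Section wiener_energy.
Context {d : measure_display} {T : measurableType d} {R : realType} {n : nat}.
Variables (P : probability T R) (rho : R) (sigma : R -> 'cV[R]_n) (J : R -> T -> 'cV[R]_n).
Local Notation mu := (@lebesgue_measure R).
Hypotheses (rho0 : 0 < rho) (cs : vcontinuous (fun t : R => sigma (Num.max t 0))).
Hypothesis Ls : L2rho rho sigma.
Hypotheses (mJ : forall t, 0 <= t -> vmeasurable (J t))
  (cJ : forall w, vcontinuous (fun t : R => J (Num.max t 0) w))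
  (EJ : forall t, 0 <= t -> (\int[P]_w (sqnorm (J t w))%:E <=
        (prim (fun u => 2 * (sqnorm (sigma (Num.max u 0)) + n%:R)) t)%:E)%E).

Let h t w := expR (- rho * t) * sqnorm (J t w).

Let mh t : 0 <= t -> measurable_fun setT (h t).
Proof. by move=> t0; apply: measurable_funM => //; apply: measurable_sqnorm; exact: mJ. Qed.

Let ch w : continuous (fun t : R => h (Num.max t 0) w).
Proof.
have -> : (fun t : R => h (Num.max t 0) w) =
  fun t => expR (- rho * Num.max t 0) * sqnorm (J (Num.max t 0) w) by [].
apply: continuousM_fun; last exact: vcontinuous_sqnorm.
apply: (@continuous_clip R _ (fun t => expR (- rho * t))).
by apply: continuous_subspaceT; exact: continuous_expRZ.
Qed.

Let h0 t w : 0 <= h t w.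
Proof. by rewrite mulr_ge0 ?expR_ge0 ?sqnorm_ge0. Qed.

Lemma measurable_path_energy :
  measurable_fun setT (fun w => \int[mu]_(t in `[0%R, +oo[) (energy_density rho (J^~ w) t)%:E)%E.
Proof. exact: (measurable_path_integral mh ch h0). Qed.

(** Tonelli's theorem moves the expectation inside, where the variance bound [EJ] and
    [discounted_prim_le] apply. *)
Lemma wiener_path_energy :
  (\int[P]_w \int[mu]_(t in `[0%R, +oo[) (energy_density rho (J^~ w) t)%:E < +oo)%E.
Proof.
rewrite (tonelli_path_integral P mh ch h0).
pose ph u := 2 * (sqnorm (sigma (Num.max u 0)) + n%:R).
have cph : continuous ph.
  apply: continuous_scale; apply: continuousD_fun; last exact: cst_continuous.
  exact: vcontinuous_sqnorm.
have ph0 u : 0 <= ph u by rewrite mulr_ge0// addr_ge0// sqnorm_ge0.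
have cG := continuous_prim cph; have ce := @continuous_expRZ R (- rho).
have /(L2rhoP _ cs)[K1 hK1] := L2rho_clip Ls.
(* A constant vector of squared norm n: the additive n in [EJ] becomes a constant input, covered by
   [L2rho_cst]. *)
pose one : 'cV[R]_n := const_mx 1.
have /(L2rhoP _ (@vcontinuous_cst R n 1 one))[K2 hK2] := L2rho_cst one rho0.
have one_n : sqnorm one = n%:R.
  by rewrite /sqnorm; under eq_bigr do rewrite mxE expr1n; rewrite sumr_const card_ord.
pose f (t : R) := expR (- rho * Num.max t 0) * prim ph (Num.max t 0).
have cf : continuous f.
  apply: (@continuous_clip R _ (fun t => expR (- rho * t) * prim ph t)).
  by apply: continuous_subspaceT; exact: continuousM_fun.
have f0 v : 0 <= f v by rewrite mulr_ge0 ?expR_ge0// prim_ge0// le_max lexx orbT.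
apply: (@le_lt_trans _ _ (\int[mu]_(t in `[0%R, +oo[) (f t)%:E)%E).
  apply: ge0_le_integral => //.
  - by move=> t _; apply: integral_ge0 => w _; rewrite lee_fin h0.
  - exact: (measurable_path_moment P mh ch h0).
  - by apply/measurable_EFinP; apply: measurable_funTS; exact: continuous_measurable_fun.
  move=> t; rewrite /= in_itv/= andbT => t0; rewrite /f (max_idPl t0) /h.
  under eq_integral do rewrite EFinM.
  have msq : measurable_fun setT (fun w => (sqnorm (J t w))%:E).
    by apply/measurable_EFinP; apply: measurable_sqnorm; exact: mJ.
  have sq0 w : (0 <= (sqnorm (J t w))%:E)%E by rewrite lee_fin sqnorm_ge0.
  rewrite ge0_integralZl ?lee_fin ?expR_ge0//.
  by rewrite EFinM
 lee_wpmul2l ?lee_fin ?expR_ge0//; exact: EJ.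
apply: (@le_lt_trans _ _ (rho^-1 * (2 * (K1 + K2)))%:E); last exact: ltry.
apply: half_line_integral_le => // t t0; rewrite lee_fin ler_pdivlMl//.
have -> : prim f t = prim (fun v => expR (- rho * v) * prim ph v) t.
  by apply: eq_in_prim => // v /andP[v0 _]; rewrite /f (max_idPl v0).
apply: (le_trans (discounted_prim_le rho0 cph ph0 t0)).
have e1 := continuous_energy_density rho cs.
have e2 := continuous_energy_density rho (@vcontinuous_cst R n 1 one).
have -> : (fun v => expR (- rho * v) * ph v) = fun v =>
    2 * (energy_density rho (fun t : R => sigma (Num.max t 0)) v + energy_density rho (fun=> one) v).
  by apply/funext => v; rewrite /ph /energy_density one_n; ring.
rewrite primZ//; last exact: continuousD_fun.
by rewrite primD// ler_pM2l// lerD// ?hK1// hK2.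
Qed.

End wiener_energy.

Section clipped_mean_field.
Context {R : realType} {n r : nat}.

Lemma within_vderive_vprim (u du : R -> 'cV[R]_n) :
  {within `[0, +oo[, continuous u} -> vcontinuous du ->
  (forall t, 0 < t -> derivable u t 1 /\ derive1 u t = du t) ->
  forall t, 0 <= t -> u t = u 0 + vprim du t.
Proof.
move=> cu cdu hu t t0; apply/matrixP => i j; rewrite !mxE (ord1 j).
have ccu : vcontinuous (fun t : R => u (Num.max t 0)) by exact: vcontinuous_clip cu.
have := @eq_prim R (fun t : R => u (Num.max t 0) i 0) (fun t => du t i 0)
  (ccu i 0) (cdu i 0) _ t t0.

rewrite (max_idPl t0) maxxx; apply=> x x0.
have [d e] := hu x x0; have := derivable_is_vderive d i 0; rewrite e.
apply: near_eq_is_derive.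
by apply: filterS (lt_nbhsr x0) => y y0; rewrite max_l// ltW.
Qed.


End clipped_mean_field.

(** * From path estimates to expected energy *)

Section closed_loop_expectation.
Context {R : realType} {n r N : nat}.
Variables (rho : R) (A G P Pi : 'M[R]_n) (B : 'M[R]_(n, r)) (Rw : 'M[R]_r).
Variables (x0 : 'cV[R]_n) (s xbar f sigma : R -> 'cV[R]_n).
Hypotheses (N0 : (0 < N)%N) (rho0 : 0 < rho).
Hypotheses (hs : C_half rho s) (hX : C_half rho xbar) (hf : C_half rho f)
  (hsigma : C_half rho sigma).
Hypothesis mfe : mean_field_eq A G B Rw f Pi s x0 xbar.
Hypothesis h1 : hurwitz (A - B *m invmx Rw *m B^T *m P - (rho / 2)%:M).
Hypothesis h2 : hurwitz (A - B *m invmx Rw *m B^T *m P + G - (rho / 2)%:M).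
Context {d d' : measure_display} {T : measurableType d} {T' : measurableType d'}.
Variables (Pr : probability T R) (Pr' : probability T' R) (p : T' -> T).
Variables (W : 'I_N -> R -> T -> R) (x : 'I_N -> R -> T' -> 'cV[R]_n).
Hypothesis bW : forall i, brownian Pr (W i).
Hypothesis ext : prob_extension Pr Pr' p.
Let u := control_law B Rw P Pi s xbar.
Hypothesis cl : closed_loop A G B f sigma Pr' (fun i t => W i t \o p) u x.
Local Notation mu := (@lebesgue_measure R).

Let cp (g : R -> 'cV[R]_n) (t : R) := g (Num.max t 0).
Let ccp (g : R -> 'cV[R]_n) : {within `[0, +oo[, continuous g} -> vcontinuous (cp g).
Proof. exact: vcontinuous_clip. Qed.

Let xp (w : T') (i : 'I_N) (t : R) := x i (Num.max t 0) w.

Let cxp w i : vcontinuous (xp w i).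
Proof. by have [_ h _] := cl i; exact: vcontinuous_clip (h w). Qed.

Let dr := @drift R n r N A G P Pi B Rw (cp s) (cp xbar) (cp f).

Let cdr w i : vcontinuous (dr (xp w) i).
Proof.
have cs := ccp hs.1; have cX := ccp hX.1; have cf := ccp hf.1.
have cM m (M : 'M[R]_(m, n)) (v : R -> 'cV[R]_n) : vcontinuous v -> vcontinuous (fun t => M *m v t).
  by move=> cv; apply: vcontinuousM => //; exact: vcontinuous_cst.
apply: vcontinuousD => //; apply: vcontinuousD; last first.
  by apply: cM; apply: vcontinuous_mean => j; exact: cxp.
apply: vcontinuousD; first exact: cM.
apply: vcontinuousM; first exact: vcontinuous_cst.
apply: vcontinuousN; apply: vcontinuousM; first exact: vcontinuous_cst.
by apply: vcontinuousD => //; apply: vcontinuousD; exact: cM.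
Qed.

(** For each fixed time the equation holds outside a null set depending on that time. Dyadic times
    leave one null set, and both sides are continuous. *)
Lemma closed_loop_path (J : 'I_N -> R -> T -> 'cV[R]_n) :
  (forall i t, 0 <= t -> is_wiener_integral Pr sigma (W i) t (J i t)) ->
  (forall i w, vcontinuous (fun t : R => J i (Num.max t 0) w)) ->
  {ae Pr', forall w, forall i t, 0 <= t ->
    xp w i t = xp w i 0 + vprim (dr (xp w) i) t + J i (Num.max t 0) (p w)}.
Proof.
move=> hJ cJ; apply: filter_forall => i.
have key t : 0 <= t -> {ae Pr', forall w,
    xp w i t = xp w i 0 + vprim (dr (xp w) i) t + J i (Num.max t 0) (p w)}.
  move=> t0; have [_ _ /(_ t t0)[I [hI hae]]] := cl i.
  have mW v : 0 <= v -> measurable_fun setT (W i v) by exact: brownian_measurable.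
  have hJ' := wiener_integral_extension t0 mW ext (hJ i t t0).
  have mW' v : 0 <= v -> measurable_fun setT (W i v \o p).
    by move=> v0; apply: measurableT_comp (mW v v0) _; exact: ext.1.
  have := wiener_integral_unique t0 mW' hI hJ'.
  apply: filterS2 hae => w hw hIJ; apply/matrixP => j k; rewrite (ord1 k) !mxE.
  rewrite /xp (max_idPl t0) maxxx hw hIJ/=; congr (_ + _ + _).
  rewrite primE//; apply: eq_Rintegral => v; rewrite inE/= in_itv/= => /andP[v0 _].
  by rewrite /dr /drift /control_law /cp /u /control_law /average /mean /xp !(max_idPl v0).
have : {ae Pr', forall w, forall m k, xp w i (dyadic m k) =
    xp w i 0 + vprim (dr (xp w) i) (dyadic m k) + J i (Num.max (dyadic m k) 0) (p w)}.
  apply/ae_foralln => m; apply/ae_foralln => k; apply: key.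
  by rewrite /dyadic divr_ge0// exprn_ge0.
apply: filterS => w hw t t0; apply/eqP; rewrite -subr_eq0; apply/eqP.
apply/matrixP => j k; rewrite (ord1 k).
pose F t := xp w i t - (xp w i 0 + vprim (dr (xp w) i) t + J i (Num.max t 0) (p w)).
have cF : vcontinuous F.
  apply: vcontinuousB => //; apply: vcontinuousD => //; apply: vcontinuousD.
    exact: vcontinuous_cst.
  exact: vcontinuous_vprim.
rewrite [RHS]mxE; apply: (eq0_dyadic (cF j 0)) => // m l.
by rewrite /F hw subrr mxE.
Qed.

Lemma closed_loop_finite_energy :
  (forall i j, measurable_fun setT (fun w => x i 0 w j 0)) ->
  (forall i, \int[Pr']_w (sqnorm (x i 0 w))%:E < +oo)%E ->
  (total_energy rho Pr' u x < +oo)%E.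
Proof.
move=> mx0 Ex0.
have cs := ccp hs.1; have cX := ccp hX.1; have cf := ccp hf.1; have csg := ccp hsigma.1.
have Ls := L2rho_clip hs.2; have LX := L2rho_clip hX.2.
have hJ0 i := wiener_path (bW i) csg.
have [J hJ] := choice hJ0.
have hXE t : 0 <= t -> cp xbar t = cp xbar 0 + vprim (fun v =>
    (A + G) *m cp xbar v - B *m invmx Rw *m B^T *m (Pi *m cp xbar v + cp s v) + cp f v) t.
  move=> t0; rewrite /cp (max_idPl t0) maxxx.
  apply: within_vderive_vprim => //; first exact: hX.1.
    apply: vcontinuousD => //; apply: vcontinuousB.
      by apply: vcontinuousM => //; exact: vcontinuous_cst.
    apply: vcontinuousM; first exact: vcontinuous_cst.
    by apply: vcontinuousD => //; apply: vcontinuousM => //; exact: vcontinuous_cst.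
  by move=> v v0; rewrite (max_idPl (ltW v0)); exact: mfe.2.
have [K K0 hK] := @closed_loop_energy R n r N rho A G P Pi B Rw _ _ _ N0 cs cX cf Ls LX h1 h2 hXE.
have mJ i t : 0 <= t -> vmeasurable (J i t) by have [h _ _ _ _] := hJ i; exact: h.
have cJ i w : vcontinuous (fun t : R => J i (Num.max t 0) w).
  by have [_ _ h _ _] := hJ i; exact: h.
have hpath := closed_loop_path (fun i => let: And5 _ _ _ h _ := hJ i in h) cJ.
have mp : measurable_fun setT p := ext.1.
pose EJ j w := (\int[mu]_(t in `[0%R, +oo[) (energy_density rho ((J j)^~ w) t)%:E)%E.
have mEJ j : measurable_fun setT (EJ j) by exact: (measurable_path_energy rho (mJ j) (cJ j)).
have EJ0 j w : (0 <= EJ j w)%E.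
  by apply: integral_ge0 => t _; rewrite lee_fin energy_density_ge0.
have EJfin j : (\int[Pr]_w EJ j w < +oo)%E.
  by apply: (wiener_path_energy rho0 csg hsigma.2 (mJ j) (cJ j)); have [_ _ _ _ h] := hJ j.
(* The random majorant, with finite mean and independent of the time and of the agent. *)
pose Z w : \bar R := (1 + \sum_j (sqnorm (x j 0 w))%:E + \sum_j EJ j (p w))%E.
have msq j : measurable_fun setT (fun w => (sqnorm (x j 0 w))%:E).
  by apply/measurable_EFinP; apply: measurable_sqnorm; exact: mx0.
have mEJp j : measurable_fun setT (fun w => EJ j (p w)) by exact: measurableT_comp.
have mZ : measurable_fun setT Z.
  apply: emeasurable_funD; last exact: emeasurable_sum.
  by apply: emeasurable_funD => //; exact: emeasurable_sum.
have Z0 w : (0 <= Z w)%E.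
  rewrite !adde_ge0 ?sume_ge0// => j _; by rewrite lee_fin sqnorm_ge0.
have EZ : (\int[Pr']_w Z w < +oo)%E.
  rewrite /Z ge0_integralD//; last 4 first.
  - by move=> w _; rewrite adde_ge0// sume_ge0// => j _; rewrite lee_fin sqnorm_ge0.
  - by apply: emeasurable_funD => //; exact: emeasurable_sum.
  - by move=> w _; rewrite sume_ge0.
  - exact: emeasurable_sum.
  rewrite ge0_integralD//; last 2 first.
  - by move=> w _; rewrite sume_ge0// => j _; rewrite lee_fin sqnorm_ge0.
  - exact: emeasurable_sum.
  rewrite integral_cst//= probability_setT mule1.
  rewrite !ge0_integral_sum//; last by move=> j w _; rewrite lee_fin sqnorm_ge0.
  rewrite !lte_add_pinfty ?ltry//; apply: lte_sum_pinfty => j _ //.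
  by rewrite (extension_integral ext).
rewrite /total_energy; apply: lte_sum_pinfty => i _.
pose h t w := expR (- rho * t) * (sqnorm (x i t w) + sqnorm (u t (x i t w))).
have h0 t w : 0 <= h t w by rewrite mulr_ge0 ?expR_ge0// addr_ge0 ?sqnorm_ge0.
have mh t : 0 <= t -> measurable_fun setT (h t).
  move=> t0; have [mx _ _] := cl i.
  have mM m (M : 'M[R]_(m, n)) (v : T' -> 'cV[R]_n) : vmeasurable v -> vmeasurable (fun w => M *m v w).
    move=> mv j; under eq_fun do rewrite mxE.
    by apply: measurable_sum => k; apply: measurable_funM.
  have mD (v : T' -> 'cV[R]_n) (c : 'cV[R]_n) : vmeasurable v -> vmeasurable (fun w => v w + c).
    by move=> mv j; under eq_fun do rewrite mxE; apply: measurable_funD.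
  apply: measurable_funM => //; apply: measurable_funD; apply: measurable_sqnorm.
    exact: mx.
  rewrite /u /control_law => j; under eq_fun do rewrite mxE.
  apply: measurableT_comp => //; apply: (mM).
  by apply: (mD); apply: (mD); apply: mM; exact: mx.
have cu w : vcontinuous (fun t => control_law B Rw P Pi (cp s) (cp xbar) t (xp w i t)).
  have cM m (M : 'M[R]_(m, n)) (v : R -> 'cV[R]_n) : vcontinuous v -> vcontinuous (fun t => M *m v t).
    by move=> cv; apply: vcontinuousM => //; exact: vcontinuous_cst.
  apply: vcontinuousN; apply: (cM).
  by apply: vcontinuousD => //; apply: vcontinuousD; exact: cM.
have ch w : continuous (fun t : R => h (Num.max t 0) w).
  have -> : (fun t : R => h (Num.max t 0) w) = fun t => expR (- rho * Num.max t 0) *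
      (sqnorm (xp w i t) + sqnorm (control_law B Rw P Pi (cp s) (cp xbar) t (xp w i t))) by [].
  apply: continuousM_fun.
    apply: (@continuous_clip R _ (fun t => expR (- rho * t))).
    by apply: continuous_subspaceT; exact: continuous_expRZ.
  by apply: continuousD_fun; apply: vcontinuous_sqnorm.
have mE := measurable_path_integral mh ch h0.
apply: (@le_lt_trans _ _ (\int[Pr']_w (K%:E * Z w))%E); last first.
  by rewrite ge0_integralZl// lte_mul_pinfty.
apply: ae_ge0_le_integral => //.
- by move=> w _; apply: integral_ge0 => t _; rewrite lee_fin h0.
- by move=> w _; rewrite mule_ge0.
- exact: emeasurable_funM.
apply: filterS hpath => w hw _.
have -> : (\int[mu]_(t in `[0%R, +oo[) (h t w)%:E = \int[mu]_(t in `[0%R, +oo[) (h (Num.max t 0) w)%:E)%E.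
  by apply: eq_integral => t; rewrite inE/= in_itv/= andbT => /max_idPl ->.
apply: half_line_integral_le => // t t0.
have := hK (xp w) (fun j t => J j (Num.max t 0) (p w)) (fun j => @cxp w j) (fun j => cJ j (p w)) hw i t t0.

have -> : prim (fun v => expR (- rho * v) * (sqnorm (xp w i v) +
    sqnorm (control_law B Rw P Pi (cp s) (cp xbar) v (xp w i v)))) t = prim (fun t => h (Num.max t 0) w) t.
  apply: eq_in_prim => // v /andP[v0 _].
  by rewrite /h /u /xp /cp /control_law (max_idPl v0).
rewrite -lee_fin EFinM => /le_trans; apply; rewrite lee_wpmul2l ?lee_fin//.
rewrite 2!EFinD -!sumEFin; apply: leeD; first by rewrite /xp maxxx.
apply: lee_sum => j _.
have -> : EJ j (p w) = (\int[mu]_(t in `[0%R, +oo[) (energy_density rho (fun t : R => J j (Num.max t 0) (p w)) t)%:E)%E.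
  by apply: eq_integral => v; rewrite inE/= in_itv/= andbT /energy_density => /max_idPl ->.
apply: prim_le_half_line => //; first exact: continuous_energy_density.
by move=> v; exact: energy_density_ge0.
Qed.

End closed_loop_expectation.

(** * Explicit closed-loop solutions *)

Section integrable_exponential.
Context {R : realType} {n : nat}.
Implicit Types (M : 'M[R]_n).

(** For an eigenvector a + i b of the shifted matrix with real part al, F = exp(- rho t)(|u|^2 +
    |v|^2) satisfies F' = 2 al F. If al >= 0, then F stays above F(0) > 0 and its integral up to t
    is at least F(0) t, which is unbounded. *)
Lemma L2rho_mexp_hurwitz (rho : R) M :
  (forall a, L2rho rho (fun t => mexp M t *m a)) -> hurwitz (M - (rho / 2)%:M).
Proof.
move=> hL; apply/hurwitzP => al be a b.
rewrite !mulmxBl !mul_scalar_mx => hMa hMb ab0; rewrite ltNge; apply/negP => al0.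
pose al' := al + rho / 2.
have {}hMa : M *m a = al' *: a - be *: b.
  by rewrite /al' scalerDl -[LHS](subrK ((rho / 2) *: a)) hMa addrAC.
have {}hMb : M *m b = be *: a + al' *: b.
  by rewrite /al' scalerDl -[LHS](subrK ((rho / 2) *: b)) hMb addrA.
pose u t := mexp M t *m a; pose v t := mexp M t *m b.
have dU (c : 'cV[R]_n) t : is_vderive (fun t => mexp M t *m c) t (mexp M t *m (M *m c)).
  have := is_vderiveM (is_vderive_mexp M t) (is_vderive_cst c t).
  by rewrite mulmx0 addr0 mexp_comm -mulmxA.
have cU c : vcontinuous (fun t => mexp M t *m c) := is_vderive_continuous (dU c).
have cu : vcontinuous u := cU a; have cv : vcontinuous v := cU b.
pose F t := energy_density rho u t + energy_density rho v t.
have dF (t : R) : is_derive t 1 F (2 * al * F t).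
  have s1 : symmetric_mx (1%:M : 'M[R]_n) by rewrite /symmetric_mx trmx1.
  have eF : F = fun x => expR (- rho * x) * bform 1%:M (u x) (u x)
                      + expR (- rho * x) * bform 1%:M (v x) (v x).
    by apply/funext => x; rewrite /F /energy_density !sqnormE.
  have -> : 2 * al * F t = expR (- rho * t) * (- rho * bform 1%:M (u t) (u t)
      + 2 * bform 1%:M (u t) (mexp M t *m (M *m a)))
    + expR (- rho * t) * (- rho * bform 1%:M (v t) (v t)
      + 2 * bform 1%:M (v t) (mexp M t *m (M *m b))).
    rewrite hMa hMb mulmxBr mulmxDr -!scalemxAr -/(u t) -/(v t).
    rewrite bformDr bformNr bformDr !bformZr eF (bformC (v t) (u t) s1) /al'; lra.
  by rewrite eF; apply: is_deriveD; apply: is_derive_weighted_form => //; exact: dU.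
have cF : continuous F := is_derive_continuous dF.
have F0 t : 0 <= F t by rewrite addr_ge0 ?energy_density_ge0.
have F0gt : 0 < F 0.
  rewrite /F /energy_density mulr0 expR0 !mul1r /u /v mexp0 !mul1mx.
  have := sqnorm_ge0 a; have := sqnorm_ge0 b.
  by move: ab0; rewrite -!sqnorm_gt0 => /orP[]; lra.
have Fge t : 0 <= t -> F 0 <= F t.
  move=> t0; have dG (x : R) : is_derive x 1 (fun x => - F x) (- (2 * al * F x)).
    exact: is_deriveN.
  have hx (x : R) : 0 < x < t -> - (2 * al * F x) <= 0.
    by move=> _; rewrite oppr_le0 !mulr_ge0.
  by have := le_is_derive dG hx t0; rewrite lerN2.

have /(L2rhoP _ cu)[K1 hK1] := hL a; have /(L2rhoP _ cv)[K2 hK2] := hL b.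
(* At this time F(0) t exceeds the sum of the two energy bounds. *)
pose t := (`|K1| + `|K2| + 1) / F 0.
have t0 : 0 <= t by apply: divr_ge0; [rewrite !addr_ge0|exact: ltW].
have : F 0 * t
 <= K1 + K2.
  apply: (le_trans _ (lerD (hK1 t t0) (hK2 t t0))).
  have e1 := continuous_energy_density rho cu; have e2 := continuous_energy_density rho cv.
  rewrite -primD// -/F.
  have -> : F 0 * t = prim (fun=> F 0) t.
    rewrite primE// Rintegral_cst//= lebesgue_measure_itv/= lte_fin.
    by move: t0; rewrite le_eqVlt => /predU1P[<-|->] /=; rewrite ?ltxx ?subr0 ?mulr0.

  by apply: le_prim => //; [exact: cst_continuous|move=> x /andP[x0 _]; exact: Fge].
rewrite /t mulrCA mulfV ?gt_eqF// mulr1.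
have := ler_norm K1; have := ler_norm K2; lra.
Qed.

End integrable_exponential.

Section path_primitive.
Context {d : measure_display} {T : measurableType d} {R : realType}.
Local Notation mu := (@lebesgue_measure R).

(** Joint measurability and Tonelli's theorem handle nonnegative integrands; a signed one is h + |h|
    minus |h|. *)
Lemma measurable_path_prim (h : R -> T -> R) t : 0 <= t ->
  (forall t, 0 <= t -> measurable_fun setT (h t)) ->
  (forall w, continuous (fun t : R => h (Num.max t 0) w)) ->
  measurable_fun setT (fun w => prim (fun v => h (Num.max v 0) w) t).
Proof.
move=> t0.
have pos (g : R -> T -> R) : (forall t, 0 <= t -> measurable_fun setT (g t)) ->
    (forall w, continuous (fun t : R => g (Num.max t 0) w)) -> (forall t w, 0 <= g t w) ->
    measurable_fun setT (fun w => prim (fun v => g (Num.max v 0) w) t).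
  move=> mg cg g0.
  pose F (z : T * measurableTypeR R) : \bar R :=
    ((if 0 <= z.2 then g z.2 z.1 else 0) * \1_(`[0, t]%classic : set R) z.2)%:E.
  have mF : measurable_fun setT F.
    apply/measurable_EFinP; apply: measurable_funM; first exact: measurable_continuous_paths.
    apply: (@measurableT_comp _ _ _ _ _ _ (\1_(`[0, t]%classic : set R) : measurableTypeR R -> R)).
      exact: measurable_indic.
    exact: measurable_snd.
  have F0 z : (0 <= F z)%E by rewrite /F lee_fin mulr_ge0//; case: ifP.
  have E w : prim (fun v => g (Num.max v 0) w) t = fine (\int[mu]_v F (w, v))%E.
    rewrite primE// /Rintegral; congr fine; rewrite integral_mkcond; apply: eq_integral => v _.
    rewrite patchE /F/= indicE mem_setE in_itv/=.
    by case: ifP => [/andP[v0 _]|_]; rewrite ?mulr0// v0 mulr1 (max_idPl v0).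
  under eq_fun do rewrite E.
  apply: (measurableT_comp (f := fine)) => //.
  exact: (@measurable_fun_fubini_tonelli_F _ _ T (measurableTypeR R) R mu F).
move=> mh ch.
have cn w : continuous (fun t : R => `|h (Num.max t 0) w|).
  by move=> x; apply: cvg_norm; exact: ch.
have -> : (fun w => prim (fun v => h (Num.max v 0) w) t) = fun w =>
    prim (fun v => h (Num.max v 0) w + `|h (Num.max v 0) w|) t -
    prim (fun v => `|h (Num.max v 0) w|) t.
  by apply/funext => w; rewrite primD// addrK.
apply: measurable_funB.
  apply: (pos (fun t w => h t w + `|h t w|)).
  - by move=> x x0; apply: measurable_funD; [exact: mh|apply: measurableT_comp => //; exact: mh].
  - by move=> w; exact: continuousD_fun.
  - by move=> x w; rewrite -lerBlDr sub0r; have := ler_norm (- h x w); rewrite normrN; lra.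
apply: (pos (fun t w => `|h t w|)) => //.
by move=> x x0; apply: measurableT_comp => //; exact: mh.
Qed.

End path_primitive.

Section explicit_solutions.
Context {R : realType} {n r N : nat}.
Variables (A G P Pi : 'M[R]_n) (B : 'M[R]_(n, r)) (Rw : 'M[R]_r).
Variables (x0 : 'cV[R]_n) (s xbar f : R -> 'cV[R]_n).
Hypothesis N0 : (0 < N)%N.
Hypotheses (cs : vcontinuous s) (cX : vcontinuous xbar) (cf : vcontinuous f).
Local Notation M1 := (A - B *m invmx Rw *m B^T *m P).
Local Notation M2 := (A - B *m invmx Rw *m B^T *m P + G).

Lemma vcontinuous_mulmx m p (M : 'M[R]_(m, p)) (u : R -> 'cV[R]_p) :
  vcontinuous u -> vcontinuous (fun v => M *m u v).
Proof. by move=> cu; apply: vcontinuousM => //; exact: vcontinuous_cst. Qed.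

Lemma lin_ode_path (M : 'M[R]_n) c g t : vcontinuous g -> 0 <= t ->
  lin_ode M c g t = c + vprim (fun v => M *m lin_ode M c g v + g v) t.
Proof.
move=> cg t0; have cz := @vcontinuous_lin_ode R n M c g cg.
rewrite -{2}(lin_ode0 M c g); apply: within_vderive_vprim => //.
- exact: within_vcontinuous.
- by apply: vcontinuousD => //; exact: vcontinuous_mulmx.
- by move=> v _; apply: is_vderive_derivable; exact: is_vderive_lin_ode.
Qed.

Lemma lin_ode_sum (M : 'M[R]_n) (g : 'I_N -> R -> 'cV[R]_n) t : (forall i, vcontinuous (g i)) ->
  0 <= t -> \sum_i lin_ode M 0 (g i) t = lin_ode M 0 (fun v => \sum_i g i v) t.
Proof.
move=> cg t0; rewrite /lin_ode -mulmx_sumr; congr (_ *m _).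
rewrite !add0r; under eq_bigr do rewrite add0r.
rewrite -vprim_sum//; last by move=> i; apply: vcontinuousM => //; exact: vcontinuous_mexpN.
by congr vprim; apply/funext => v; rewrite mulmx_sumr.
Qed.

Lemma lin_ode_zero (M : 'M[R]_n) t : 0 <= t -> lin_ode M 0 (fun=> 0) t = 0.
Proof.
move=> t0; rewrite /lin_ode add0r.
have -> : (fun v => mexp M (- v) *m (0 : 'cV[R]_n)) = fun v => 0 *: (0 : 'cV[R]_n).
  by apply/funext => v; rewrite mulmx0 scaler0.
by rewrite vprimZ ?scale0r ?mulmx0//; exact: vcontinuous_cst.
Qed.

Definition offset (v : R) := f v - B *m invmx Rw *m B^T *m ((Pi - P) *m xbar v + s v).

Lemma vcontinuous_offset : vcontinuous offset.
Proof.
apply: vcontinuousB => //; apply: vcontinuous_mulmx; apply: vcontinuousD => //.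
exact: vcontinuous_mulmx.
Qed.

Lemma drift_offset (x : 'I_N -> R -> 'cV[R]_n) i v :
  drift A G P Pi B Rw s xbar f x i v = M1 *m x i v + G *m mean (x^~ v) + offset v.
Proof.
rewrite driftE /offset; move: (_ *m x i v) (G *m _) (_ *m (_ + _)) (f v) => a b c e.
by apply/matrixP => k l; rewrite !mxE; lra.
Qed.

Section paths.
Variable J : 'I_N -> R -> 'cV[R]_n.
Hypotheses (cJ : forall i, vcontinuous (J i)) (J0 : forall i, J i 0 = 0).

Let mJ v := mean (J^~ v).
Let cmJ : vcontinuous mJ := vcontinuous_mean cJ.

(** With all initial states equal to x0, mean and deviations decouple, with matrices Abar + G and
    Abar. Each is a solution of the equation from which the noise has been subtracted, plus the
    noise. *)
Definition base_mean (t : R) := lin_ode M2 x0 (fun v => M2 *m mean (J^~ v) + offset v) t + mean (J^~ t).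

Definition base_dev (i : 'I_N) (t : R) :=
  lin_ode M1 0 (fun v => M1 *m (J i v - mean (J^~ v))) t + (J i t - mean (J^~ t)).

Definition base (i : 'I_N) (t : R) := base_mean t + base_dev i t.

Let c2 : vcontinuous (fun v => M2 *m mJ v + offset v).
Proof. by apply: vcontinuousD; [exact: vcontinuous_mulmx|exact: vcontinuous_offset]. Qed.

Let c1 i : vcontinuous (fun v => M1 *m (J i v - mJ v)).
Proof. by apply: vcontinuous_mulmx; exact: vcontinuousB. Qed.

Lemma vcontinuous_base_mean : vcontinuous base_mean.
Proof. by apply: vcontinuousD => //; exact: vcontinuous_lin_ode. Qed.

Lemma vcontinuous_base_dev i : vcontinuous (base_dev i).
Proof. by apply: vcontinuousD; [exact: vcontinuous_lin_ode|exact: vcontinuousB]. Qed.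

Lemma vcontinuous_base i : vcontinuous (base i).
Proof.
by apply: vcontinuousD; [exact: vcontinuous_base_mean|exact: vcontinuous_base_dev].
Qed.

Lemma base_mean_path t : 0 <= t ->
  base_mean t = x0 + vprim (fun v => M2 *m base_mean v + offset v) t + mJ t.
Proof.
move=> t0; have -> : (fun v => M2 *m base_mean v + offset v) =
    fun v => M2 *m lin_ode M2 x0 (fun v => M2 *m mJ v + offset v) v + (M2 *m mJ v + offset v).
  by apply/funext => v; rewrite /base_mean [in LHS](mulmxDr M2) -[LHS]addrA.
by rewrite -(lin_ode_path M2 x0 c2 t0).
Qed.

Lemma base_dev_path i t : 0 <= t ->
  base_dev i t = vprim (fun v => M1 *m base_dev i v) t + (J i t - mJ t).
Proof.
move=> t0; have -> : (fun v => M1 *m base_dev i v) =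
    fun v => M1 *m lin_ode M1 0 (fun v => M1 *m (J i v - mJ v)) v + M1 *m (J i v - mJ v).
  by apply/funext => v; rewrite /base_dev [in LHS](mulmxDr M1).
by rewrite -[vprim _ t]add0r -(lin_ode_path M1 0 (@c1 i) t0).


Qed.

Lemma sum_deviation (y : 'I_N -> 'cV[R]_n) : \sum_i (y i - mean y) = 0.
Proof.
rewrite big_split/= sumr_const card_ord mulNrn /mean scalerMnl.
by rewrite -(mulr_natr N%:R^-1) mulVf ?pnatr_eq0 -?lt0n// scale1r subrr.
Qed.

(** The deviations add up to a linear equation with zero input and zero initial value; this makes
    [base_mean] the true mean of [base], as the coupling in the drift demands. *)
Lemma mean_base_dev t : 0 <= t -> mean (base_dev^~ t) = 0.
Proof.
move=> t0; rewrite /mean /base_dev big_split/= sum_deviation addr0 lin_ode_sum//.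
have -> : (fun v => \sum_i M1 *m (J i v - mean (J^~ v))) = fun=> 0.
  by apply/funext => v; rewrite -mulmx_sumr sum_deviation mulmx0.
by rewrite lin_ode_zero// scaler0.
Qed.

Lemma mean_cst (c : 'cV[R]_n) : mean (fun _ : 'I_N => c) = c.
Proof.
rewrite /mean sumr_const card_ord -scalerMnr scalerMnl.
by rewrite -(mulr_natr N%:R^-1) mulVf ?pnatr_eq0 -?lt0n// scale1r.
Qed.

Lemma meanD (y z : 'I_N -> 'cV[R]_n) : mean (fun i => y i + z i) = mean y + mean z.
Proof. by rewrite /mean big_split scalerDr. Qed.

Lemma meanZ k (y : 'I_N -> 'cV[R]_n) : mean (fun i => k *: y i) = k *: mean y.
Proof. by rewrite /mean -scaler_sumr !scalerA mulrC. Qed.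

Lemma mean_base t : 0 <= t -> mean (base^~ t) = base_mean t.
Proof. by move=> t0; rewrite /base meanD mean_cst mean_base_dev// addr0. Qed.

Section perturbation.
Variables (i0 : 'I_N) (a : 'cV[R]_n).

(* The displacement of agent [i] when the initial state of agent [i0] is
   displaced by [a]: the closed loop is affine in the initial states. *)
Definition response (i : 'I_N) (t : R) : 'cV[R]_n :=
  mexp M2 t *m (N%:R^-1 *: a) + mexp M1 t *m ((i == i0)%:R *: a - N%:R^-1 *: a).

Lemma mean_response t : mean (response^~ t) = mexp M2 t *m (N%:R^-1 *: a).
Proof.
rewrite /response meanD mean_cst /mean -mulmx_sumr.
have -> : \sum_(i < N) ((i == i0)%:R *: a - N%:R^-1 *: a) = 0.
  have e : N%:R^-1 *: a = mean (fun i => (i == i0)%:R *: a).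
    rewrite /mean (bigD1 i0)//= eqxx scale1r big1 ?addr0// => i /negbTE ->.
    by rewrite scale0r.
  by under eq_bigr do rewrite e; exact: sum_deviation.
by rewrite mulmx0 scaler0 addr0.
Qed.

Lemma is_vderive_response i t :
  is_vderive (response i) t (M1 *m response i t + G *m mean (response^~ t)).
Proof.
rewrite mean_response; have h (M : 'M[R]_n) (c : 'cV[R]_n) : is_vderive (fun t => mexp M t *m c) t (M *m (mexp M t *m c)).
  have := is_vderiveM (is_vderive_mexp M t) (is_vderive_cst c t).
  by rewrite mulmx0 addr0 -mulmxA.
have := is_vderiveD (h M2 (N%:R^-1 *: a)) (h M1 ((i == i0)%:R *: a - N%:R^-1 *: a)).
rewrite /response; set y := mexp M2 t *m _; set z := mexp M1 t *m _.
by rewrite (mulmxDl M1 G) [in X in _ -> X](mulmxDr M1) (addrAC (M1 *m y)); exact.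

Qed.

Lemma vcontinuous_response i : vcontinuous (response i).
Proof. exact: is_vderive_continuous (is_vderive_response i). Qed.

Lemma response0 i : response i 0 = (i == i0)%:R *: a.
Proof. by rewrite /response !mexp0 !mul1mx addrC subrK. Qed.

Definition perturbed (k : R) (i : 'I_N) (t : R) := base i t + k *: response i t.

Lemma vcontinuous_perturbed k i : vcontinuous (perturbed k i).
Proof.
apply: vcontinuousD; first exact: vcontinuous_base.
by apply: vcontinuousZ; exact: vcontinuous_response.
Qed.

Lemma perturbed0 k i : perturbed k i 0 = x0 + k *: ((i == i0)%:R *: a).
Proof.
rewrite /perturbed response0 /base /base_mean /base_dev !lin_ode0 J0.
have -> : mean (J^~ 0) = 0.
  by rewrite (_ : J^~ 0 = fun=> 0) ?mean_cst//; apply/funext => j; exact: J0.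
by rewrite subrr !addr0.
Qed.

(** Superposition: [base] carries the noise and the inputs s, xbar and f, while [response] solves
    the homogeneous linear system. *)
Lemma perturbed_path k i t : 0 <= t -> perturbed k i t = perturbed k i 0 +
  vprim (drift A G P Pi B Rw s xbar f (perturbed k) i) t + J i t.
Proof.
move=> t0; rewrite perturbed0 {1}/perturbed {1}/base base_mean_path// base_dev_path//.
have cr := @vcontinuous_response.
have cbm := vcontinuous_base_mean; have cbd := @vcontinuous_base_dev i.
have cmr : vcontinuous (fun v => mean (response^~ v)) by exact: vcontinuous_mean.
have cR : vcontinuous (fun v => M1 *m response i v + G *m mean (response^~ v)).
  by apply: vcontinuousD; exact: vcontinuous_mulmx.
have -> : response i t = (i == i0)%:R *: a +
    vprim (fun v => M1 *m response i v + G *m mean (response^~ v)) t.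
  rewrite -response0; apply: within_vderive_vprim => //.
    exact: within_vcontinuous.
  by move=> v _; apply: is_vderive_derivable; exact: is_vderive_response.
have -> : vprim (drift A G P Pi B Rw s xbar f (perturbed k) i) t =
    vprim (fun v => M2 *m base_mean v + offset v) t +
    vprim (fun v => M1 *m base_dev i v) t +
    k *: vprim (fun v => M1 *m response i v + G *m mean (response^~ v)) t.
  have cM1 : vcontinuous (fun v => M1 *m base_dev i v) by exact: vcontinuous_mulmx.
  have cM2 : vcontinuous (fun v => M2 *m base_mean v + offset v).
    by apply: vcontinuousD; [exact: vcontinuous_mulmx|exact: vcontinuous_offset].
  rewrite -vprimZ// -vprimD// -vprimD//; last 2 first.
  - exact: vcontinuousD.
  - exact: vcontinuousZ.
  apply: eq_vprim => // v /andP[v0 _].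
  rewrite drift_offset /perturbed meanD meanZ mean_base// /base.
  move: (base_mean v) (base_dev i v) (response i v) (mean (response^~ v)) (offset v) => y1 y2 y3 y4 y5.
  rewrite (mulmxDl M1 G) !(mulmxDr M1) !(mulmxDr G) -!scalemxAr.
  move: (M1 *m y1) (M1 *m y2) (M1 *m y3) (G *m y1) (G *m y4) => b1 b2 b3 b4 b5.
  by apply/matrixP => j l; rewrite !mxE; lra.
move: (vprim _ t) (vprim _ t) (vprim _ t) (mJ t) (J i t) => b1 b2 b3 b4 b5.
by apply/matrixP => j l; rewrite !mxE; lra.
Qed.

End perturbation.

End paths.
End explicit_solutions.

Section measurable_solutions.
Context {R : realType} {n : nat} {d : measure_display} {T : measurableType d}.

Lemma vmeasurableD (X Y : T -> 'cV[R]_n) : vmeasurable X -> vmeasurable Y ->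
  vmeasurable (fun w => X w + Y w).
Proof.
by move=> mX mY j; under eq_fun do rewrite mxE; apply: measurable_funD.
Qed.

Lemma vmeasurable_cst (c : 'cV[R]_n) : vmeasurable (fun _ : T => c).
Proof. by move=> j; exact: measurable_cst. Qed.

Lemma vmeasurableZ k (X : T -> 'cV[R]_n) : vmeasurable X -> vmeasurable (fun w => k *: X w).
Proof. by move=> mX j; under eq_fun do rewrite mxE; apply: measurable_funM. Qed.

Lemma vmeasurable_sum (I : Type) (l : seq I) (X : I -> T -> 'cV[R]_n) :
  (forall i, vmeasurable (X i)) -> vmeasurable (fun w => \sum_(i <- l) X i w).
Proof. by move=> mX j; under eq_fun do rewrite summxE; apply: measurable_sum => i; exact: mX. Qed.

Lemma vmeasurableM m (M : 'M[R]_(m, n)) (X : T -> 'cV[R]_n) : vmeasurable X ->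
  vmeasurable (fun w => M *m X w).
Proof.
move=> mX j; under eq_fun do rewrite mxE.
by apply: measurable_sum => k; apply: measurable_funM.
Qed.

Lemma vmeasurable_lin_ode (M : 'M[R]_n) c (h : R -> T -> 'cV[R]_n) t : 0 <= t ->
  (forall v, 0 <= v -> vmeasurable (h v)) ->
  (forall w, vcontinuous (fun v : R => h (Num.max v 0) w)) ->
  vmeasurable (fun w => lin_ode M c (fun v => h (Num.max v 0) w) t).
Proof.
move=> t0 mh ch; rewrite /lin_ode; apply: vmeasurableM.
apply: vmeasurableD; first exact: vmeasurable_cst.
move=> j; under eq_fun do rewrite mxE.
have -> : (fun w => prim (fun v => (mexp M (- v) *m h (Num.max v 0) w) j 0) t) =
  fun w => prim (fun v => (fun v w => (mexp M (- v) *m h v w) j 0) (Num.max v 0) w) t.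
  by apply/funext => w; apply: eq_in_prim => // v /andP[v0 _]; rewrite (max_idPl v0).
apply: (@measurable_path_prim _ T R (fun v w => (mexp M (- v) *m h v w) j 0) t t0).
  by move=> v v0; exact: (vmeasurableM _ (mh v v0)).
move=> w; have cE : vcontinuous (fun v : R => mexp M (- Num.max v 0)).
  apply: (@vcontinuous_clip R n n (fun v => mexp M (- v))).
  by apply: within_vcontinuous; exact: vcontinuous_mexpN.
exact: (vcontinuousM cE (ch w)).
Qed.

End measurable_solutions.

(** * Extension of the probability space by a coin *)

Section coin_toss.
Context {R : realType} {d : measure_display} {T : measurableType d}.
Variable P : probability T R.

Definition coin : probability bool R := bernoulli_prob (2^-1).

Definition with_coin : probability (T * bool)%type R := (P \x coin)%E.

Lemma coinE (C : set bool) : coin C = ((2^-1)%:E * \d_true C + (2^-1)%:E * \d_false C)%E.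
Proof.
transitivity (bernoulli_prob (2^-1 : R) C); first by [].
rewrite bernoulli_probE; last by rewrite invr_ge0 ler0n/= invf_le1// ler1n.
congr (_ + _%:E * _)%E; transitivity (1 - 2^-1 : R); [by []|lra].
Qed.

Lemma coin1 b : coin [set b] = (2^-1)%:E.
Proof.
rewrite coinE !diracE; case: b.
  by rewrite mem_set// memNset//= mule1 mule0 adde0.
by rewrite memNset// mem_set//= mule1 mule0 add0e.
Qed.

Lemma with_coinE (E : set T) (C : set bool) : measurable E ->
  with_coin (fst @^-1` E `&` snd @^-1` C) = (P E * coin C)%E.
Proof.
move=> mE; rewrite (_ : _ `&` _ = E `*` C); last by apply/seteqP; split => -[].
exact: product_measure1E.
Qed.

Lemma with_coin_snd (C : set bool) : with_coin (snd @^-1` C) = coin C.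
Proof.
by rewrite -[LHS]/(with_coin _) -[snd @^-1` C]setTI -(preimage_setT fst) with_coinE// probability_setT mul1e.
Qed.

Lemma with_coin_extension : prob_extension P with_coin fst.
Proof.
split=> [|E mE]; first exact: measurable_fst.
by rewrite -[fst @^-1` E]setIT -(preimage_setT snd) with_coinE// probability_setT mule1.
Qed.

Definition sgn (b : bool) : R := (-1) ^+ b.

Lemma measurable_sgn : measurable_fun (setT : set (T * bool)) (fun z => sgn z.2).
Proof. by apply: (@measurableT_comp _ _ _ _ _ _ sgn) => //; exact: measurable_snd. Qed.

Lemma sigma_of_snd (I : Type) (D : set I) (X : I -> bool -> R) E :
  sigma_of D (fun i (z : T * bool) => X i z.2) E -> exists C : set bool, E = snd @^-1` C.
Proof.
move=> hE; have : preimage_set_system setT snd (setT : set (set bool)) E.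
  move: hE; apply: smallest_sub.
    apply: sigma_algebra_preimage; split=> //.
  by move=> A [i Di [B mB <-]]; exists (X i @^-1` B); rewrite // setTI.
by move=> [C _ <-]; exists C; rewrite setTI.
Qed.

Lemma sigma_of_fst (I : Type) (D : set I) (X : I -> T -> R) E :
  (forall i, D i -> measurable_fun setT (X i)) ->
  sigma_of D (fun i (z : T * bool) => X i z.1) E -> exists2 F : set T, measurable F & E = fst @^-1` F.
Proof.
move=> mX hE; have : preimage_set_system setT fst (measurable : set (set T)) E.
  move: hE; apply: smallest_sub.
    apply: sigma_algebra_preimage; exact: sigma_algebra_measurable.
  move=> A [i Di [B mB <-]]; exists (X i @^-1` B); last by rewrite !setTI.
  by have := mX i Di measurableT B mB; rewrite setTI.
by move=> [C mC <-]; exists C => //; rewrite setTI.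
Qed.

(** Constants generate the trivial sigma-algebra; this serves for the agents whose initial state is
    deterministic. *)
Lemma sigma_of_cst (I : Type) (D : set I) (c : I -> R) (E : set (T * bool)) :
  sigma_of D (fun i _ => c i) E -> E = set0 \/ E = setT.
Proof.
move=> hE; have : [set F : set (T * bool) | F = set0 \/ F = setT] E; last by [].
move: hE; apply: smallest_sub.
  split; first by left.
    move=> A [->|->]; first by right; rewrite setD0.
    by left; rewrite setDT.
  move=> F hF; have [[k Fk]|h] := pselect (exists k, F k = setT).
    by right; rewrite -subTset -Fk; exact: bigcup_sup.
  left; rewrite -subset0 => z [k _]; have [->//|Fk] := hF k.
  by exfalso; apply: h; exists k.
move=> A [i Di [B mB <-]]; rewrite setTI.
by have [h|h] := pselect (B (c i)); [right|left]; apply/seteqP; split => z.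
Qed.

Section initial_values.
Variables (n N : nat) (x0 a : 'cV[R]_n) (i0 : 'I_N) (W : 'I_N -> R -> T -> R).
Hypothesis mW : forall i t, 0 <= t -> measurable_fun setT (W i t).

Definition coin_initial (i : 'I_N) (z : T * bool) : 'cV[R]_n :=
  x0 + sgn z.2 *: ((i == i0)%:R *: a).

Let measurable_initial i j : measurable_fun setT (fun z => coin_initial i z j 0).
Proof.
rewrite /coin_initial; under eq_fun do rewrite !mxE.
by apply: measurable_funD => //; apply: measurable_funM => //; exact: measurable_sgn.
Qed.

(** Only agent [i0] is random, so independence of the family reduces to trivial events, and the mean
    is x0 by symmetry of the coin. The initial states depend on the coin alone and the Brownian
    motions on the original outcome alone. *)
Lemma coin_initial_admissible :
  admissible_initial with_coin (fun i t => W i t \o fst) x0 coin_initial.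
Proof.
split.
- exact: measurable_initial.
- move=> J E hE.
  have hC i : i != i0 -> E i = set0 \/ E i = setT.
    move=> /negbTE ni; have := hE i; rewrite /coin_initial ni.
    rewrite (_ : (fun j z => _) = fun j (_ : T * bool) => x0 j 0); first exact: sigma_of_cst.
    by apply/funext => j; apply/funext => z; rewrite scale0r scaler0 addr0.
  have [[i [iJ ni Ei]]|h] := pselect (exists i, [/\ i \in J, i != i0 & E i = set0]).
    rewrite (bigD1 i)//= Ei measure0 mul0e.
    rewrite (_ : \bigcap_(i in _) _ = set0) ?measure0//.
    by rewrite -subset0 -Ei; apply: bigcap_inf.
  have hT i : i \in J -> i != i0 -> E i = setT.
    by move=> iJ ni; have [Ei|//] := hC i ni; exfalso; apply: h; exists i.
  have [iJ|niJ] := boolP (i0 \in J).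
    rewrite (bigD1 i0)//= big1 ?mule1; last first.
      by move=> i /andP[iJ' ni]; rewrite hT// probability_setT.
    congr (with_coin _); apply/seteqP; split; first exact: bigcap_inf.
    move=> z hz i /= iJ'; have [->//|ni] := eqVneq i i0.
    by rewrite hT.
  rewrite big1; last first.
    by move=> i iJ'; rewrite hT ?probability_setT//; apply: contraNneq niJ => <-.
  rewrite (_ : \bigcap_(i in _) _ = setT) ?probability_setT//.
  apply/seteqP; split => // z _ i /= iJ'.
  by rewrite hT//; apply: contraNneq niJ => <-.
- move=> i j; rewrite unlock.
  pose k := (i == i0)%:R * a j 0.
  pose A : set (T * bool) := snd @^-1` [set true].
  have mA : measurable A by rewrite -[A]setTI; exact: measurable_snd.
  (* [sgn] is 1 at [false] and -1 at [true], so the coordinate is x0 + k plus a variable equal to -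
     2 k with probability 1/2 and to 0 otherwise, of mean - k. *)
  pose Y (z : T * bool) := if z.2 then - 2 * k else 0.
  have mb : measurable_fun (setT : set (T * bool)) (fun z => z.2) by exact: measurable_snd.
  have sY : sqint with_coin Y := sqint_mulbool mb (sqint_cst with_coin (- 2 * k)).
  have E z : coin_initial i z j 0 = (x0 j 0 + k) + Y z.
    by case: z => w b; rewrite /coin_initial !mxE -/k /Y /sgn; case: b => /=; rewrite ?expr1 ?expr0; lra.
  under eq_integral do rewrite /= E EFinD.

  rewrite integralD//; last 2 first.
  - exact: sqint_integrable1 (sqint_cst with_coin _).
  - exact: sqint_integrable1.
  rewrite integral_cst//= probability_setT mule1.
  have -> : (\int[with_coin]_z (Y z)%:E = \int[with_coin]_(z in A) (- 2 * k)%:E)%E.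
    rewrite [RHS]integral_mkcond; apply: eq_integral => z _.
    by rewrite patchE /Y; case: ifPn => hz; [rewrite mem_set|rewrite memNset//=; exact/negP].
  rewrite integral_cst//= [X in (_ + _ * X)%E](_ : _ = (2^-1)%:E); last first.
    by rewrite -(coin1 true) -with_coin_snd.
  by rewrite -EFinM -EFinD; congr EFin; lra.

- pose c := 2 * (sqnorm x0 + sqnorm a).
  exists (c + 1) => i; rewrite unlock.
  apply: (@le_lt_trans _ _ (\int[with_coin]_z c%:E)%E); last first.
    by rewrite integral_cst//= probability_setT mule1 lte_fin ltrDl.
  apply: ge0_le_integral => //.
  + by move=> z _; rewrite lee_fin sqnorm_ge0.
  + by apply/measurable_EFinP; apply: measurable_sqnorm => j; exact: measurable_initial.
  move=> z _
; rewrite lee_fin /coin_initial (le_trans (sqnormD_le _ _))// ler_pM2l// lerD2l.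
  rewrite !sqnormZ /sgn sqrr_sign mul1r; case: eqP => _; first by rewrite expr1n mul1r.
  by rewrite expr0n/= mul0r sqnorm_ge0.
- move=> E1 E2 h1 h2.
  have [C ->] := @sigma_of_snd _ setT (fun (k : 'I_N * 'I_n) b => (x0 + sgn b *: ((k.1 == i0)%:R *: a)) k.2 0) E1 h1.
  have [|F mF ->] := @sigma_of_fst _ [set k : 'I_N * R | 0 <= k.2] (fun k => W k.1 k.2) E2 _ h2.
    by move=> k; exact: mW.
  rewrite setIC with_coinE// with_coin_snd muleC; congr (_ * _)%E.
  by have [_ ->] := with_coin_extension.
Qed.

End initial_values.
End coin_toss.

(** * Finite energy forces both shifted matrices to be Hurwitz *)

Section finite_energy.
Context {R : realType} {n r N : nat}.
Variables (rho : R) (A G P Pi : 'M[R]_n) (B : 'M[R]_(n, r)) (Rw : 'M[R]_r).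
Variables (x0 : 'cV[R]_n) (s xbar f sigma : R -> 'cV[R]_n).
Hypothesis N1 : (1 < N)%N.
Hypotheses (hs : C_half rho s) (hX : C_half rho xbar) (hf : C_half rho f)
  (hsigma : C_half rho sigma).
Context {d : measure_display} {T : measurableType d}.
Variables (Pr : probability T R) (W : 'I_N -> R -> T -> R).
Hypothesis bW : forall i, brownian Pr (W i).
Local Notation mu := (@lebesgue_measure R).
Local Notation M1 := (A - B *m invmx Rw *m B^T *m P).
Local Notation M2 := (A - B *m invmx Rw *m B^T *m P + G).
Let u := control_law B Rw P Pi s xbar.
Let W' (i : 'I_N) (t : R) : T * bool -> R := W i t \o fst.
Hypothesis finite_energy : forall x : 'I_N -> R -> (T * bool)%type -> 'cV[R]_n,
  admissible_initial (with_coin Pr) W' x0 (fun i => x i 0) ->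
  closed_loop A G B f sigma (with_coin Pr) W' u x ->
  (total_energy rho (with_coin Pr) u x < +oo)%E.

Let N0 : (0 < N)%N. Proof. exact: ltnW. Qed.
Let cp (g : R -> 'cV[R]_n) (t : R) := g (Num.max t 0).
Let cs : vcontinuous (cp s). Proof. exact: vcontinuous_clip hs.1. Qed.
Let cX : vcontinuous (cp xbar). Proof. exact: vcontinuous_clip hX.1. Qed.
Let cf : vcontinuous (cp f). Proof. exact: vcontinuous_clip hf.1. Qed.

Section with_noise.
Variable J : 'I_N -> R -> T -> 'cV[R]_n.
Hypotheses (mJ : forall i t, 0 <= t -> vmeasurable (J i t)) (J0 : forall i w, J i 0 w = 0)
  (cJ : forall i w, vcontinuous (fun t : R => J i (Num.max t 0) w))
  (hJ : forall i t, 0 <= t -> is_wiener_integral Pr sigma (W i) t (J i t)).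
Variables (i0 : 'I_N) (a : 'cV[R]_n).

Let Jp (w : T) (i : 'I_N) (t : R) := J i (Num.max t 0) w.

Let xx (i : 'I_N) (t : R) (z : T * bool) : 'cV[R]_n :=
  perturbed A G P Pi B Rw x0 (cp s) (cp xbar) (cp f) (Jp z.1) i0 a (sgn z.2) i t.

Let cxx i z : vcontinuous (fun t => xx i t z).
Proof. by apply: vcontinuous_perturbed => // j; exact: cJ. Qed.

Let mxx i t : 0 <= t -> vmeasurable (xx i t).
Proof.
move=> t0; have mm v : 0 <= v -> vmeasurable (fun w => mean (fun j => J j v w)).
  by move=> v0; apply: vmeasurableZ; apply: vmeasurable_sum => j; exact: mJ.
have cm w : vcontinuous (fun v : R => mean (fun j => J j (Num.max v 0) w)).
  by apply: vcontinuous_mean => j; exact: cJ.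
have mbm : vmeasurable (fun w => base_mean A G P Pi B Rw x0 (cp s) (cp xbar) (cp f) (Jp w) t).
  apply: vmeasurableD; last first.
    by rewrite /Jp (max_idPl t0); exact: mm.
  apply: (@vmeasurable_lin_ode _ _ _ _ M2 x0 (fun v w => M2 *m mean (fun j => J j v w)
     + offset P Pi B Rw s xbar f v) t t0).
    move=> v v0; apply: vmeasurableD; last exact: vmeasurable_cst.
    by apply: vmeasurableM; exact: mm.
  move=> w; apply: vcontinuousD; first exact: vcontinuous_mulmx.
  have h : vcontinuous (offset P Pi B Rw (cp s) (cp xbar) (cp f)) by exact: vcontinuous_offset.
  exact: h.
have mbd : vmeasurable (fun w => base_dev A P B Rw (Jp w) i t).
  apply: vmeasurableD; last first.
    by rewrite /Jp (max_idPl t0); apply: vmeasurableB; [exact: mJ|exact: mm].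
  apply: (@vmeasurable_lin_ode _ _ _ _ M1 0 (fun v w => M1 *m (J i v w - mean (fun j => J j v w))) t t0).
    by move=> v v0; apply: vmeasurableM; apply: vmeasurableB; [exact: mJ|exact: mm].
  by move=> w; apply: vcontinuous_mulmx; apply: vcontinuousB; [exact: cJ|exact: cm].
have mb : vmeasurable (fun z : T * bool => base A G P Pi B Rw x0 (cp s) (cp xbar) (cp f) (Jp z.1) i t).
  by move=> j; apply: (measurableT_comp ((vmeasurableD mbm mbd) j)); exact: measurable_fst.
apply: vmeasurableD => // j; under eq_fun do rewrite mxE.
by apply: measurable_funM => //; exact: measurable_sgn.
Qed.

Let xx_closed_loop : closed_loop A G B f sigma (with_coin Pr) W' u xx.
Proof.
move=> i; split; first exact: mxx.
  by move=> z; apply: within_vcontinuous; exact: cxx.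
move=> t t0; exists (J i t \o fst); split.
  have mW v : 0 <= v -> measurable_fun setT (W i v) by exact: brownian_measurable.
  exact: (wiener_integral_extension t0 mW (with_coin_extension Pr) (hJ i t0)).
apply: aeW => z j.
have J0' k : Jp z.1 k 0 = 0 by rewrite /Jp maxxx J0.
have cJ' k : vcontinuous (Jp z.1 k) := @cJ k z.1.

rewrite [in LHS]/xx (perturbed_path A G P Pi B Rw x0 N0 cs cX cf cJ' J0' i0 a (sgn z.2) i t0) !mxE.
congr (_ + _ + _); last by rewrite /Jp (max_idPl t0).
rewrite primE//; apply: eq_Rintegral => v; rewrite inE/= in_itv/= => /andP[v0 _].
by rewrite /drift /control_law /cp (max_idPl v0) /u /control_law /average /mean.
Qed.

Let xx_admissible : admissible_initial (with_coin Pr) W' x0 (fun i => xx i 0).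
Proof.
have -> : (fun i => xx i 0) = coin_initial x0 a i0.
  apply/funext => i; apply/funext => z; rewrite /xx perturbed0//.
  by move=> k; rewrite /Jp maxxx.
apply: coin_initial_admissible => i t t0; exact: brownian_measurable.
Qed.

(** Finite expected energy makes almost every path square integrable. For some outcome of the noise
    this holds for both sides of the coin, and half the difference of the two paths is the response,
    the common part [base] cancelling. *)
Lemma L2rho_response i : L2rho rho (response A G P B Rw i0 a i).
Proof.
have := finite_energy xx_admissible xx_closed_loop.
pose h t z := expR (- rho * t) * (sqnorm (xx i t z) + sqnorm (u t (xx i t z))).
have h0 t z : 0 <= h t z by rewrite mulr_ge0 ?expR_ge0// addr_ge0 ?sqnorm_ge0.
pose E z := (\int[mu]_(t in `[0%R, +oo[) (h t z)%:E)%E.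
have E0 z : (0 <= E z)%E by apply: integral_ge0 => t _; rewrite lee_fin.
move=> hfin; have {hfin} Efin : (\int[with_coin Pr]_z E z < +oo)%E.
  apply: le_lt_trans hfin; rewrite /total_energy (bigD1 i)//= leeDl// sume_ge0// => j _.
  apply: integral_ge0 => z _; apply: integral_ge0 => t _.
  by rewrite lee_fin mulr_ge0 ?expR_ge0// addr_ge0 ?sqnorm_ge0.
have mh t : 0 <= t -> measurable_fun setT (h t).
  move=> t0; have mx := mxx i t0.
  apply: measurable_funM => //; apply: measurable_funD; apply: measurable_sqnorm => //.
  rewrite /u /control_law => j; under eq_fun do rewrite mxE.
  apply: measurableT_comp => //; move: j; apply: vmeasurableM.
  by do 2 apply: (vmeasurableD _ (vmeasurable_cst _)); exact: vmeasurableM.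
have cu z : vcontinuous (fun t => control_law B Rw P Pi (cp s) (cp xbar) t (xx i (Num.max t 0) z)).
  have cxm : vcontinuous (fun t : R => xx i (Num.max t 0) z).
    exact: (vcontinuous_clip (within_vcontinuous (@cxx i z))).
  apply: vcontinuousN; apply: vcontinuous_mulmx.
  by apply: vcontinuousD => //; apply: vcontinuousD; exact: vcontinuous_mulmx.
have ch z : continuous (fun t : R => h (Num.max t 0) z).
  have -> : (fun t : R => h (Num.max t 0) z) = fun t => expR (- rho * Num.max t 0) *
      (sqnorm (xx i (Num.max t 0) z) + sqnorm (control_law B Rw P Pi (cp s) (cp xbar) t (xx i (Num.max t 0) z))) by [].
  apply: continuousM_fun.
    apply: (@continuous_clip R _ (fun t => expR (- rho * t))).
    by apply: continuous_subspaceT; exact: continuous_expRZ.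
  apply: continuousD_fun; apply: vcontinuous_sqnorm => //.
  exact: (vcontinuous_clip (within_vcontinuous (@cxx i z))).
have mE : measurable_fun setT E := measurable_path_integral mh ch h0.
have iE : (with_coin Pr).-integrable setT E.
  by apply/integrableP; split=> //; under eq_integral do rewrite gee0_abs//.
have [Z [mZ Z0 hZ]] := integrable_ae measurableT iE.
(* Each side of the coin has probability 1/2, so both sections of the null set Z are null. *)
have Zb b : Pr [set w | Z (w, b)] = 0%E.
  have mp : measurable_fun setT (fun w : T => (w, b)).
    exact: measurable_fun_pair.
  have mZb : measurable [set w | Z (w, b)] by have := mp measurableT Z mZ; rewrite setTI.
  have : (with_coin Pr (fst @^-1` [set w | Z (w, b)] `&` snd @^-1` [set b]) <= 0)%E.
    rewrite -Z0; apply: le_measure; rewrite ?inE//.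
      apply: measurableI; first by rewrite -[_ @^-1` _]setTI; exact: measurable_fst.
      by rewrite -[_ @^-1` _]setTI; exact: measurable_snd.
    by move=> [w c] /= [Zw cb]; rewrite cb.

  rewrite with_coinE// coin1 => h1; apply/eqP; rewrite eq_le measure_ge0 andbT.
  by rewrite -(@pmule_lle0 _ (2^-1)%:E)// lte_fin.
have [w [Zt Zf]] : exists w, ~ Z (w, true) /\ ~ Z (w, false).
  apply: contrapT => hno.
  have mZ2 b : measurable [set w | Z (w, b)].
    have mp : measurable_fun setT (fun w : T => (w, b)) by exact: measurable_fun_pair.
    by have := mp measurableT Z mZ; rewrite setTI.
  have : (Pr setT <= Pr [set w | Z (w, true)] + Pr [set w | Z (w, false)])%E.
    apply: (@le_trans _ _ (Pr ([set w | Z (w, true)] `|` [set w | Z (w, false)]))); last exact: measureU2.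
    apply: le_measure
; rewrite ?inE//; first exact: measurableU.
    move=> w _; have [h1|h1] := pselect (Z (w, true)); first by left.
    by right; apply: contrapT => h2; apply: hno; exists w.
  by rewrite !Zb adde0 probability_setT lee_fin ler10.

have LE b : ~ Z (w, b) -> L2rho rho (fun t => xx i t (w, b)).
  move=> hw; have Ew : (E (w, b) < +oo)%E.
    have : E (w, b) \is a fin_num by apply: contrapT => hn; apply: hw; apply: hZ => /= /(_ I).
    by rewrite ge0_fin_numE.
  apply/(L2rhoP rho (@cxx i (w, b))); exists (fine (E (w, b))) => t t0.
  rewrite -lee_fin fineK ?ge0_fin_numE//.
  have -> : E (w, b) = (\int[mu]_(t in `[0%R, +oo[) (h (Num.max t 0) (w, b))%:E)%E.
    by apply: eq_integral => v; rewrite inE/= in_itv/= andbT => /max_idPl ->.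
  apply: le_trans (prim_le_half_line (ch (w, b)) (fun v => h0 _ _) t0).
  rewrite lee_fin; apply: le_prim => //; first exact: continuous_energy_density.
  move=> v /andP[v0 _]; rewrite (max_idPl v0) /energy_density /h ler_wpM2l ?expR_ge0//.
  by rewrite lerDl sqnorm_ge0.
have cD b : vcontinuous (fun t => xx i t (w, b)) by exact: cxx.
have := L2rhoM (2^-1)%:M (vcontinuousB (cD false) (cD true))
  (L2rhoD (cD false) (vcontinuousN (cD true)) (LE false Zf) (L2rhoN (LE true Zt))).
congr L2rho; apply/funext => t; rewrite mul_scalar_mx /xx /perturbed /sgn/= expr0 expr1.
move: (base _ _ _ _ _ _ _ _ _ _ _ _ _) (response _ _ _ _ _ _ _ _ _) => y1 y2.
by apply/matrixP => j k; rewrite !mxE; lra.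
Qed.

End with_noise.

Lemma finite_energy_hurwitz :
  hurwitz (M1 - (rho / 2)%:M) /\ hurwitz (M2 - (rho / 2)%:M).
Proof.
have csg : vcontinuous (fun t : R => sigma (Num.max t 0)) by exact: vcontinuous_clip hsigma.1.
have [J hJ] := choice (fun i => wiener_path (bW i) csg).
have mJ i t : 0 <= t -> vmeasurable (J i t) by have [h _ _ _ _] := hJ i; exact: h.
have J0 i w : J i 0 w = 0 by have [_ h _ _ _] := hJ i; exact: h.
have cJ i w : vcontinuous (fun t : R => J i (Num.max t 0) w).
  by have [_ _ h _ _] := hJ i; exact: h.
have wJ i t : 0 <= t -> is_wiener_integral Pr sigma (W i) t (J i t).
  by have [_ _ _ h _] := hJ i; exact: h.
have LR := L2rho_response mJ J0 cJ wJ.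
pose i0 := Ordinal N0; pose i1 := Ordinal N1.
have cR i a := @vcontinuous_response R n r N A G P B Rw N0 i0 a i.
(* When agent [i0] is displaced by a, its response and that of the other agent [i1] differ by exp(t
   Abar) a. *)
have L1 a : L2rho rho (fun t => mexp M1 t *m a).
  have := L2rhoD (cR i0 a) (vcontinuousN (cR i1 a)) (LR i0 a i0) (L2rhoN (LR i0 a i1)).
  congr L2rho; apply/funext => t; rewrite /response eqxx scale1r scale0r !mulmxBr mulmx0.
  move: (_ *m _) (_ *m _) (_ *m _) => y1 y2 y3.
  by apply/matrixP => j k; rewrite !mxE; lra.
have c1 (a : 'cV[R]_n) : vcontinuous (fun t => mexp M1 t *m a).
  by apply: vcontinuousM; [exact: vcontinuous_mexp|exact: vcontinuous_cst].
split; first exact: (L2rho_mexp_hurwitz L1).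
apply: L2rho_mexp_hurwitz => a.

(* When [i0] is displaced by N a, agent [i1] responds with exp(t (Abar + G)) a - exp(t Abar) a, and
   the second term is already known to be square integrable. *)
have := L2rhoD (cR i1 (N%:R *: a)) (c1 a) (LR i0 (N%:R *: a) i1) (L1 a).
congr L2rho; apply/funext => t; rewrite /response scale0r sub0r mulmxN scalerA.
by rewrite mulVf ?pnatr_eq0 -?lt0n// scale1r subrK.
Qed.

End finite_energy.

Theorem mainTheorem5 (R : realType) (n r N : nat) (rho : R)
  (A G Gam Q : 'M[R]_n) (B : 'M[R]_(n, r)) (Rw : 'M[R]_r) (eta : 'cV[R]_n)
  (f sigma : R -> 'cV[R]_n) (x0 : 'cV[R]_n) (sqrtQ : 'M[R]_n)
  (d : measure_display) (T : measurableType d) (Pr : probability T R)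
  (W : 'I_N -> R -> T -> R)
  (hN : (2 <= N)%N)
  (hrho : 0 < rho)
  (hR : posdef Rw)
  (hf : C_half rho f)
  (hsigma : C_half rho sigma)
  (hW : indep_brownians Pr W)
  (hQ : psd Q)
  (hsqrtQ : is_psd_sqrt Q sqrtQ)
  (hdetP : detectable (A - (rho / 2)%:M) sqrtQ)
  (hdetPi : detectable (A + G - (rho / 2)%:M) (sqrtQ *m (1%:M - Gam))) :
  let RP := riccati rho A B Rw Q in
  let RPi := riccati rho (A + G) B Rw (Qhat Gam Q) in
  let meanHurwitz (P : 'M[R]_n) :=
    hurwitz ((A - B *m invmx Rw *m B^T *m P) + G - (rho / 2)%:M) in
  let stmt_i :=
    exists (P Pi : 'M[R]_n) (s xbar : R -> 'cV[R]_n),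
      [/\ symmetric_mx P /\ RP P,
          symmetric_mx Pi /\ RPi Pi,
          C_half rho s /\ offset_eq rho A G Gam Q B Rw eta f Pi s,
          C_half rho xbar /\ mean_field_eq A G B Rw f Pi s x0 xbar &
          forall (d' : measure_display) (T' : measurableType d')
                 (Pr' : probability T' R) (p : T' -> T),
            prob_extension Pr Pr' p ->
            let W' := fun i t => W i t \o p in
            let u := control_law B Rw P Pi s xbar in
            forall x : 'I_N -> R -> T' -> 'cV[R]_n,
              admissible_initial Pr' W' x0 (fun i => x i 0) ->
              closed_loop A G B f sigma Pr' W' u x ->
              (total_energy rho Pr' u x < +oo)%E] in
  let stmt_ii :=
    exists P Pi : 'M[R]_n,
      [/\ unique_psd_solution RP P,
          unique_psd_solution RPi Pi &
          meanHurwitz P] in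
  let stmt_iii :=
    [/\ stabilizable (A - (rho / 2)%:M) B,
        stabilizable (A + G - (rho / 2)%:M) B &
        forall P : 'M[R]_n, psd P -> RP P -> meanHurwitz P] in
  (stmt_i <-> stmt_ii) /\ (stmt_ii <-> stmt_iii).
Proof.
move=> RP RPi meanHurwitz stmt_i stmt_ii stmt_iii.
have [[sS pS] SQ] := hsqrtQ.
(* Both weights are Gram matrices, of sqrtQ and of sqrtQ (I - Gam), so the same lemmas serve the two
   Riccati equations, each with its detectability hypothesis. *)
have QC : Q = sqrtQ^T *m sqrtQ by rewrite sS.
have QhC : Qhat Gam Q = (sqrtQ *m (1%:M - Gam))^T *m (sqrtQ *m (1%:M - Gam)).
  by rewrite /Qhat trmx_mul sS -SQ !mulmxA.
have hP P : psd P -> RP P -> hurwitz (A - B *m invmx Rw *m B^T *m P - (rho / 2)%:M).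
  exact: (riccati_hurwitz hR QC hdetP).
have uP P P' : psd P -> psd P' -> RP P -> RP P' -> P = P'.
  exact: (riccati_psd_unique hR QC hdetP).
have uPi P P' : psd P -> psd P' -> RPi P -> RPi P' -> P = P'.
  exact: (riccati_psd_unique hR QhC hdetPi).
(* The feedback - R^-1 B^T P turns A + G into Abar + G. *)
have hstab P : meanHurwitz P -> stabilizable (A + G - (rho / 2)%:M) B.
  move=> hm; exists (- (invmx Rw *m B^T *m P)).
  rewrite mulmxN (mulmxA B) (mulmxA B (invmx Rw)).
  rewrite (_ : _ + _ = A - B *m invmx Rw *m B^T *m P + G - (rho / 2)%:M); first exact: hm.
  move: (B *m _ *m _ *m _) => X.
  by apply/matrixP => i j; rewrite !mxE; lra.
have bW i : brownian Pr (W i) by exact: hW.1.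
split; split.
- move=> [P [Pi [s [xbar [[sP eP] [sPi ePi] [hs offs] [hX mf] hE]]]]].
  (* Statement (i) is applied to one extension, the product with a coin. *)
  have [h1 h2] : hurwitz (A - B *m invmx Rw *m B^T *m P - (rho / 2)%:M) /\ meanHurwitz P.
    apply: (@finite_energy_hurwitz R n r N rho A G P Pi B Rw x0 s xbar f sigma hN hs hX hf hsigma
      d T Pr W bW) => x adm cl.
    exact: (hE _ _ (with_coin Pr) fst (with_coin_extension Pr) x adm cl).
  have pP : psd P by exact: (riccati_hurwitz_psd hR QC sP eP h1).
  (* Statement (ii) asks for a positive semidefinite solution, while that of (i) is only symmetric;
     it is constructed from the stabilizability just obtained. *)
  have [Pi' [pPi' ePi']] := stabilizable_riccati hR QhC (hstab P h2).
  exists P, Pi'; split; last exact: h2.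
  + by split; [exact: pP|exact: eP|move=> P' pP' eP'; exact: uP].
  + by split; [exact: pPi'|exact: ePi'|move=> P' pP' eP'; exact: uPi].
- move=> [P [Pi [[pP eP _] [pPi ePi _] hm]]].
  have h1 := hP P pP eP.
  have hPi := riccati_hurwitz hR QhC hdetPi pPi ePi.
  have [s [cs hs offs]] := offset_eq_solution Gam Q eta hrho hf hPi.
  have [xbar [hX mf]] := mean_field_solution hf hPi x0 cs hs.
  exists P, Pi, s, xbar; split.
  + by split; [exact: pP.1|exact: eP].
  + by split; [exact: pPi.1|exact: ePi].
  + by split.
  + by split.
  move=> d' T' Pr' p ext W' u x [mx0 _ _ [C0 hC0] _] cl.
  apply: (closed_loop_finite_energy (ltnW hN) hrho hs hX hf hsigma mf h1 hm bW ext cl) => //.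
  move=> i; have := hC0 i; rewrite unlock => /lt_trans; apply; exact: ltry.
- move=> [P [Pi [[pP eP _] [pPi ePi _] hm]]]; split.
  + exact: (riccati_stabilizable hR QC hdetP pP eP).
  + exact: (riccati_stabilizable hR QhC hdetPi pPi ePi).
  + by move=> P' pP' eP'; rewrite (uP P' P pP' pP eP' eP); exact: hm.
- move=> [st1 st2 hm].
  have [P [pP eP]] := stabilizable_riccati hR QC st1.
  have [Pi [pPi ePi]] := stabilizable_riccati hR QhC st2.
  exists P, Pi; split; last exact: (hm P pP eP).
  + by split; [exact: pP|exact: eP|move=> P' pP' eP'; exact: uP].
  + by split; [exact: pPi|exact: ePi|move=> P' pP' eP'; exact: uPi].
Qed.
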